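(* There exists a map $(t,u,u')\mapsto\tilde\Gamma(t,u,u')=(x,y,y')$, in the extended phase space, of the form $$x=\gamma\Big(t,-\frac{u'}{u^2},\frac{u^3}{u'^2}\Big),\qquad y=u,$$ $$y'=-u^2\,\eta\Big(t,-\frac{u'}{u^2},\frac{u^3}{u'^2}\Big)=u'\Big[1+\Big(\frac{u'}{u^2}\Big)^4\eta_1\Big(t,-\frac{u'}{u^2},\frac{u^3}{u'^2}\Big)\Big],$$ where, for every $x_0\in\mathbb{C}$ (with suitable $R\ge1$ and $0<\epsilon<1/4$), the functions $\gamma,\eta,\eta_1$ are holomorphic on the polydisk $$\Delta(x_0)=\Big\{(t,v,w)\in\mathbb{C}^3:\ |t-x_0|<1,\ |v|<R^{-1},\ \big|w-\tfrac14\big|<\epsilon\Big\},$$ and which takes the equation $\dfrac{d^2y}{dx^2}=6y^2+x$ into the equation $\dfrac{d^2u}{dt^2}=6u^2$. The transformation $\tilde\Gamma$ is one-to-one on each domain $$\tilde\Delta(x_0)=\Big\{(t,u,u')\in\mathbb{C}^3:\ |t-x_0|<1,\ \Big|\frac{u'}{u^2}\Big|<R^{-1},\ \Big|\frac{u^3}{u'^2}-\frac14\Big|<\epsilon\Big\}.$$ If $u(t)$ is a solution of $\dfrac{d^2u}{dt^2}=6u^2$ such that the set $\mathcal{T}_u=\{(t,v(t),w(t)):\ |t-t_1|<\epsilon'\}$ is included in $\Delta(x_0)$, where $v=-u^{-2}\,\dfrac{du}{dt}$ and $w=u^3\Big(\dfrac{du}{dt}\Big)^{-2}$, then the equality $y(x)=u(t)$,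 with $x=\gamma(t,v(t),w(t))$, defines a solution $y$ of $\dfrac{d^2y}{dx^2}=6y^2+x$ for $x\in\gamma(\mathcal{T}_u)$.
   Context: All variables are complex. ''Extended phase space'' means the space of the independent variable, the dependent variable and its derivative: $(t,u,u')\in\mathbb{C}^3$ with $u'=du/dt$, and $(x,y,y')\in\mathbb{C}^3$ with $y'=dy/dx$. That $\tilde\Gamma$ takes the first equation into the second means that substituting $(x,y,y')=\tilde\Gamma(t,u,u')$ in $d^2y/dx^2=6y^2+x$ (as a first order system in $(y,y')$) yields $d^2u/dt^2=6u^2$ (as a first order system in $(u,u')$). The numbers $R$ and $\epsilon$ may depend on $x_0$, and the same $R,\epsilon$ are used in $\Delta(x_0)$ and in $\tilde\Delta(x_0)$. If $p$ is a pole of $u(t)$, then $v(t)$ and $w(t)$ have removable singularities at $p$, with $v(p)=0$ and $w(p)=1/4$; $v,w$ are understood to be extended to such points, so that solutions $u(t)$ and $y(x)$ may have poles. *)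

(* Defs.v *)
From Stdlib Require Import Reals.
From Coquelicot Require Import Coquelicot.

Open Scope C_scope.

Definition C3 : Type := (C * C * C)%type.

Definition C3_NormedModule : NormedModule C_AbsRing :=
  prod_NormedModule C_AbsRing
    (prod_NormedModule C_AbsRing C_NormedModule C_NormedModule) C_NormedModule.

(* Complex (i.e. C-linear) Frechet differentiability at every point of [D];
   it is used on open sets only, where it is holomorphy in three variables. *)
Definition holomorphic_on (D : C3 -> Prop) (f : C3 -> C) : Prop :=
  forall z : C3, D z ->
    @ex_filterdiff C_AbsRing C3_NormedModule C_NormedModule f
      (@locally C3_NormedModule z).

Definition polydisk (x0 : C) (rho eps : R) (z : C3) : Prop :=
  let '(t, v, w) := z in
  (Cmod (t - x0) < 1 /\ Cmod v < / rho /\ Cmod (w - / RtoC 4) < eps)%R.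

(* Division is total with [a / 0 = 0].  Since [eps < 1/4], the last inequality
   fails when [u = 0] or [u1 = 0], so no such point belongs to the domain. *)
Definition tpolydisk (x0 : C) (rho eps : R) (z : C3) : Prop :=
  let '(t, u, u1) := z in
  (Cmod (t - x0) < 1 /\ Cmod (u1 / u ^ 2) < / rho
   /\ Cmod (u ^ 3 / u1 ^ 2 - / RtoC 4) < eps)%R.

(* The coordinates (t, v, w) = (t, -u'/u^2, u^3/u'^2). *)
Definition tvw (z : C3) : C3 :=
  let '(t, u, u1) := z in (t, - (u1 / u ^ 2), u ^ 3 / u1 ^ 2).

(* A right-hand side [F] stands for the equation y'' = F(x, y), that is, for
   the system dy/dx = y', dy'/dx = F(x, y). *)
Definition F_painleve (x y : C) : C := RtoC 6 * y ^ 2 + x.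
Definition F_elliptic (_ u : C) : C := RtoC 6 * u ^ 2.

(* Substituting (x, y, y') = G (t, u, u') in the system of [F1] yields the
   system of [F2]: along any curve t |-> (u t, u1 t) in the domain [D], the
   system dy/dx = y', dy'/dx = F1(x, y), where the derivatives with respect to
   x are quotients of derivatives with respect to t, holds if and only if
   du/dt = u', du'/dt = F2(t, u). *)
Definition takes_into (G : C3 -> C3) (D : C3 -> Prop) (F1 F2 : C -> C -> C)
    : Prop :=
  forall (t0 : C) (u u1 : C -> C) (du du1 : C),
    D (t0, u t0, u1 t0) ->
    @is_derive C_AbsRing C_NormedModule u t0 du ->
    @is_derive C_AbsRing C_NormedModule u1 t0 du1 ->
    let x  := fun t : C => fst (fst (G (t, u t, u1 t))) in
    let y  := fun t : C => snd (fst (G (t, u t, u1 t))) in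
    let y1 := fun t : C => snd (G (t, u t, u1 t)) in
    (exists dx dy dy1 : C,
        @is_derive C_AbsRing C_NormedModule x t0 dx /\
        @is_derive C_AbsRing C_NormedModule y t0 dy /\
        @is_derive C_AbsRing C_NormedModule y1 t0 dy1 /\
        dx <> 0 /\
        dy / dx = y1 t0 /\
        dy1 / dx = F1 (x t0) (y t0))
    <-> (du = u1 t0 /\ du1 = F2 t0 (u t0)).

(* Functions with poles take values in [option C], with [None] for infinity. *)
Definition finite_value (a : option C) : C :=
  match a with Some z => z | None => 0 end.
Definition reciprocal (a : option C) : C :=
  match a with Some z => / z | None => 0 end.

(* [y] is a solution of y'' = F(x, y), possibly with poles, on the open set [D],
   with derivative [y1].  At a pole, [y] is finite on a punctured neighbourhood
   and 1/y, extended by 0, is complex differentiable; the value there of [y1] is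
   irrelevant. *)
Definition is_solution (F : C -> C -> C) (D : C -> Prop)
    (y : C -> option C) (y1 : C -> C) : Prop :=
  @open C_UniformSpace D /\
  forall x : C, D x ->
    match y x with
    | Some c =>
        @locally C_UniformSpace x (fun s => y s <> None) /\
        @is_derive C_AbsRing C_NormedModule (fun s => finite_value (y s)) x (y1 x) /\
        @is_derive C_AbsRing C_NormedModule y1 x (F x c)
    | None =>
        @locally' C_UniformSpace x (fun s => y s <> None) /\
        @ex_derive C_AbsRing C_NormedModule (fun s => reciprocal (y s)) x
    end.

(* v = -u'/u^2 and w = u^3/u'^2, extended to the poles of [u] by the values 0
   and 1/4.  Where u or u' vanishes, v and w take a conventional value, but then
   w = 0, and (t, v, w) belongs to no [polydisk x0 rho eps] with [eps < 1/4]. *)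
Definition v_of (u : C -> option C) (u1 : C -> C) (t : C) : C :=
  match u t with Some c => - (u1 t / c ^ 2) | None => 0 end.
Definition w_of (u : C -> option C) (u1 : C -> C) (t : C) : C :=
  match u t with Some c => c ^ 3 / u1 t ^ 2 | None => / RtoC 4 end.

Definition T_set (u : C -> option C) (u1 : C -> C) (t1 : C) (r : R) (z : C3)
    : Prop :=
  exists t : C, (Cmod (t - t1) < r)%R /\ z = (t, v_of u u1 t, w_of u u1 t).

Definition image_set (f : C3 -> C) (T : C3 -> Prop) (x : C) : Prop :=
  exists z : C3, T z /\ x = f z.

(* Main.v *)
(** Put [h = u'^2 - 4 u^3], [q = u^(-1/2)] (so that [q = v sqrt w]) and
    [kap = h q^6 = 1/w - 4].  Along a solution of u'' = 6 u^2 with a pole at [p] one has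
    [dt/dq = 2 (4 + kap)^(-1/2)], so the solutions are the curves [p = const, h = const].
    Along a solution of y'' = 6 y^2 + x with [y = q^(-2)] and pole [p] one has
    [y'^2 = 4 y^3 + h + 2 z] with [dz/dy = x], whence [x = p + q (1 + lam)] and
    [y' = -2 q^(-3) (1 + mu)], where [lam], [mu] are power series in [A = p q^4], [B = q^5]
    and [D = kap].  Giving [A], [B], [D] the weights 4, 5, 6, their homogeneous parts obey a
    quadratic recursion, so the series converge near the origin; at [A = B = 0] they give back the
    elliptic solutions.  The required map sends the solution [(p, h)] of the elliptic
    equation to the solution [(p, h)] of the Painleve equation, matching points with the
    same [q]. *)

Require Import Defs.
From Stdlib Require Import Reals Lra Lia Psatz ClassicalEpsilon.
From Coquelicot Require Import Coquelicot.

Open Scope C_scope.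

(** * Complex differentiability *)

(** The polydisk contains the points [v = 0], where [u] and [u'] are infinite. The map is therefore
    written in [q], [p] and [kap], which stay finite there, with nonnegative powers of [q] only. The
    pole position [p] can be as large as [|x0|], but it enters the series through [p q^4] alone, so
    a bound on [q] times [|x0| + 3] is enough; this is why R depends on [x0]. Along an arbitrary
    curve the defects of either system are linear in [dp] and [dh], so the equivalence of the two
    systems comes down to the invertibility of a 2 by 2 matrix, a perturbation of a triangular one.
    The two solutions with the same [(p, h)] are values of the same series at points whose distance
    is of order [q^4]. Hence [gamma - t] and the relative change of [u'] are O(v^4), which is the
    fourth power in the formula for [y']. It also makes [x] a small perturbation of the identity
    along a solution, so that [x] can be inverted on the whole disk, through the poles. *)

Definition approx {T : Type} (d : T -> R) (t0 : T) (f L : T -> C) : Prop :=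
  (exists K : R, (0 <= K)%R /\ forall t, (Cmod (L t) <= K * d t)%R) /\
  (forall eps : R, (0 < eps)%R -> exists del : R, (0 < del)%R /\
     forall t, (d t < del)%R -> (Cmod (f t - f t0 - L t) <= eps * d t)%R).

Lemma Cmod_triangle3 (a b c : C) : (Cmod (a + b + c) <= Cmod a + Cmod b + Cmod c)%R.
Proof.
  pose proof (Cmod_triangle (a + b) c); pose proof (Cmod_triangle a b); lra.
Qed.

Lemma Cmod_minus_sym (a b : C) : Cmod (a - b) = Cmod (b - a).
Proof. rewrite <- Cmod_opp; f_equal; ring. Qed.

Lemma Cmod_minus_le (a b : C) : (Cmod (a - b) <= Cmod a + Cmod b)%R.
Proof. unfold Cminus; rewrite <- (Cmod_opp b); apply Cmod_triangle. Qed.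

Lemma Cmod_triangle_inv (a b : C) : (Cmod a - Cmod b <= Cmod (a - b))%R.
Proof.
  pose proof (Cmod_triangle (a - b) b).
  replace (a - b + b) with a in H by ring. lra.
Qed.

Section Approx.
Context {T : Type} (d : T -> R) (Hd : forall t, (0 <= d t)%R) (t0 : T).

Lemma approx_eq_lin (f L L' : T -> C) :
  (forall t, L t = L' t) -> approx d t0 f L -> approx d t0 f L'.
Proof.
  intros E [[K [HK B]] H]; split.
  - exists K; split; auto; intros t; rewrite <- E; auto.
  - intros eps He; destruct (H eps He) as [del [Hdel Hb]]; exists del; split; auto.
    intros t Ht; rewrite <- E; auto.
Qed.

Lemma approx_ext_loc (f g L : T -> C) :
  f t0 = g t0 ->
  (exists del : R, (0 < del)%R /\ forall t, (d t < del)%R -> f t = g t) ->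
  approx d t0 f L -> approx d t0 g L.
Proof.
  intros E0 [del0 [Hd0 E]] [B H]; split; auto.
  intros eps He; destruct (H eps He) as [del [Hdel Hb]].
  exists (Rmin del0 del); split; [now apply Rmin_pos|].
  intros t Ht; rewrite <- E0, <- E.
  - apply Hb; eapply Rlt_le_trans; [exact Ht|apply Rmin_r].
  - eapply Rlt_le_trans; [exact Ht|apply Rmin_l].
Qed.

Lemma approx_ext (f g L : T -> C) :
  (forall t, f t = g t) -> approx d t0 f L -> approx d t0 g L.
Proof.
  intros E; apply approx_ext_loc; auto.
  exists 1%R; split; [lra|auto].
Qed.

Lemma approx_lipschitz (f L : T -> C) :
  approx d t0 f L ->
  exists K del : R, (0 <= K)%R /\ (0 < del)%R /\
    forall t, (d t < del)%R -> (Cmod (f t - f t0) <= K * d t)%R.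
Proof.
  intros [[K [HK B]] H]; destruct (H 1%R Rlt_0_1) as [del [Hdel Hb]].
  exists (K + 1)%R, del; repeat split; auto; [lra|].
  intros t Ht; pose proof (Hb t Ht); pose proof (B t).
  pose proof (Cmod_triangle (f t - f t0 - L t) (L t)).
  replace (f t - f t0 - L t + L t) with (f t - f t0) in H2 by ring. lra.
Qed.

Lemma approx_continuous (f L : T -> C) :
  approx d t0 f L -> forall eps : R, (0 < eps)%R ->
  exists del : R, (0 < del)%R /\
    forall t, (d t < del)%R -> (Cmod (f t - f t0) < eps)%R.
Proof.
  intros H eps He; destruct (approx_lipschitz _ _ H) as [K [del [HK [Hdel Hb]]]].
  assert (HK1 : (0 < eps / (K + 1))%R) by (apply Rdiv_lt_0_compat; lra).
  exists (Rmin del (eps / (K + 1)))%R; split; [now apply Rmin_pos|].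
  intros t Ht.
  assert (H1 : (d t < del)%R) by (eapply Rlt_le_trans; [exact Ht|apply Rmin_l]).
  assert (H2 : (d t < eps / (K + 1))%R) by (eapply Rlt_le_trans; [exact Ht|apply Rmin_r]).
  specialize (Hb t H1).
  assert (H3 : (d t * (K + 1) < eps)%R).
  { apply (Rmult_lt_compat_r (K + 1)) in H2; [|lra].
    unfold Rdiv in H2; rewrite Rmult_assoc, Rinv_l, Rmult_1_r in H2; lra. }
  pose proof (Hd t); lra.
Qed.

Lemma approx_const (c : C) : approx d t0 (fun _ => c) (fun _ => 0).
Proof.
  split.
  - exists 0%R; split; [lra|]; intros t; rewrite Cmod_0; lra.
  - intros eps He; exists 1%R; split; [lra|]; intros t _.
    replace (c - c - 0) with (RtoC 0) by ring; rewrite Cmod_0.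
    apply Rmult_le_pos; [lra|auto].
Qed.

Lemma approx_plus (f g Lf Lg : T -> C) :
  approx d t0 f Lf -> approx d t0 g Lg ->
  approx d t0 (fun t => f t + g t) (fun t => Lf t + Lg t).
Proof.
  intros [[K [HK B]] H] [[K' [HK' B']] H']; split.
  - exists (K + K')%R; split; [lra|]; intros t.
    pose proof (Cmod_triangle (Lf t) (Lg t)); specialize (B t); specialize (B' t); lra.
  - intros eps He; destruct (H (eps / 2)%R ltac:(lra)) as [d1 [Hd1 H1]].
    destruct (H' (eps / 2)%R ltac:(lra)) as [d2 [Hd2 H2]].
    exists (Rmin d1 d2); split; [now apply Rmin_pos|]; intros t Ht.
    specialize (H1 t (Rlt_le_trans _ _ _ Ht (Rmin_l _ _))).
    specialize (H2 t (Rlt_le_trans _ _ _ Ht (Rmin_r _ _))).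
    pose proof (Cmod_triangle (f t - f t0 - Lf t) (g t - g t0 - Lg t)).
    replace (f t - f t0 - Lf t + (g t - g t0 - Lg t))
      with (f t + g t - (f t0 + g t0) - (Lf t + Lg t)) in H0 by ring. lra.
Qed.

Lemma approx_scal (c : C) (f L : T -> C) :
  approx d t0 f L -> approx d t0 (fun t => c * f t) (fun t => c * L t).
Proof.
  intros [[K [HK B]] H]; pose proof (Cmod_ge_0 c) as Hc; split.
  - exists (Cmod c * K)%R; split; [now apply Rmult_le_pos|]; intros t.
    rewrite Cmod_mult, Rmult_assoc; apply Rmult_le_compat_l; auto.
  - intros eps He; destruct (H (eps / (Cmod c + 1))%R) as [d1 [Hd1 H1]].
    { apply Rdiv_lt_0_compat; lra. }
    exists d1; split; auto; intros t Ht; specialize (H1 t Ht).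
    replace (c * f t - c * f t0 - c * L t) with (c * (f t - f t0 - L t)) by ring.
    rewrite Cmod_mult.
    apply Rle_trans with (Cmod c * (eps / (Cmod c + 1) * d t))%R.
    { now apply Rmult_le_compat_l. }
    replace (Cmod c * (eps / (Cmod c + 1) * d t))%R
      with ((Cmod c / (Cmod c + 1)) * (eps * d t))%R by (field; lra).
    rewrite <- (Rmult_1_l (eps * d t)) at 2.
    apply Rmult_le_compat_r; [apply Rmult_le_pos; [lra|auto]|].
    apply Rmult_le_reg_r with (Cmod c + 1)%R; [lra|].
    unfold Rdiv; rewrite Rmult_assoc, Rinv_l by lra; lra.
Qed.

Lemma approx_opp (f L : T -> C) :
  approx d t0 f L -> approx d t0 (fun t => - f t) (fun t => - L t).
Proof.
  intros H; apply approx_ext with (fun t => (- RtoC 1) * f t); [intros; ring|].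
  apply approx_eq_lin with (fun t => (- RtoC 1) * L t); [intros; ring|].
  now apply approx_scal.
Qed.

Lemma approx_minus (f g Lf Lg : T -> C) :
  approx d t0 f Lf -> approx d t0 g Lg ->
  approx d t0 (fun t => f t - g t) (fun t => Lf t - Lg t).
Proof. intros; apply approx_plus; auto; now apply approx_opp. Qed.

(** An error of second order in [d] does not change the linear part. The rules for products and
    inverses, and the derivative at a pole, all rest on this. *)
Lemma approx_perturb (f g L : T -> C) :
  approx d t0 g L -> f t0 = g t0 ->
  (exists K del : R, (0 <= K)%R /\ (0 < del)%R /\
     forall t, (d t < del)%R -> (Cmod (f t - g t) <= K * (d t * d t))%R) ->
  approx d t0 f L.
Proof.
  intros [B H] E [K [d0 [HK [Hd0 H0]]]]; split; auto.
  intros eps He; destruct (H (eps / 2)%R ltac:(lra)) as [d1 [Hd1 H1]].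
  assert (H2 : (0 < eps / 2 / (K + 1))%R) by (apply Rdiv_lt_0_compat; lra).
  exists (Rmin (eps / 2 / (K + 1)) (Rmin d0 d1))%R; split.
  { repeat apply Rmin_pos; auto. }
  intros t Ht.
  pose proof (Rlt_le_trans _ _ _ Ht (Rmin_l _ _)) as T1.
  pose proof (Rlt_le_trans _ _ _ Ht (Rmin_r _ _)) as T2.
  pose proof (Rlt_le_trans _ _ _ T2 (Rmin_l _ _)) as T3.
  pose proof (Rlt_le_trans _ _ _ T2 (Rmin_r _ _)) as T4.
  specialize (H0 t T3); specialize (H1 t T4); specialize (Hd t).
  assert (T5 : (d t * (K + 1) < eps / 2)%R).
  { apply (Rmult_lt_compat_r (K + 1)) in T1; [|lra].
    replace (eps / 2 / (K + 1) * (K + 1))%R with (eps / 2)%R in T1 by (field; lra). lra. }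
  assert (T6 : (K * (d t * d t) <= eps / 2 * d t)%R) by nra.
  pose proof (Cmod_triangle (f t - g t) (g t - g t0 - L t)).
  replace (f t - g t + (g t - g t0 - L t)) with (f t - f t0 - L t) in H3
    by (rewrite E; ring). lra.
Qed.

(** The product differs from its linearization [f0 g + g0 f - f0 g0] by [(f - f0)(g - g0)], which is
    of second order. *)
Lemma approx_mult (f g Lf Lg : T -> C) :
  approx d t0 f Lf -> approx d t0 g Lg ->
  approx d t0 (fun t => f t * g t) (fun t => f t0 * Lg t + g t0 * Lf t).
Proof.
  intros Hf Hg.
  destruct (approx_lipschitz _ _ Hf) as [K [d1 [HK [Hd1 B]]]].
  destruct (approx_lipschitz _ _ Hg) as [K' [d2 [HK' [Hd2 B']]]].
  apply approx_perturb with (fun t => f t0 * g t + g t0 * f t - f t0 * g t0).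
  - apply approx_eq_lin with (fun t => f t0 * Lg t + g t0 * Lf t - 0); [intros; ring|].
    apply approx_minus; [|apply approx_const].
    apply approx_plus; now apply approx_scal.
  - ring.
  - exists (K * K')%R, (Rmin d1 d2); repeat split.
    + now apply Rmult_le_pos.
    + now apply Rmin_pos.
    + intros t Ht.
      specialize (B t (Rlt_le_trans _ _ _ Ht (Rmin_l _ _))).
      specialize (B' t (Rlt_le_trans _ _ _ Ht (Rmin_r _ _))).
      replace (f t * g t - (f t0 * g t + g t0 * f t - f t0 * g t0))
        with ((f t - f t0) * (g t - g t0)) by ring.
      rewrite Cmod_mult.
      replace (K * K' * (d t * d t))%R with ((K * d t) * (K' * d t))%R by ring.
      apply Rmult_le_compat; auto using Cmod_ge_0.
Qed.

(** The error of the first-order expansion of [1/f] is exactly [(f - f0)^2 / (f f0^2)]. Near the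
    base point [|f| >= |f0|/2], whence the factor [2/|f0|^3]. *)
Lemma approx_inv (f L : T -> C) :
  f t0 <> 0 -> approx d t0 f L ->
  approx d t0 (fun t => / f t) (fun t => - (L t / (f t0 * f t0))).
Proof.
  intros Hn Hf.
  destruct (approx_lipschitz _ _ Hf) as [K [d1 [HK [Hd1 B]]]].
  pose proof (proj1 (Cmod_gt_0 _) Hn) as Hp.
  destruct (approx_continuous _ _ Hf (Cmod (f t0) / 2)%R ltac:(lra)) as [d2 [Hd2 B']].
  apply approx_perturb with (fun t => / f t0 - (f t - f t0) / (f t0 * f t0)).
  - apply approx_ext with (fun t => RtoC 2 * / f t0 + (- / (f t0 * f t0)) * f t).
    { intros t; field; auto. }
    apply approx_eq_lin with (fun t => 0 + (- / (f t0 * f t0)) * L t).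
    { intros t; field; auto. }
    apply approx_plus; [apply approx_const|now apply approx_scal].
  - field; auto.
  - exists (K * K * (2 / (Cmod (f t0) * (Cmod (f t0) * Cmod (f t0)))))%R, (Rmin d1 d2); repeat split.
    + apply Rmult_le_pos; [nra|].
      apply Rlt_le, Rdiv_lt_0_compat; [lra|]; repeat apply Rmult_lt_0_compat; lra.
    + now apply Rmin_pos.
    + intros t Ht.
      specialize (B t (Rlt_le_trans _ _ _ Ht (Rmin_l _ _))).
      specialize (B' t (Rlt_le_trans _ _ _ Ht (Rmin_r _ _))).
      assert (Hl : (Cmod (f t0) / 2 <= Cmod (f t))%R).
      { pose proof (Cmod_triangle_inv (f t0) (f t0 - f t)).
        replace (f t0 - (f t0 - f t)) with (f t) in H by ring.
        rewrite (Cmod_minus_sym (f t0) (f t)) in H; lra. }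
      assert (Ht0 : f t <> 0) by (apply Cmod_gt_0; lra).
      replace (/ f t - (/ f t0 - (f t - f t0) / (f t0 * f t0)))
        with ((f t - f t0) * (f t - f t0) * (/ f t * / (f t0 * f t0))) by (field; auto).
      rewrite !Cmod_mult, !Cmod_inv, !Cmod_mult by (try apply Cmult_neq_0; auto).
      replace (K * K * (2 / (Cmod (f t0) * (Cmod (f t0) * Cmod (f t0)))) * (d t * d t))%R
        with ((K * d t) * (K * d t) * (2 / (Cmod (f t0) * (Cmod (f t0) * Cmod (f t0)))))%R by (field; lra).
      apply Rmult_le_compat; auto using Cmod_ge_0.
      * apply Rmult_le_pos; apply Cmod_ge_0.
      * rewrite <- Rinv_mult. apply Rlt_le, Rinv_0_lt_compat; repeat apply Rmult_lt_0_compat; lra.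
      * apply Rmult_le_compat; auto using Cmod_ge_0.
      * rewrite <- Rinv_mult.
        replace (2 / (Cmod (f t0) * (Cmod (f t0) * Cmod (f t0))))%R
          with (/ ((Cmod (f t0) / 2) * (Cmod (f t0) * Cmod (f t0))))%R by (field; lra).
        apply Rinv_le_contravar; [repeat apply Rmult_lt_0_compat; lra|].
        apply Rmult_le_compat_r; [apply Rmult_le_pos; lra|auto].
Qed.

Lemma approx_div (f g Lf Lg : T -> C) :
  g t0 <> 0 -> approx d t0 f Lf -> approx d t0 g Lg ->
  approx d t0 (fun t => f t / g t)
    (fun t => (Lf t * g t0 - f t0 * Lg t) / (g t0 * g t0)).
Proof.
  intros Hn Hf Hg.
  eapply approx_eq_lin; [|apply (approx_mult f (fun t => / g t) Lf _ Hf (approx_inv _ _ Hn Hg))].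
  intros t; simpl; field; auto.
Qed.

Lemma approx_pow (n : nat) (f L : T -> C) :
  approx d t0 f L ->
  approx d t0 (fun t => f t ^ n) (fun t => RtoC (INR n) * f t0 ^ (n - 1) * L t).
Proof.
  intros Hf; induction n as [|n IH].
  - apply approx_eq_lin with (fun _ => 0); [intros; simpl; ring|exact (approx_const (RtoC 1))].
  - eapply approx_eq_lin; [|apply (approx_mult f (fun t => f t ^ n) L _ Hf IH)].
    intros t; rewrite S_INR, RtoC_plus.
    replace (S n - 1)%nat with n by lia.
    destruct n as [|n]; [simpl; ring|].
    replace (S n - 1)%nat with n by lia. simpl Cpow. ring.
Qed.

End Approx.

(** * Derivatives in one and in three complex variables *)

Definition dist1 (t0 t : C) : R := Cmod (t - t0).
(** [approx] asks of the map [L] only a bound by a multiple of [d]; linearity enters with the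
    instances [D1] and [D3]. The algebraic rules are thus shared by curves and by functions of three
    variables. *)
Definition D1 (f : C -> C) (t a : C) : Prop :=
  approx (dist1 t) t f (fun s => a * (s - t)).

Definition norm3 (z : C3) : R :=
  let '(a, b, c) := z in (Cmod a + Cmod b + Cmod c)%R.
Definition sub3 (z z' : C3) : C3 :=
  let '(a, b, c) := z in let '(a', b', c') := z' in (a - a', b - b', c - c').
Definition lin3 (a b c : C) (z : C3) : C :=
  let '(x, y, w) := z in a * x + b * y + c * w.
Definition dist3 (z0 z : C3) : R := norm3 (sub3 z z0).
Definition D3 (f : C3 -> C) (z : C3) (a b c : C) : Prop :=
  approx (dist3 z) z f (fun z' => lin3 a b c (sub3 z' z)).

Lemma dist1_pos (t0 t : C) : (0 <= dist1 t0 t)%R.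
Proof. apply Cmod_ge_0. Qed.

Lemma norm3_pos (z : C3) : (0 <= norm3 z)%R.
Proof.
  destruct z as [[a b] c]; simpl.
  pose proof (Cmod_ge_0 a); pose proof (Cmod_ge_0 b); pose proof (Cmod_ge_0 c); lra.
Qed.

Lemma dist3_pos (z0 z : C3) : (0 <= dist3 z0 z)%R.
Proof. apply norm3_pos. Qed.

Lemma lin3_bound (a b c : C) (z : C3) :
  (Cmod (lin3 a b c z) <= (Cmod a + Cmod b + Cmod c) * norm3 z)%R.
Proof.
  destruct z as [[x y] w]; simpl.
  eapply Rle_trans; [apply Cmod_triangle3|]. rewrite !Cmod_mult.
  pose proof (Cmod_ge_0 a); pose proof (Cmod_ge_0 b); pose proof (Cmod_ge_0 c).
  pose proof (Cmod_ge_0 x); pose proof (Cmod_ge_0 y); pose proof (Cmod_ge_0 w).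
  nra.
Qed.

Lemma approx_comp3 {T : Type} (d : T -> R) (Hd : forall t, (0 <= d t)%R) (t0 : T)
    (F : C3 -> C) (f1 f2 f3 L1 L2 L3 : T -> C) (a b c : C) :
  D3 F (f1 t0, f2 t0, f3 t0) a b c ->
  approx d t0 f1 L1 -> approx d t0 f2 L2 -> approx d t0 f3 L3 ->
  approx d t0 (fun t => F (f1 t, f2 t, f3 t)) (fun t => a * L1 t + b * L2 t + c * L3 t).
Proof.
  intros [_ HF] H1 H2 H3.
  assert (HL : approx d t0 (fun t => a * f1 t + b * f2 t + c * f3 t)
                 (fun t => a * L1 t + b * L2 t + c * L3 t)).
  { repeat apply approx_plus; now apply approx_scal. }
  destruct HL as [HB HL]; split; auto.
  destruct (approx_lipschitz _ _ _ _ H1) as [K1 [e1 [HK1 [He1 B1]]]].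
  destruct (approx_lipschitz _ _ _ _ H2) as [K2 [e2 [HK2 [He2 B2]]]].
  destruct (approx_lipschitz _ _ _ _ H3) as [K3 [e3 [HK3 [He3 B3]]]].
  set (K := (K1 + K2 + K3 + 1)%R). assert (HK : (0 < K)%R) by (unfold K; lra).
  intros eps He.
  destruct (HF (eps / (2 * K))%R) as [e4 [He4 B4]]; [apply Rdiv_lt_0_compat; lra|].
  destruct (HL (eps / 2)%R ltac:(lra)) as [e5 [He5 B5]].
  assert (He6 : (0 < e4 / K)%R) by (apply Rdiv_lt_0_compat; lra).
  exists (Rmin (Rmin e1 (Rmin e2 e3)) (Rmin (e4 / K) e5)); split.
  { repeat apply Rmin_pos; auto. }
  intros t Ht.
  pose proof (Rlt_le_trans _ _ _ Ht (Rmin_l _ _)) as T1.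
  pose proof (Rlt_le_trans _ _ _ Ht (Rmin_r _ _)) as T2.
  specialize (B1 t (Rlt_le_trans _ _ _ T1 (Rmin_l _ _))).
  pose proof (Rlt_le_trans _ _ _ T1 (Rmin_r _ _)) as T3.
  specialize (B2 t (Rlt_le_trans _ _ _ T3 (Rmin_l _ _))).
  specialize (B3 t (Rlt_le_trans _ _ _ T3 (Rmin_r _ _))).
  pose proof (Rlt_le_trans _ _ _ T2 (Rmin_l _ _)) as T6.
  specialize (B5 t (Rlt_le_trans _ _ _ T2 (Rmin_r _ _))).
  specialize (Hd t).
  assert (HN : (dist3 (f1 t0, f2 t0, f3 t0) (f1 t, f2 t, f3 t) <= K * d t)%R).
  { unfold dist3, K; simpl; lra. }
  assert (HN' : (K * d t < e4)%R).
  { apply (Rmult_lt_compat_l K) in T6; [|lra].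
    replace (K * (e4 / K))%R with e4 in T6 by (field; lra). lra. }
  specialize (B4 (f1 t, f2 t, f3 t) (Rle_lt_trans _ _ _ HN HN')).
  simpl in B4.
  assert (B6 : (eps / (2 * K) * dist3 (f1 t0, f2 t0, f3 t0) (f1 t, f2 t, f3 t)
                <= eps / 2 * d t)%R).
  { replace (eps / 2 * d t)%R with (eps / (2 * K) * (K * d t))%R by (field; lra).
    apply Rmult_le_compat_l; auto. apply Rlt_le, Rdiv_lt_0_compat; lra. }
  match type of B4 with (Cmod ?x <= _)%R => match type of B5 with (Cmod ?y <= _)%R =>
    pose proof (Cmod_triangle x y) as B7;
    replace (x + y) with (F (f1 t, f2 t, f3 t) - F (f1 t0, f2 t0, f3 t0) -
       (a * L1 t + b * L2 t + c * L3 t)) in B7 by ring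
  end end.
  lra.
Qed.

Lemma D1_unique (f : C -> C) (t a b : C) : D1 f t a -> D1 f t b -> a = b.
Proof.
  intros [_ Ha] [_ Hb].
  assert (H : forall eps, (0 < eps)%R -> (Cmod (a - b) <= eps)%R).
  { intros eps He.
    destruct (Ha (eps / 2)%R ltac:(lra)) as [d1 [Hd1 H1]].
    destruct (Hb (eps / 2)%R ltac:(lra)) as [d2 [Hd2 H2]].
    set (h := (Rmin d1 d2 / 2)%R).
    assert (Hh : (0 < h)%R) by (unfold h; pose proof (Rmin_pos _ _ Hd1 Hd2); lra).
    assert (Hdist : dist1 t (t + RtoC h) = h).
    { unfold dist1; replace (t + RtoC h - t) with (RtoC h) by ring.
      rewrite Cmod_R, Rabs_pos_eq; lra. }
    specialize (H1 (t + RtoC h)); specialize (H2 (t + RtoC h)).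
    rewrite Hdist in H1, H2.
    pose proof (Rmin_l d1 d2); pose proof (Rmin_r d1 d2).
    specialize (H1 ltac:(unfold h in *; lra)); specialize (H2 ltac:(unfold h in *; lra)).
    pose proof (Cmod_minus_le (f (t + RtoC h) - f t - b * (t + RtoC h - t))
                  (f (t + RtoC h) - f t - a * (t + RtoC h - t))).
    replace (f (t + RtoC h) - f t - b * (t + RtoC h - t) -
             (f (t + RtoC h) - f t - a * (t + RtoC h - t))) with ((a - b) * RtoC h) in H3 by ring.
    rewrite Cmod_mult, Cmod_R, (Rabs_pos_eq h) in H3 by lra.
    apply Rmult_le_reg_r with h; lra. }
  assert (H0 : Cmod (a - b) = 0%R).
  { apply Rle_antisym; [|apply Cmod_ge_0].
    apply le_epsilon; intros eps He; specialize (H eps He); lra. }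
  apply Cmod_eq_0 in H0.
  replace a with (a - b + b) by ring; rewrite H0; ring.
Qed.

Lemma D1_id (t : C) : D1 (fun s => s) t 1.
Proof.
  split.
  - exists 1%R; split; [lra|]; intros s; unfold dist1; rewrite Cmult_1_l; lra.
  - intros eps He; exists 1%R; split; [lra|]; intros s _.
    replace (s - t - 1 * (s - t)) with (RtoC 0) by ring; rewrite Cmod_0.
    apply Rmult_le_pos; [lra|apply dist1_pos].
Qed.

Lemma D3_lin (a b c : C) (z : C3) : D3 (lin3 a b c) z a b c.
Proof.
  split.
  - exists (Cmod a + Cmod b + Cmod c)%R; split.
    + pose proof (Cmod_ge_0 a); pose proof (Cmod_ge_0 b); pose proof (Cmod_ge_0 c); lra.
    + intros z'; apply lin3_bound.
  - intros eps He; exists 1%R; split; [lra|]; intros z' _.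
    replace (lin3 a b c z' - lin3 a b c z - lin3 a b c (sub3 z' z)) with (RtoC 0).
    + rewrite Cmod_0; apply Rmult_le_pos; [lra|apply dist3_pos].
    + destruct z as [[? ?] ?], z' as [[? ?] ?]; simpl; ring.
Qed.

(** * Agreement with the derivatives defined by filters *)

Lemma norm_C_eq (x : C) : @norm C_AbsRing C_NormedModule x = Cmod x.
Proof. reflexivity. Qed.

(** The balls of [C_UniformSpace] are squares. The square of half-side [del / 2] lies in the disk of
    radius [del] because [sqrt 2 <= 2]. *)
Lemma locally_C_intro (t : C) (P : C -> Prop) :
  (exists del : R, (0 < del)%R /\ forall s, (Cmod (s - t) < del)%R -> P s) ->
  @locally C_UniformSpace t P.
Proof.
  intros [del [Hdel H]].
  exists (mkposreal (del / 2) ltac:(lra)); intros s Hs; apply H.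
  pose proof (C_NormedModule_mixin_compat2 t s _ Hs) as H2; simpl in H2.
  change (minus s t) with (s - t) in H2.
  assert (sqrt 2 <= 2)%R.
  { rewrite <- (sqrt_pow2 2) at 2 by lra. apply sqrt_le_1; lra. }
  nra.
Qed.

Lemma locally_C_elim (t : C) (P : C -> Prop) :
  @locally C_UniformSpace t P ->
  exists del : R, (0 < del)%R /\ forall s, (Cmod (s - t) < del)%R -> P s.
Proof.
  intros [eps H]; exists eps; split; [apply cond_pos|]; intros s Hs; apply H.
  now apply C_NormedModule_mixin_compat1.
Qed.

Lemma is_derive_D1 (f : C -> C) (t a : C) :
  @is_derive C_AbsRing C_NormedModule f t a <-> D1 f t a.
Proof.
  split.
  - intros [_ H]; split.
    + exists (Cmod a); split; [apply Cmod_ge_0|]; intros s; rewrite Cmod_mult; apply Rle_refl.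
    + intros eps He.
      specialize (H t (fun P HP => HP) (mkposreal eps He)).
      (* The neighbourhoods in [is_derive] come from the absolute value of the ring; [locally_C]
         exchanges them for those of the product structure. *)
      apply (locally_C t) in H; apply locally_C_elim in H.
      destruct H as [del [Hdel H]]; exists del; split; auto; intros s Hs.
      specialize (H s Hs); simpl in H.
      replace (a * (s - t)) with ((s - t) * a) by ring. exact H.
  - intros [_ H]; split; [apply is_linear_scal_l|].
    intros t' Ht'.
    assert (t = t').
    { apply (@is_filter_lim_locally_unique C_AbsRing (AbsRing_NormedModule C_AbsRing)).
      exact Ht'. }
    subst t'; intros [eps He]; apply (locally_C t), locally_C_intro.
    destruct (H eps He) as [del [Hdel H']]; exists del; split; auto.
    intros s Hs; specialize (H' s Hs); simpl.
    replace (a * (s - t)) with ((s - t) * a) in H' by ring. exact H'.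
Qed.

Lemma D3_ex_filterdiff (f : C3 -> C) (z : C3) (a b c : C) :
  D3 f z a b c ->
  @ex_filterdiff C_AbsRing C3_NormedModule C_NormedModule f (@locally C3_NormedModule z).
Proof.
  intros [_ H].
  assert (HN : forall z : C3, (norm3 z <= 3 * @norm C_AbsRing C3_NormedModule z)%R).
  { intros [[x y] w].
    pose proof (@norm_prod C_AbsRing
      (prod_NormedModule C_AbsRing C_NormedModule C_NormedModule) C_NormedModule (x, y) w) as [H1 _].
    pose proof (@norm_prod C_AbsRing C_NormedModule C_NormedModule x y) as [H2 _].
    pose proof (Rle_trans _ _ _ (Rmax_l _ _) H1) as H3.
    pose proof (Rle_trans _ _ _ (Rmax_r _ _) H1) as H4.
    pose proof (Rle_trans _ _ _ (Rmax_l _ _) H2) as H5.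
    pose proof (Rle_trans _ _ _ (Rmax_r _ _) H2) as H6.
    assert (E : forall a b c n m : R, (n <= m -> c <= m -> a <= n -> b <= n -> a + b + c <= 3 * m)%R)
      by (intros; lra).
    exact (E _ _ _ _ _ H3 H4 H5 H6). }
  exists (lin3 a b c : C3_NormedModule -> C_NormedModule). split.
  - split.
    + intros [[x y] w] [[x' y'] w']; simpl.
      change (a * (x + x') + b * (y + y') + c * (w + w') =
              (a * x + b * y + c * w) + (a * x' + b * y' + c * w')). ring.
    + intros k [[x y] w]; simpl.
      change (a * (k * x) + b * (k * y) + c * (k * w) = k * (a * x + b * y + c * w)). ring.
    + exists ((Cmod a + Cmod b + Cmod c + 1) * 3)%R; split.
      { pose proof (Cmod_ge_0 a); pose proof (Cmod_ge_0 b); pose proof (Cmod_ge_0 c); lra. }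
      intros u. rewrite norm_C_eq.
      eapply Rle_trans; [apply lin3_bound|].
      pose proof (HN u); pose proof (norm3_pos u).
      pose proof (Cmod_ge_0 a); pose proof (Cmod_ge_0 b); pose proof (Cmod_ge_0 c). nra.
  - intros z' Hz'.
    assert (z = z') by (apply (@is_filter_lim_locally_unique C_AbsRing C3_NormedModule); exact Hz').
    subst z'; intros [eps He].
    (* [eps / 3] pays for the comparison of [norm3] with the product norm. The box of size [del / 6]
       leaves less than [del / 3] for each coordinate. *)
    destruct (H (eps / 3)%R ltac:(lra)) as [del [Hdel H']].
    exists (mkposreal (del / 6) ltac:(lra)).
    destruct z as [[x y] w]; intros [[x' y'] w'] [[Hx Hy] Hw]; simpl in Hx, Hy, Hw.
    assert (Hs : (sqrt 2 <= 2)%R).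
    { rewrite <- (sqrt_pow2 2) at 2 by lra. apply sqrt_le_1; lra. }
    assert (HC : forall s s' : C, ball s (del / 6) s' -> (Cmod (s' - s) < del / 3)%R).
    { intros s s' Hb.
      pose proof (C_NormedModule_mixin_compat2 s s' (mkposreal (del / 6) ltac:(lra)) Hb) as H2.
      simpl in H2; change (minus s' s) with (s' - s) in H2. nra. }
    assert (Hd : (dist3 (x, y, w) (x', y', w') < del)%R).
    { unfold dist3; simpl. pose proof (HC _ _ Hx); pose proof (HC _ _ Hy); pose proof (HC _ _ Hw). lra. }
    specialize (H' _ Hd). rewrite norm_C_eq.
    eapply Rle_trans; [exact H'|]. simpl pos.
    specialize (HN (sub3 (x', y', w') (x, y, w))).
    change (@minus C3_NormedModule (x', y', w') (x, y, w)) with (sub3 (x', y', w') (x, y, w)).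
    unfold dist3. nra.
Qed.

(** * Geometrically dominated complex series *)

Fixpoint Csum (a : nat -> C) (n : nat) : C :=
  match n with O => a O | S k => Csum a k + a (S k) end.

Definition conv (a b : nat -> C) (n : nat) : C :=
  Csum (fun k => a k * b (n - k)%nat) n.

Definition CS (a : nat -> C) : C :=
  (Series (fun n => Re (a n)), Series (fun n => Im (a n))).

(** With ratio 1/2 the tail of the majorant after index [N] sums to its [N]-th term, which keeps all
    tail estimates in the same form. *)
Definition dom (K : R) (a : nat -> C) : Prop :=
  forall n, (Cmod (a n) <= K * (/ 2) ^ n)%R.

Lemma Csum_ext (a b : nat -> C) (n : nat) :
  (forall k, (k <= n)%nat -> a k = b k) -> Csum a n = Csum b n.
Proof.
  induction n as [|n IH]; intros H; simpl; [apply H; lia|].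
  rewrite IH, H; auto.
Qed.

Lemma Csum_plus (a b : nat -> C) (n : nat) :
  Csum (fun k => a k + b k) n = Csum a n + Csum b n.
Proof. induction n as [|n IH]; simpl; [auto|rewrite IH; ring]. Qed.

Lemma Csum_scal (c : C) (a : nat -> C) (n : nat) :
  Csum (fun k => c * a k) n = c * Csum a n.
Proof. induction n as [|n IH]; simpl; [auto|rewrite IH; ring]. Qed.

Lemma Re_Csum (a : nat -> C) (n : nat) : Re (Csum a n) = sum_f_R0 (fun k => Re (a k)) n.
Proof. induction n as [|n IH]; simpl; [auto|rewrite <- IH; auto]. Qed.

Lemma Im_Csum (a : nat -> C) (n : nat) : Im (Csum a n) = sum_f_R0 (fun k => Im (a k)) n.
Proof. induction n as [|n IH]; simpl; [auto|rewrite <- IH; auto]. Qed.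

Lemma re_im_le_Cmod (c : C) : (Rabs (Re c) <= Cmod c /\ Rabs (Im c) <= Cmod c)%R.
Proof.
  pose proof (Rmax_Cmod c); pose proof (Rmax_l (Rabs (fst c)) (Rabs (snd c)));
  pose proof (Rmax_r (Rabs (fst c)) (Rabs (snd c))); unfold Re, Im; lra.
Qed.

Lemma Cmod_le_re_im (c : C) : (Cmod c <= Rabs (Re c) + Rabs (Im c))%R.
Proof.
  destruct c as [x y].
  assert (E : (x, y) = RtoC x + Ci * RtoC y)
    by (apply injective_projections; simpl; ring).
  rewrite E at 1.
  eapply Rle_trans; [apply Cmod_triangle|].
  rewrite Cmod_mult, Cmod_Ci, !Cmod_R; simpl; lra.
Qed.

Lemma half_pow_small (K eps : R) : (0 < eps)%R -> exists N : nat, (K * (/ 2) ^ N < eps)%R.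
Proof.
  intros He.
  destruct (pow_lt_1_zero (/ 2) ltac:(rewrite Rabs_pos_eq; lra) (eps / (Rabs K + 1))) as [N HN].
  { apply Rdiv_lt_0_compat; pose proof (Rabs_pos K); lra. }
  exists N; specialize (HN N (le_n _)).
  pose proof (Rabs_pos K).
  assert (H0 : (0 < (/ 2) ^ N)%R) by (apply pow_lt; lra).
  rewrite Rabs_pos_eq in HN by lra.
  apply (Rmult_lt_compat_l (Rabs K + 1)) in HN; [|lra].
  replace ((Rabs K + 1) * (eps / (Rabs K + 1)))%R with eps in HN by (field; lra).
  pose proof (Rle_abs K). nra.
Qed.

Lemma half_pow_pos (n : nat) : (0 < (/ 2) ^ n)%R.
Proof. apply pow_lt; lra. Qed.

Lemma is_series_geom_tail (K : R) (N : nat) :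
  is_series (fun n => K * (/ 2) ^ (S N + n))%R (K * (/ 2) ^ N)%R.
Proof.
  assert (H : is_series (fun n => (/ 2) ^ n)%R (/ (1 - / 2))%R).
  { apply is_series_geom; rewrite Rabs_pos_eq; lra. }
  apply (is_series_scal (K * (/ 2) ^ (S N))%R) in H.
  replace (K * (/ 2) ^ N)%R with (scal (K * (/ 2) ^ (S N))%R (/ (1 - / 2))%R).
  - revert H; apply is_series_ext; intros n; rewrite pow_add; unfold scal; simpl; unfold mult; simpl; ring.
  - unfold scal; simpl; unfold mult; simpl; field.
Qed.

Lemma Series_dom (K : R) (a : nat -> R) :
  (forall n, (Rabs (a n) <= K * (/ 2) ^ n)%R) ->
  ex_series (fun n => Rabs (a n)) /\ ex_series a /\
  forall N, (Rabs (Series a - sum_f_R0 a N) <= K * (/ 2) ^ N)%R.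
Proof.
  intros H.
  assert (Hg : ex_series (fun n => K * (/ 2) ^ n)%R).
  { apply (ex_series_scal (K := R_AbsRing) (V := R_NormedModule) K), ex_series_geom.
    rewrite Rabs_pos_eq; lra. }
  assert (Ha : ex_series (fun n => Rabs (a n))).
  { apply (ex_series_le (K := R_AbsRing) (V := R_CompleteNormedModule)) with (2 := Hg).
    intros n; unfold norm; simpl; unfold abs; simpl; rewrite Rabs_Rabsolu; auto. }
  assert (Hb : ex_series a) by now apply ex_series_Rabs.
  split; [auto|split; auto]; intros N.
  rewrite (Series_incr_n a (S N)) by (auto; lia).
  simpl pred.
  replace (sum_f_R0 a N + Series (fun k => a (S N + k)%nat) - sum_f_R0 a N)%R
    with (Series (fun k => a (S N + k)%nat)) by ring.
  rewrite <- (is_series_unique _ _ (is_series_geom_tail K N)).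
  assert (Hg2 : ex_series (fun n => K * (/ 2) ^ (S N + n))%R) by (eexists; apply is_series_geom_tail).
  eapply Rle_trans; [apply Series_Rabs|].
  - apply (ex_series_le (K := R_AbsRing) (V := R_CompleteNormedModule)) with (2 := Hg2).
    intros n; unfold norm; simpl; unfold abs; simpl; rewrite Rabs_Rabsolu.
    apply (H (S (N + n))).
  - apply Series_le; auto; intros n; split; [apply Rabs_pos|apply (H (S N + n)%nat)].
Qed.

Lemma CS_tail (K : R) (a : nat -> C) (N : nat) :
  dom K a -> (Cmod (CS a - Csum a N) <= 2 * K * (/ 2) ^ N)%R.
Proof.
  intros H.
  destruct (Series_dom K (fun n => Re (a n))) as [_ [_ H1]].
  { intros n; eapply Rle_trans; [apply re_im_le_Cmod|apply H]. }
  destruct (Series_dom K (fun n => Im (a n))) as [_ [_ H2]].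
  { intros n; eapply Rle_trans; [apply re_im_le_Cmod|apply H]. }
  specialize (H1 N); specialize (H2 N).
  rewrite <- Re_Csum in H1; rewrite <- Im_Csum in H2.
  eapply Rle_trans; [apply Cmod_le_re_im|].
  change (Re (CS a - Csum a N)) with (Series (fun n => Re (a n)) - Re (Csum a N))%R.
  change (Im (CS a - Csum a N)) with (Series (fun n => Im (a n)) - Im (Csum a N))%R.
  lra.
Qed.

(** Identities between sums are obtained by comparing partial sums. The threshold [N0] allows for
    identities that hold only once the exceptional low degrees have been passed. *)
Lemma CS_unique (K K' : R) (N0 : nat) (a : nat -> C) (s : C) :
  dom K a ->
  (forall N, (N0 <= N)%nat -> (Cmod (s - Csum a N) <= K' * (/ 2) ^ N)%R) -> CS a = s.
Proof.
  intros Ha Hs.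
  assert (H : forall eps, (0 < eps)%R -> (Cmod (CS a - s) <= eps)%R).
  { intros eps He.
    destruct (half_pow_small (2 * Rabs K + Rabs K') eps He) as [N HN].
    pose proof (CS_tail K a (N0 + N) Ha) as H1; specialize (Hs (N0 + N)%nat ltac:(lia)).
    pose proof (Cmod_minus_le (CS a - Csum a (N0 + N)) (s - Csum a (N0 + N))) as H2.
    replace (CS a - Csum a (N0 + N) - (s - Csum a (N0 + N))) with (CS a - s) in H2 by ring.
    assert (H3 : ((/ 2) ^ (N0 + N) <= (/ 2) ^ N)%R).
    { rewrite pow_add. rewrite <- (Rmult_1_l ((/ 2) ^ N)) at 2.
      apply Rmult_le_compat_r; [apply Rlt_le, half_pow_pos|].
      rewrite <- (pow1 N0); apply pow_incr; lra. }
    pose proof (half_pow_pos (N0 + N)); pose proof (half_pow_pos N).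
    pose proof (Rle_abs K); pose proof (Rle_abs K'); pose proof (Rabs_pos K); pose proof (Rabs_pos K').
    nra. }
  assert (H0 : Cmod (CS a - s) = 0%R).
  { apply Rle_antisym; [|apply Cmod_ge_0].
    apply le_epsilon; intros eps He; specialize (H eps He); lra. }
  apply Cmod_eq_0 in H0.
  replace (CS a) with (CS a - s + s) by ring; rewrite H0; ring.
Qed.

Lemma CS_ext (a b : nat -> C) : (forall n, a n = b n) -> CS a = CS b.
Proof. intros H; unfold CS; f_equal; apply Series_ext; intros n; now rewrite H. Qed.

Lemma dom_plus (K K' : R) (a b : nat -> C) :
  dom K a -> dom K' b -> dom (K + K') (fun n => a n + b n).
Proof.
  intros Ha Hb n; specialize (Ha n); specialize (Hb n).
  pose proof (Cmod_triangle (a n) (b n)); lra.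
Qed.

Lemma dom_scal (K : R) (c : C) (a : nat -> C) :
  dom K a -> dom (Cmod c * K) (fun n => c * a n).
Proof.
  intros Ha n; rewrite Cmod_mult, Rmult_assoc.
  apply Rmult_le_compat_l; [apply Cmod_ge_0|apply Ha].
Qed.

Lemma CS_plus (K K' : R) (a b : nat -> C) :
  dom K a -> dom K' b -> CS (fun n => a n + b n) = CS a + CS b.
Proof.
  intros Ha Hb.
  apply CS_unique with (K + K')%R (2 * K + 2 * K')%R 0%nat; [now apply dom_plus|].
  intros N _; rewrite Csum_plus.
  pose proof (CS_tail K a N Ha); pose proof (CS_tail K' b N Hb).
  pose proof (Cmod_triangle (CS a - Csum a N) (CS b - Csum b N)).
  replace (CS a - Csum a N + (CS b - Csum b N)) with (CS a + CS b - (Csum a N + Csum b N)) in H1 by ring.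
  lra.
Qed.

Lemma CS_scal (K : R) (c : C) (a : nat -> C) :
  dom K a -> CS (fun n => c * a n) = c * CS a.
Proof.
  intros Ha.
  apply CS_unique with (Cmod c * K)%R (Cmod c * (2 * K))%R 0%nat; [now apply dom_scal|].
  intros N _; rewrite Csum_scal.
  replace (c * CS a - c * Csum a N) with (c * (CS a - Csum a N)) by ring.
  rewrite Cmod_mult, Rmult_assoc; apply Rmult_le_compat_l; [apply Cmod_ge_0|].
  now apply CS_tail.
Qed.

Lemma CS_bound (K : R) (a : nat -> C) : dom K a -> (Cmod (CS a) <= 3 * K)%R.
Proof.
  intros Ha; pose proof (CS_tail K a 0 Ha) as H; pose proof (Ha 0%nat) as H0.
  simpl in *; pose proof (Cmod_triangle (CS a - a 0%nat) (a 0%nat)) as H1.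
  replace (CS a - a 0%nat + a 0%nat) with (CS a) in H1 by ring. lra.
Qed.

(** Real and imaginary parts are combinations of four real Cauchy products of absolutely convergent
    series. *)
Lemma CS_conv (K K' : R) (a b : nat -> C) :
  dom K a -> dom K' b -> CS (conv a b) = CS a * CS b.
Proof.
  intros Ha Hb.
  assert (RA : forall n, (Rabs (Re (a n)) <= K * (/ 2) ^ n)%R)
    by (intros n; eapply Rle_trans; [apply re_im_le_Cmod|apply Ha]).
  assert (IA : forall n, (Rabs (Im (a n)) <= K * (/ 2) ^ n)%R)
    by (intros n; eapply Rle_trans; [apply re_im_le_Cmod|apply Ha]).
  assert (RB : forall n, (Rabs (Re (b n)) <= K' * (/ 2) ^ n)%R)
    by (intros n; eapply Rle_trans; [apply re_im_le_Cmod|apply Hb]).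
  assert (IB : forall n, (Rabs (Im (b n)) <= K' * (/ 2) ^ n)%R)
    by (intros n; eapply Rle_trans; [apply re_im_le_Cmod|apply Hb]).
  apply Series_dom in RA, IA, RB, IB.
  destruct RA as [RA [RA' _]], IA as [IA [IA' _]], RB as [RB [RB' _]], IB as [IB [IB' _]].
  apply Series_correct in RA', IA', RB', IB'.
  apply injective_projections; simpl.
  - apply is_series_unique.
    pose proof (is_series_minus _ _ _ _ (is_series_mult _ _ _ _ RA' RB' RA RB)
                  (is_series_mult _ _ _ _ IA' IB' IA IB)) as H.
    revert H; apply is_series_ext; intros n.
    unfold conv; rewrite Re_Csum.
    exact (eq_sym (minus_sum (fun k => Re (a k) * Re (b (n - k)%nat))%R
                             (fun k => Im (a k) * Im (b (n - k)%nat))%R n)).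
  - apply is_series_unique.
    pose proof (is_series_plus _ _ _ _ (is_series_mult _ _ _ _ RA' IB' RA IB)
                  (is_series_mult _ _ _ _ IA' RB' IA RB)) as H.
    revert H; apply is_series_ext; intros n.
    unfold conv; rewrite Im_Csum.
    exact (eq_sym (plus_sum (fun k => Re (a k) * Im (b (n - k)%nat))%R
                            (fun k => Im (a k) * Re (b (n - k)%nat))%R n)).
Qed.

(** The inverse square makes the weights stable under convolution up to a constant factor. The plain
    weights [2^(-n)] would lose a factor [n + 1] and the recursive estimate would not close. *)
Definition wt (n : nat) : R := ((/ 2) ^ n * / ((INR n + 1) * (INR n + 1)))%R.

Lemma wt_pos (n : nat) : (0 < wt n)%R.
Proof.
  unfold wt; pose proof (pos_INR n); apply Rmult_lt_0_compat; [apply half_pow_pos|].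
  apply Rinv_0_lt_compat; nra.
Qed.

Lemma wt_le (n : nat) : (wt n <= (/ 2) ^ n)%R.
Proof.
  unfold wt; pose proof (pos_INR n); rewrite <- (Rmult_1_r ((/ 2) ^ n)) at 2.
  apply Rmult_le_compat_l; [apply Rlt_le, half_pow_pos|].
  rewrite <- Rinv_1; apply Rinv_le_contravar; nra.
Qed.

(** Telescoping: [1/(n+2)^2 <= 1/(n+1) - 1/(n+2)]. *)
Lemma sum_inv_square_le (n : nat) :
  (sum_f_R0 (fun i => / ((INR i + 1) * (INR i + 1))) n <= 2 - / (INR n + 1))%R.
Proof.
  induction n as [|n IH]; [simpl; lra|].
  rewrite tech5, S_INR; pose proof (pos_INR n).
  assert (H1 : (/ ((INR n + 1 + 1) * (INR n + 1 + 1)) <= / (INR n + 1) - / (INR n + 1 + 1))%R).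
  { replace (/ (INR n + 1) - / (INR n + 1 + 1))%R with (/ ((INR n + 1) * (INR n + 1 + 1)))%R by (field; lra).
    apply Rinv_le_contravar; nra. }
  lra.
Qed.

Lemma sum_f_R0_rev (f : nat -> R) (n : nat) :
  sum_f_R0 (fun i => f (n - i)%nat) n = sum_f_R0 f n.
Proof.
  induction n as [|n IH]; [reflexivity|].
  rewrite decomp_sum by lia. simpl pred.
  rewrite (tech5 f n), <- IH, Rplus_comm. f_equal.
Qed.

(* [1/((i+1)(n-i+1)) = (1/(n+2)) (1/(i+1) + 1/(n-i+1))], so that each product of
   inverse squares is at most [2/(n+1)^2] times the sum of the two inverse squares. *)
Lemma wt_conv (n : nat) : (sum_f_R0 (fun i => wt i * wt (n - i)) n <= 8 * wt n)%R.
Proof.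
  set (s := fun i => (/ ((INR i + 1) * (INR i + 1)))%R).
  apply Rle_trans with
    (sum_f_R0 (fun i => (s i + s (n - i)%nat) * (2 * wt n)) n)%R.
  - apply sum_Rle; intros i Hi; unfold wt, s.
    assert (E : ((/ 2) ^ n = (/ 2) ^ i * (/ 2) ^ (n - i))%R) by (rewrite <- pow_add; f_equal; lia).
    rewrite E. rewrite minus_INR by lia.
    pose proof (half_pow_pos i); pose proof (half_pow_pos (n - i)).
    pose proof (pos_INR i); pose proof (le_INR _ _ Hi).
    set (x := INR i) in *; set (y := (INR n - x)%R). assert (Hy : (0 <= y)%R) by (unfold y; lra).
    replace (INR n) with (x + y)%R by (unfold y; ring).
    replace ((/ 2) ^ i * / ((x + 1) * (x + 1)) * ((/ 2) ^ (n - i) * / ((y + 1) * (y + 1))))%R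
      with ((/ 2) ^ i * (/ 2) ^ (n - i) * / ((x + 1) * (x + 1) * ((y + 1) * (y + 1))))%R by (field; lra).
    replace ((/ ((x + 1) * (x + 1)) + / ((y + 1) * (y + 1))) *
      (2 * ((/ 2) ^ i * (/ 2) ^ (n - i) * / ((x + y + 1) * (x + y + 1)))))%R
      with ((/ 2) ^ i * (/ 2) ^ (n - i) * (2 * ((x + 1) * (x + 1) + (y + 1) * (y + 1)) /
         ((x + 1) * (x + 1) * ((y + 1) * (y + 1)) * ((x + y + 1) * (x + y + 1)))))%R by (field; lra).
    apply Rmult_le_compat_l; [nra|].
    assert (E2 : forall A D S : R, (0 < A -> 0 < D -> D <= S -> / A <= S / (A * D))%R).
    { intros A D S HA HD HS. replace (/ A)%R with (D * / (A * D))%R by (field; lra).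
      apply Rmult_le_compat_r; [|auto]. apply Rlt_le, Rinv_0_lt_compat; nra. }
    apply E2; [repeat apply Rmult_lt_0_compat; lra|apply Rmult_lt_0_compat; lra|].
    assert (Hx : (0 <= x)%R) by apply pos_INR.
    clearbody x y; clear - Hx Hy; pose proof (Rle_0_sqr (x - y)); unfold Rsqr in *; nra.
  - rewrite <- scal_sum, plus_sum, (sum_f_R0_rev s).
    pose proof (sum_inv_square_le n) as H; fold s in H.
    change (fun i : nat => / ((INR i + 1) * (INR i + 1)))%R with s in H.
    assert (0 < / (INR n + 1))%R by (apply Rinv_0_lt_compat; pose proof (pos_INR n); lra).
    pose proof (wt_pos n). nra.
Qed.

(** * The graded series *)

(** Radius of the ball on which the series are controlled. The tightest requirement is that of the
    degree 5 source term [B/2]: [dl / 2 <= MM / 2 * wt 5 = 1/230400]. *)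
Definition dl : R := (/ 120000)%R.

Definition euler3 (z : C3) (ga gb gc : C) : C :=
  let '(A, B, D) := z in 4 * A * ga + 5 * B * gb + 6 * D * gc.

(* The number [a] bounds [f] and [dl] times its Lipschitz constant, so a product costs a
   factor 2.  A series whose terms have summable Lipschitz constants can be differentiated
   term by term, which makes Cauchy estimates unnecessary.  The last clause is Euler's
   identity for the weights 4, 5, 6. *)
Definition graded (n : nat) (f : C3 -> C) (a : R) : Prop :=
  (0 <= a)%R /\ forall z, (norm3 z < dl)%R ->
  (Cmod (f z) <= a)%R /\
  (forall z', (norm3 z' < dl)%R -> (dl * Cmod (f z' - f z) <= a * dist3 z z')%R) /\
  exists ga gb gc, D3 f z ga gb gc /\ euler3 z ga gb gc = RtoC (INR n) * f z.

Lemma dl_pos : (0 < dl)%R.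
Proof. unfold dl; lra. Qed.

Lemma D3_ext (f g : C3 -> C) (z : C3) (a b c : C) :
  (forall z, f z = g z) -> D3 f z a b c -> D3 g z a b c.
Proof. intros H; now apply approx_ext. Qed.

Lemma graded_ext (n : nat) (f g : C3 -> C) (a : R) :
  (forall z, f z = g z) -> graded n f a -> graded n g a.
Proof.
  intros E [Ha H]; split; auto; intros z Hz; destruct (H z Hz) as [H1 [H2 [ga [gb [gc [H3 H4]]]]]].
  rewrite <- E; split; auto; split.
  - intros z' Hz'; rewrite <- !E; auto.
  - exists ga, gb, gc; split; auto. now apply D3_ext with f.
Qed.

Lemma graded_le (n : nat) (f : C3 -> C) (a b : R) :
  (a <= b)%R -> graded n f a -> graded n f b.
Proof.
  intros E [Ha H]; split; [lra|]; intros z Hz; destruct (H z Hz) as [H1 [H2 H3]].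
  split; [lra|split; auto]; intros z' Hz'; specialize (H2 z' Hz').
  pose proof (dist3_pos z z'); nra.
Qed.

Lemma graded_zero (n : nat) : graded n (fun _ => 0) 0.
Proof.
  split; [lra|]; intros z Hz; rewrite Cmod_0; split; [lra|split].
  - intros z' _; replace (RtoC 0 - 0) with (RtoC 0) by ring; rewrite Cmod_0; lra.
  - exists 0, 0, 0; split.
    + eapply approx_eq_lin; [|apply approx_const, dist3_pos].
      intros [[? ?] ?]; destruct z as [[? ?] ?]; simpl; ring.
    + destruct z as [[? ?] ?]; simpl; ring.
Qed.

Lemma graded_plus (n : nat) (f g : C3 -> C) (a b : R) :
  graded n f a -> graded n g b -> graded n (fun z => f z + g z) (a + b).
Proof.
  intros [Ha H] [Hb H']; split; [lra|]; intros z Hz.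
  destruct (H z Hz) as [H1 [H2 [ga [gb [gc [H3 H4]]]]]].
  destruct (H' z Hz) as [H1' [H2' [ga' [gb' [gc' [H3' H4']]]]]].
  split; [|split].
  - eapply Rle_trans; [apply Cmod_triangle|lra].
  - intros z' Hz'; specialize (H2 z' Hz'); specialize (H2' z' Hz').
    replace (f z' + g z' - (f z + g z)) with (f z' - f z + (g z' - g z)) by ring.
    pose proof (Cmod_triangle (f z' - f z) (g z' - g z)); pose proof dl_pos; nra.
  - exists (ga + ga'), (gb + gb'), (gc + gc'); split.
    + eapply approx_eq_lin; [|apply (approx_plus _ _ _ _ _ _ H3 H3')].
      intros [[? ?] ?]; destruct z as [[? ?] ?]; simpl; ring.
    + replace (RtoC (INR n) * (f z + g z)) with (RtoC (INR n) * f z + RtoC (INR n) * g z) by ring.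
      rewrite <- H4, <- H4'; destruct z as [[? ?] ?]; simpl; ring.
Qed.

Lemma graded_scal (n : nat) (c : C) (f : C3 -> C) (a : R) :
  graded n f a -> graded n (fun z => c * f z) (Cmod c * a).
Proof.
  intros [Ha H]; pose proof (Cmod_ge_0 c) as Hc; split; [nra|]; intros z Hz.
  destruct (H z Hz) as [H1 [H2 [ga [gb [gc [H3 H4]]]]]].
  split; [|split].
  - rewrite Cmod_mult; nra.
  - intros z' Hz'; specialize (H2 z' Hz').
    replace (c * f z' - c * f z) with (c * (f z' - f z)) by ring.
    rewrite Cmod_mult; nra.
  - exists (c * ga), (c * gb), (c * gc); split.
    + eapply approx_eq_lin; [|apply (approx_scal _ (dist3_pos z) _ c _ _ H3)].
      intros [[? ?] ?]; destruct z as [[? ?] ?]; simpl; ring.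
    + replace (RtoC (INR n) * (c * f z)) with (c * (RtoC (INR n) * f z)) by ring.
      rewrite <- H4; destruct z as [[? ?] ?]; simpl; ring.
Qed.

Lemma graded_mult (n m : nat) (f g : C3 -> C) (a b : R) :
  graded n f a -> graded m g b -> graded (n + m) (fun z => f z * g z) (2 * a * b).
Proof.
  intros [Ha H] [Hb H']; split; [nra|]; intros z Hz.
  destruct (H z Hz) as [H1 [H2 [ga [gb [gc [H3 H4]]]]]].
  destruct (H' z Hz) as [H1' [H2' [ga' [gb' [gc' [H3' H4']]]]]].
  split; [|split].
  - rewrite Cmod_mult. pose proof (Cmod_ge_0 (f z)); pose proof (Cmod_ge_0 (g z)); nra.
  - intros z' Hz'; specialize (H2 z' Hz'); specialize (H2' z' Hz').
    destruct (H z' Hz') as [H5 _].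
    replace (f z' * g z' - f z * g z) with (f z' * (g z' - g z) + g z * (f z' - f z)) by ring.
    eapply Rle_trans; [apply Rmult_le_compat_l; [apply Rlt_le, dl_pos|apply Cmod_triangle]|].
    rewrite !Cmod_mult.
    pose proof (dist3_pos z z'); pose proof (Cmod_ge_0 (f z')); pose proof (Cmod_ge_0 (g z)).
    pose proof (Cmod_ge_0 (f z' - f z)); pose proof (Cmod_ge_0 (g z' - g z)); pose proof dl_pos.
    assert (Cmod (f z') * (dl * Cmod (g z' - g z)) <= a * (b * dist3 z z'))%R
      by (apply Rmult_le_compat; auto; nra).
    assert (Cmod (g z) * (dl * Cmod (f z' - f z)) <= b * (a * dist3 z z'))%R
      by (apply Rmult_le_compat; auto; nra).
    nra.
  - exists (f z * ga' + g z * ga), (f z * gb' + g z * gb), (f z * gc' + g z * gc); split.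
    + eapply approx_eq_lin; [|apply (approx_mult _ (dist3_pos z) _ _ _ _ _ H3 H3')].
      intros [[? ?] ?]; destruct z as [[? ?] ?]; simpl; ring.
    + rewrite plus_INR, RtoC_plus.
      replace ((RtoC (INR n) + RtoC (INR m)) * (f z * g z))
        with (f z * (RtoC (INR m) * g z) + g z * (RtoC (INR n) * f z)) by ring.
      rewrite <- H4, <- H4'; destruct z as [[? ?] ?]; simpl; ring.
Qed.

Lemma graded_Csum (n N : nat) (f : nat -> C3 -> C) (a : nat -> R) :
  (forall k, (k <= N)%nat -> graded n (f k) (a k)) ->
  graded n (fun z => Csum (fun k => f k z) N) (sum_f_R0 a N).
Proof.
  induction N as [|N IH]; intros H; simpl; [apply H; lia|].
  apply graded_plus; [apply IH; intros; apply H; lia|apply H; lia].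
Qed.

(** The constant 16 is 8 from the convolution of the weights times 2 from the product rule for
    [graded]. *)
Lemma graded_conv (n : nat) (f g : nat -> C3 -> C) (a b : R) :
  (0 <= a)%R -> (0 <= b)%R ->
  (forall k, graded k (f k) (a * wt k)) -> (forall k, graded k (g k) (b * wt k)) ->
  graded n (fun z => conv (fun k => f k z) (fun k => g k z) n) (16 * a * b * wt n).
Proof.
  intros Ha Hb Hf Hg; unfold conv.
  apply graded_le with (sum_f_R0 (fun k => wt k * wt (n - k) * (2 * a * b)) n)%R.
  - rewrite <- scal_sum. pose proof (wt_conv n).
    assert (0 <= 2 * a * b)%R by (apply Rmult_le_pos; lra). nra.
  - apply graded_Csum; intros k Hk.
    apply graded_le with (2 * (a * wt k) * (b * wt (n - k)))%R; [apply Req_le; ring|].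
    replace n with (k + (n - k))%nat at 1 by lia.
    apply graded_mult; auto.
Qed.

(** On the ball of radius [dl] a coordinate is bounded by [dl] and has Lipschitz constant 1. This is
    the reason for the factor [dl] before the Lipschitz constant: both bounds become the same
    number. *)
Lemma graded_coord1 : graded 4 (fun z => fst (fst z)) dl.
Proof.
  split; [apply Rlt_le, dl_pos|]; intros [[A B] D] Hz; simpl in *.
  pose proof (Cmod_ge_0 A); pose proof (Cmod_ge_0 B); pose proof (Cmod_ge_0 D).
  split; [lra|split].
  - intros [[A' B'] D'] _; simpl; pose proof dl_pos.
    apply Rmult_le_compat_l; [lra|]; unfold dist3; simpl.
    pose proof (Cmod_ge_0 (B' - B)); pose proof (Cmod_ge_0 (D' - D)); lra.
  - exists 1, 0, 0; split; [|simpl; replace (1 + 1 + 1 + 1)%R with 4%R by ring; ring].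
    apply D3_ext with (lin3 1 0 0); [intros [[? ?] ?]; simpl; ring|apply D3_lin].
Qed.

Lemma graded_coord2 : graded 5 (fun z => snd (fst z)) dl.
Proof.
  split; [apply Rlt_le, dl_pos|]; intros [[A B] D] Hz; simpl in *.
  pose proof (Cmod_ge_0 A); pose proof (Cmod_ge_0 B); pose proof (Cmod_ge_0 D).
  split; [lra|split].
  - intros [[A' B'] D'] _; simpl; pose proof dl_pos.
    apply Rmult_le_compat_l; [lra|]; unfold dist3; simpl.
    pose proof (Cmod_ge_0 (A' - A)); pose proof (Cmod_ge_0 (D' - D)); lra.
  - exists 0, 1, 0; split; [|simpl; replace (1 + 1 + 1 + 1 + 1)%R with 5%R by ring; ring].
    apply D3_ext with (lin3 0 1 0); [intros [[? ?] ?]; simpl; ring|apply D3_lin].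
Qed.

Lemma graded_coord3 : graded 6 (fun z => snd z) dl.
Proof.
  split; [apply Rlt_le, dl_pos|]; intros [[A B] D] Hz; simpl in *.
  pose proof (Cmod_ge_0 A); pose proof (Cmod_ge_0 B); pose proof (Cmod_ge_0 D).
  split; [lra|split].
  - intros [[A' B'] D'] _; simpl; pose proof dl_pos.
    apply Rmult_le_compat_l; [lra|]; unfold dist3; simpl.
    pose proof (Cmod_ge_0 (B' - B)); pose proof (Cmod_ge_0 (A' - A)); lra.
  - exists 0, 0, 1; split; [|simpl; replace (1 + 1 + 1 + 1 + 1 + 1)%R with 6%R by ring; ring].
    apply D3_ext with (lin3 0 0 1); [intros [[? ?] ?]; simpl; ring|apply D3_lin].
Qed.

(* The recursion expresses, degree by degree, [4 (1 + mu)^2 = 4 + D + 2 (A + B (2 + om))]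
   and [(1 + mu) (1 + ell) = 1], where [(n + 1) lam_n = ell_n] comes from
   [dx/dq = 1 + ell] and [(n - 1) om_n = - 2 lam_n] from [dz/dy = x]. *)
Definition om_c (ell : nat -> C) (n : nat) : C :=
  match n with
  | S (S j) => RtoC (- 2 / ((INR j + 3) * (INR j + 1))) * ell n
  | _ => 0
  end.

(** Dividing the relation for [mu] by 8 gives [mu = A/4 + B/2 + D/8 + B om/4 - mu^2/2]; this is the
    part of degree [n] without the square. The term [B om] starts in degree 7 because [om] has no
    part of degree 0 or 1, so it does not meet the three linear terms. *)
Definition src (z : C3) (ell : nat -> C) (n : nat) : C :=
  let '(A, B, D) := z in
  match n with
  | 4%nat => RtoC (/ 4) * A
  | 5%nat => RtoC (/ 2) * B
  | 6%nat => RtoC (/ 8) * D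
  | S (S (S (S (S m)))) => RtoC (/ 4) * (B * om_c ell m)
  | _ => 0
  end.

(** The convolutions formally contain the unknown terms of degree [n], but only multiplied by terms
    of degree 0, which vanish. Extending the known terms by zero is therefore harmless. *)
Definition step (z : C3) (f : nat -> C * C) (n : nat) : C * C :=
  let mu := src z (fun k => snd (f k)) n
            - RtoC (/ 2) * conv (fun k => fst (f k)) (fun k => fst (f k)) n in
  (mu, - mu - conv (fun k => fst (f k)) (fun k => snd (f k)) n).

(* The terms of degree less than [n], extended by zero. *)
Fixpoint pre (z : C3) (n : nat) : nat -> C * C :=
  match n with
  | O => fun _ => (RtoC 0, RtoC 0)
  | S m => fun k => if Nat.eqb k m then step z (pre z m) m else pre z m k
  end.

Definition mu_n (z : C3) (n : nat) : C := fst (pre z (S n) n).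
Definition ell_n (z : C3) (n : nat) : C := snd (pre z (S n) n).

Lemma pre_ge (z : C3) (n k : nat) : (n <= k)%nat -> pre z n k = (RtoC 0, RtoC 0).
Proof.
  induction n as [|n IH]; intros H; simpl; auto.
  destruct (Nat.eqb_spec k n); [lia|apply IH; lia].
Qed.

Lemma pre_lt (z : C3) (n k : nat) : (k < n)%nat -> pre z n k = (mu_n z k, ell_n z k).
Proof.
  induction n as [|n IH]; intros H; [lia|].
  destruct (Nat.eq_dec k n) as [->|E].
  - unfold mu_n, ell_n; now rewrite <- surjective_pairing.
  - simpl. destruct (Nat.eqb_spec k n); [lia|apply IH; lia].
Qed.

Lemma src_ext (z : C3) (a b : nat -> C) (n : nat) :
  (forall k, (k < n)%nat -> a k = b k) -> src z a n = src z b n.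
Proof.
  intros H; destruct z as [[A B] D]; unfold src.
  destruct n as [|[|[|[|[|[|[|n]]]]]]]; auto.
  unfold om_c. now rewrite H by lia.
Qed.

Lemma mu_n_0 (z : C3) : mu_n z 0 = 0.
Proof. destruct z as [[A B] D]; unfold mu_n; simpl; unfold conv; simpl; ring. Qed.

Lemma ell_n_0 (z : C3) : ell_n z 0 = 0.
Proof. destruct z as [[A B] D]; unfold ell_n; simpl; unfold conv; simpl; ring. Qed.

(** The two sides can differ only in the summands [k = 0] and [k = n], and these are zero on both
    sides. *)
Lemma conv_pre (a b a' b' : nat -> C) (n : nat) :
  (forall k, (k < n)%nat -> a k = a' k) -> (forall k, (k < n)%nat -> b k = b' k) ->
  a n = 0 -> b n = 0 -> a' 0%nat = 0 -> b' 0%nat = 0 -> conv a b n = conv a' b' n.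
Proof.
  intros Ha Hb Ha0 Hb0 Ha0' Hb0'; apply Csum_ext; intros k Hk.
  destruct (Nat.eq_dec k 0) as [->|Ek].
  - rewrite Nat.sub_0_r, Hb0, Ha0'; ring.
  - destruct (Nat.eq_dec k n) as [->|En].
    + rewrite Nat.sub_diag, Ha0, Hb0'; ring.
    + rewrite Ha, Hb by lia; reflexivity.
Qed.

Lemma mu_n_rec (z : C3) (n : nat) :
  mu_n z n = src z (ell_n z) n - RtoC (/ 2) * conv (mu_n z) (mu_n z) n.
Proof.
  unfold mu_n at 1; simpl; rewrite Nat.eqb_refl; simpl.
  apply (f_equal2 Cminus); [|apply f_equal].
  - apply src_ext; intros k Hk; now rewrite pre_lt.
  - apply conv_pre; try (intros k Hk; now rewrite pre_lt);
      try (now rewrite pre_ge); apply mu_n_0.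
Qed.

Lemma ell_n_rec (z : C3) (n : nat) :
  ell_n z n = - mu_n z n - conv (mu_n z) (ell_n z) n.
Proof.
  unfold ell_n at 1, mu_n at 1; simpl; rewrite Nat.eqb_refl; simpl.
  apply f_equal.
  apply conv_pre; try (intros k Hk; now rewrite pre_lt);
      try (now rewrite pre_ge); [apply mu_n_0|apply ell_n_0].
Qed.

(** The induction needs [MM/2 + 8 MM^2 <= MM] for [mu] and [MM + 32 MM^2 <= 2 MM] for [ell], that is
    [32 MM <= 1]. The smaller value also keeps [mu] within 3/100 of zero. *)
Definition MM : R := (/ 100)%R.

Lemma graded_src (f : nat -> C3 -> C) (n : nat) :
  (forall k, graded k (f k) (2 * MM * wt k)) ->
  graded n (fun z => src z (fun k => f k z) n) (MM / 2 * wt n).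
Proof.
  intros Hf.
  assert (Hp : (0 <= MM / 2 * wt n)%R) by (pose proof (wt_pos n); unfold MM; lra).
  assert (Hz : forall n, (0 <= MM / 2 * wt n)%R -> graded n (fun _ => 0) (MM / 2 * wt n))
    by (intros; apply graded_le with 0%R; [auto|apply graded_zero]).
  destruct n as [|[|[|[|[|[|[|n]]]]]]].
  - apply graded_ext with (fun _ => 0); [intros [[? ?] ?]; reflexivity|auto].
  - apply graded_ext with (fun _ => 0); [intros [[? ?] ?]; reflexivity|auto].
  - apply graded_ext with (fun _ => 0); [intros [[? ?] ?]; reflexivity|auto].
  - apply graded_ext with (fun _ => 0); [intros [[? ?] ?]; reflexivity|auto].
  - apply graded_ext with (fun z : C3 => RtoC (/ 4) * fst (fst z)); [intros [[? ?] ?]; reflexivity|].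
    apply graded_le with (Cmod (RtoC (/ 4)) * dl)%R; [|apply graded_scal, graded_coord1].
    rewrite Cmod_R, Rabs_pos_eq by lra. unfold wt, dl, MM; simpl; lra.
  - apply graded_ext with (fun z : C3 => RtoC (/ 2) * snd (fst z)); [intros [[? ?] ?]; reflexivity|].
    apply graded_le with (Cmod (RtoC (/ 2)) * dl)%R; [|apply graded_scal, graded_coord2].
    rewrite Cmod_R, Rabs_pos_eq by lra. unfold wt, dl, MM; simpl; lra.
  - apply graded_ext with (fun z : C3 => RtoC (/ 8) * snd z); [intros [[? ?] ?]; reflexivity|].
    apply graded_le with (Cmod (RtoC (/ 8)) * dl)%R; [|apply graded_scal, graded_coord3].
    rewrite Cmod_R, Rabs_pos_eq by lra. unfold wt, dl, MM; simpl; lra.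
  - set (c := RtoC (- 2 / ((INR n + 3) * (INR n + 1)))).
    apply graded_ext with (fun z : C3 => RtoC (/ 4) * (snd (fst z) * (c * f (S (S n)) z)));
      [intros [[? ?] ?]; reflexivity|].
    assert (Hc : (Cmod c <= 2 / 3)%R).
    { unfold c; rewrite Cmod_R. pose proof (pos_INR n).
      replace (- 2 / ((INR n + 3) * (INR n + 1)))%R with (- (2 / ((INR n + 3) * (INR n + 1))))%R by (field; lra).
      rewrite Rabs_Ropp, Rabs_pos_eq.
      - unfold Rdiv; apply Rmult_le_compat_l; [lra|]; apply Rinv_le_contravar; nra.
      - apply Rlt_le, Rdiv_lt_0_compat; nra. }
    apply graded_le with (Cmod (RtoC (/ 4)) * (2 * dl * (Cmod c * (2 * MM * wt (S (S n))))))%R.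
    + rewrite Cmod_R, Rabs_pos_eq by lra.
      (* Multiplication by [B] raises the degree by 5: the powers of 1/2 cost 32, and the inverse
         squares at most 16, since [n + 3 >= (n + 8)/4]. *)
      assert (Hw : (wt (S (S n)) <= 512 * wt (7 + n))%R).
      { unfold wt. replace (7 + n)%nat with (5 + S (S n))%nat by lia. rewrite pow_add, plus_INR.
        pose proof (half_pow_pos (S (S n))) as Hh; set (h := ((/ 2) ^ S (S n))%R) in *.
        rewrite !S_INR; pose proof (pos_INR n) as Hn; change (INR 0) with 0%R; set (x := INR n) in *.
        apply Rle_trans with (h * (16 * / ((x + 8) * (x + 8))))%R.
        - apply Rmult_le_compat_l; [lra|].
          replace (16 * / ((x + 8) * (x + 8)))%R with (/ ((x + 8) / 4 * ((x + 8) / 4)))%R by (field; lra).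
          apply Rinv_le_contravar; nra.
        - apply Req_le; field; lra. }
      change (S (S (S (S (S (S (S n))))))) with (7 + n)%nat.
      pose proof (wt_pos (7 + n)); pose proof (wt_pos (S (S n))); pose proof (Cmod_ge_0 c).
      assert (Cmod c * (2 * MM * wt (S (S n))) <= 2 / 3 * (2 * MM * (512 * wt (7 + n))))%R
        by (apply Rmult_le_compat; unfold MM in *; lra).
      unfold dl, MM in *; lra.
    + change (S (S (S (S (S (S (S n))))))) with (5 + S (S n))%nat.
      apply graded_scal, graded_mult; [apply graded_coord2|apply graded_scal, Hf].
Qed.

(** Majorant argument: the source uses up half of [MM * wt k], and the quadratic terms fit into the
    rest because [MM] is small. Values beyond the computed range are zero, so the bounds hold for
    every [k]. *)
Lemma graded_pre (n k : nat) :
  graded k (fun z => fst (pre z n k)) (MM * wt k) /\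
  graded k (fun z => snd (pre z n k)) (2 * MM * wt k).
Proof.
  revert k; induction n as [|n IH]; intros k.
  - pose proof (wt_pos k); split; apply graded_le with 0%R; try apply graded_zero; unfold MM; lra.
  - simpl; destruct (Nat.eqb_spec k n) as [->|E]; [|apply IH].
    assert (Hmu : graded n (fun z => fst (step z (pre z n) n)) (MM * wt n)).
    { unfold step; simpl.
      apply graded_ext with (fun z => src z (fun k => snd (pre z n k)) n +
         (RtoC (- / 2)) * conv (fun k => fst (pre z n k)) (fun k => fst (pre z n k)) n).
      { intros z; rewrite RtoC_opp; ring. }
      apply graded_le with (MM / 2 * wt n + Cmod (RtoC (- / 2)) * (16 * MM * MM * wt n))%R.
      - rewrite Cmod_R, Rabs_Ropp, Rabs_pos_eq by lra. pose proof (wt_pos n); unfold MM; lra.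
      - apply graded_plus.
        + apply (graded_src (fun k z => snd (pre z n k))); intros; apply IH.
        + apply graded_scal, (graded_conv n (fun k z => fst (pre z n k)) (fun k z => fst (pre z n k)));
            try (unfold MM; lra); intros; apply IH. }
    split; auto.
    unfold step at 1; simpl.
    apply graded_ext with (fun z => (RtoC (- 1)) * fst (step z (pre z n) n) +
       (RtoC (- 1)) * conv (fun k => fst (pre z n k)) (fun k => snd (pre z n k)) n).
    { intros z; unfold step; simpl fst; ring. }
    apply graded_le with (Cmod (RtoC (- 1)) * (MM * wt n) + Cmod (RtoC (-1)) * (16 * MM * (2 * MM) * wt n))%R.
    + rewrite Cmod_R. rewrite Rabs_left by lra. pose proof (wt_pos n); unfold MM; lra.
    + apply graded_plus; apply graded_scal; auto.
      apply (graded_conv n (fun k z => fst (pre z n k)) (fun k z => snd (pre z n k)));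
            try (unfold MM; lra); intros; apply IH.
Qed.

Lemma graded_mu_n (n : nat) : graded n (fun z => mu_n z n) (MM * wt n).
Proof. apply (graded_pre (S n) n). Qed.

Lemma graded_ell_n (n : nat) : graded n (fun z => ell_n z n) (2 * MM * wt n).
Proof. apply (graded_pre (S n) n). Qed.

Definition lam_n (z : C3) (n : nat) : C := RtoC (/ (INR n + 1)) * ell_n z n.
Definition om_n (z : C3) (n : nat) : C := om_c (ell_n z) n.

Lemma graded_lam_n (n : nat) : graded n (fun z => lam_n z n) (2 * MM * wt n).
Proof.
  apply graded_le with (Cmod (RtoC (/ (INR n + 1))) * (2 * MM * wt n))%R;
    [|apply graded_scal, graded_ell_n].
  pose proof (pos_INR n); pose proof (wt_pos n).
  assert (0 < / (INR n + 1) <= 1)%R.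
  { split; [apply Rinv_0_lt_compat; lra|]. rewrite <- Rinv_1; apply Rinv_le_contravar; lra. }
  rewrite Cmod_R, Rabs_pos_eq by lra. unfold MM; nra.
Qed.

Lemma graded_om_n (n : nat) : graded n (fun z => om_n z n) (2 * MM * wt n).
Proof.
  destruct n as [|[|n]].
  - apply graded_le with 0%R; [pose proof (wt_pos 0); unfold MM; lra|apply graded_zero].
  - apply graded_le with 0%R; [pose proof (wt_pos 1); unfold MM; lra|apply graded_zero].
  - set (c := RtoC (- 2 / ((INR n + 3) * (INR n + 1)))).
    apply graded_le with (Cmod c * (2 * MM * wt (S (S n))))%R;
      [|apply (graded_scal (S (S n)) c), graded_ell_n].
    assert (Hc : (Cmod c <= 1)%R).
    { unfold c; rewrite Cmod_R. pose proof (pos_INR n).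
      replace (- 2 / ((INR n + 3) * (INR n + 1)))%R with (- (2 / ((INR n + 3) * (INR n + 1))))%R by (field; lra).
      rewrite Rabs_Ropp, Rabs_pos_eq.
      - apply Rmult_le_reg_r with ((INR n + 3) * (INR n + 1))%R; [nra|].
        unfold Rdiv; rewrite Rmult_assoc, Rinv_l; nra.
      - apply Rlt_le, Rdiv_lt_0_compat; nra. }
    pose proof (wt_pos (S (S n))); unfold MM; nra.
Qed.

(** * Sums of graded series *)

Lemma functional_choice {A B : Type} (P : A -> B -> Prop) :
  (forall x, exists y, P x y) -> exists f : A -> B, forall x, P x (f x).
Proof.
  intros H; exists (fun x => proj1_sig (constructive_indefinite_description _ (H x))).
  intros x; exact (proj2_sig (constructive_indefinite_description _ (H x))).
Qed.

Lemma D3_plus (f g : C3 -> C) (z : C3) (a b c a' b' c' : C) :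
  D3 f z a b c -> D3 g z a' b' c' -> D3 (fun z => f z + g z) z (a + a') (b + b') (c + c').
Proof.
  intros H H'; eapply approx_eq_lin; [|apply (approx_plus _ _ _ _ _ _ H H')].
  intros [[? ?] ?]; destruct z as [[? ?] ?]; simpl; ring.
Qed.

Lemma D3_Csum (f : nat -> C3 -> C) (z : C3) (a b c : nat -> C) (N : nat) :
  (forall n, D3 (f n) z (a n) (b n) (c n)) ->
  D3 (fun z => Csum (fun n => f n z) N) z (Csum a N) (Csum b N) (Csum c N).
Proof. intros H; induction N as [|N IH]; simpl; [apply H|now apply D3_plus]. Qed.

(** A Lipschitz bound limits the derivative in each unit direction; the step [h] is small enough to
    stay both in the ball and within the range of the linear approximation. *)
Lemma D3_gradient_bound (f : C3 -> C) (z : C3) (a b c : C) (l : R) :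
  (norm3 z < dl)%R -> (0 <= l)%R -> D3 f z a b c ->
  (forall z', (norm3 z' < dl)%R -> (dl * Cmod (f z' - f z) <= l * dist3 z z')%R) ->
  (dl * Cmod a <= l /\ dl * Cmod b <= l /\ dl * Cmod c <= l)%R.
Proof.
  intros Hz Hl [_ HD] HL.
  assert (H : forall e : C3, norm3 e = 1%R -> (dl * Cmod (lin3 a b c e) <= l)%R).
  { intros e He; apply le_epsilon; intros eps Heps; pose proof dl_pos as Hdl.
    destruct (HD (eps / dl)%R) as [del [Hdel H]]; [now apply Rdiv_lt_0_compat|].
    set (h := (Rmin del (dl - norm3 z) / 2)%R).
    pose proof (Rmin_pos del (dl - norm3 z) Hdel ltac:(lra)).
    pose proof (Rmin_l del (dl - norm3 z)); pose proof (Rmin_r del (dl - norm3 z)).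
    assert (Hh : (0 < h)%R) by (unfold h; lra).
    set (z' := (let '(x, y, w) := z in let '(x', y', w') := e in
                (x + RtoC h * x', y + RtoC h * y', w + RtoC h * w')) : C3).
    assert (E1 : dist3 z z' = h).
    { unfold dist3, z'; destruct z as [[x y] w], e as [[x' y'] w']; simpl in *.
      replace (x + RtoC h * x' - x) with (RtoC h * x') by ring.
      replace (y + RtoC h * y' - y) with (RtoC h * y') by ring.
      replace (w + RtoC h * w' - w) with (RtoC h * w') by ring.
      rewrite !Cmod_mult, Cmod_R, Rabs_pos_eq by lra. nra. }
    assert (E2 : (norm3 z' <= norm3 z + h)%R).
    { rewrite <- E1; unfold dist3; destruct z as [[x y] w], z' as [[x' y'] w']; simpl.
      pose proof (Cmod_triangle_inv x' x); pose proof (Cmod_triangle_inv y' y);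
      pose proof (Cmod_triangle_inv w' w); lra. }
    assert (E3 : lin3 a b c (sub3 z' z) = RtoC h * lin3 a b c e).
    { unfold z'; destruct z as [[x y] w], e as [[x' y'] w']; simpl; ring. }
    specialize (H z'); rewrite E1, E3 in H; specialize (H ltac:(unfold h in *; lra)).
    specialize (HL z' ltac:(unfold h in *; lra)); rewrite E1 in HL.
    pose proof (Cmod_minus_le (f z' - f z) (f z' - f z - RtoC h * lin3 a b c e)) as H3.
    replace (f z' - f z - (f z' - f z - RtoC h * lin3 a b c e))
      with (RtoC h * lin3 a b c e) in H3 by ring.
    rewrite Cmod_mult, Cmod_R, (Rabs_pos_eq h) in H3 by lra.
    apply Rmult_le_reg_r with h; auto.
    replace ((l + eps) * h)%R with (l * h + dl * (eps / dl * h))%R by (field; lra).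
    nra. }
  pose proof (H (RtoC 1, RtoC 0, RtoC 0) ltac:(simpl; rewrite Cmod_1, Cmod_0; lra)) as Ha.
  pose proof (H (RtoC 0, RtoC 1, RtoC 0) ltac:(simpl; rewrite Cmod_1, Cmod_0; lra)) as Hb.
  pose proof (H (RtoC 0, RtoC 0, RtoC 1) ltac:(simpl; rewrite Cmod_1, Cmod_0; lra)) as Hc.
  simpl in Ha, Hb, Hc.
  replace (a * 1 + b * 0 + c * 0) with a in Ha by ring.
  replace (a * 0 + b * 1 + c * 0) with b in Hb by ring.
  replace (a * 0 + b * 0 + c * 1) with c in Hc by ring. auto.
Qed.

Lemma graded_dom (K : R) (f : nat -> C3 -> C) (z : C3) :
  (0 <= K)%R -> (forall n, graded n (f n) (K * wt n)) -> (norm3 z < dl)%R ->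
  dom K (fun n => f n z).
Proof.
  intros HK Hf Hz n; destruct (Hf n) as [_ H]; destruct (H z Hz) as [H1 _].
  pose proof (wt_le n); nra.
Qed.

Lemma graded_series_bound (K : R) (f : nat -> C3 -> C) (z : C3) :
  (0 <= K)%R -> (forall n, graded n (f n) (K * wt n)) -> (norm3 z < dl)%R ->
  (Cmod (CS (fun n => f n z)) <= 3 * K)%R.
Proof. intros; apply CS_bound; now apply graded_dom. Qed.

Lemma graded_dom_diff (K : R) (f : nat -> C3 -> C) (z z' : C3) :
  (0 <= K)%R -> (forall n, graded n (f n) (K * wt n)) ->
  (norm3 z < dl)%R -> (norm3 z' < dl)%R ->
  dom (K * dist3 z z' / dl) (fun n => f n z' + (RtoC (-1)) * f n z).
Proof.
  intros HK Hf Hz Hz' n; destruct (Hf n) as [_ H]; destruct (H z Hz) as [_ [H1 _]].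
  specialize (H1 z' Hz'). pose proof dl_pos as Hdl.
  replace (f n z' + RtoC (-1) * f n z) with (f n z' - f n z) by ring.
  apply Rmult_le_reg_l with dl; auto. eapply Rle_trans; [exact H1|].
  replace (dl * (K * dist3 z z' / dl * (/ 2) ^ n))%R with (K * dist3 z z' * (/ 2) ^ n)%R by (field; lra).
  pose proof (wt_le n); pose proof (dist3_pos z z').
  replace (K * wt n * dist3 z z')%R with (K * dist3 z z' * wt n)%R by ring.
  apply Rmult_le_compat_l; auto; nra.
Qed.

Lemma CS_diff (K : R) (f : nat -> C3 -> C) (z z' : C3) :
  (0 <= K)%R -> (forall n, graded n (f n) (K * wt n)) ->
  (norm3 z < dl)%R -> (norm3 z' < dl)%R ->
  CS (fun n => f n z' + (RtoC (-1)) * f n z) = CS (fun n => f n z') - CS (fun n => f n z).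
Proof.
  intros HK Hf Hz Hz'.
  rewrite (CS_plus K (Cmod (RtoC (-1)) * K)); [|now apply graded_dom|now apply dom_scal, graded_dom].
  rewrite (CS_scal K) by now apply graded_dom. ring.
Qed.

Lemma graded_series_lipschitz (K : R) (f : nat -> C3 -> C) (z z' : C3) :
  (0 <= K)%R -> (forall n, graded n (f n) (K * wt n)) ->
  (norm3 z < dl)%R -> (norm3 z' < dl)%R ->
  (dl * Cmod (CS (fun n => f n z') - CS (fun n => f n z)) <= 3 * K * dist3 z z')%R.
Proof.
  intros HK Hf Hz Hz'; rewrite <- (CS_diff K) by auto.
  pose proof (CS_bound _ _ (graded_dom_diff K f z z' HK Hf Hz Hz')) as H.
  pose proof dl_pos as Hdl.
  apply (Rmult_le_compat_l dl) in H; [|lra].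
  replace (dl * (3 * (K * dist3 z z' / dl)))%R with (3 * K * dist3 z z')%R in H by (field; lra). auto.
Qed.

(** The Lipschitz constants of the terms are summable, so the remainder of the series is small
    relative to the distance, uniformly in the ball; the gradients of the terms are summable for the
    same reason. Euler's identity is then summed degree by degree. *)
Lemma graded_series_D3 (K : R) (f : nat -> C3 -> C) (z : C3) :
  (0 <= K)%R -> (forall n, graded n (f n) (K * wt n)) -> (norm3 z < dl)%R ->
  exists ga gb gc, D3 (fun z => CS (fun n => f n z)) z ga gb gc /\
    euler3 z ga gb gc = CS (fun n => RtoC (INR n) * f n z) /\
    (dl * Cmod ga <= 3 * K /\ dl * Cmod gb <= 3 * K /\ dl * Cmod gc <= 3 * K)%R.
Proof.
  intros HK Hf Hz. pose proof dl_pos as Hdl.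
  assert (HG : exists g : nat -> C3, forall n, let '(a, b, c) := g n in
     D3 (f n) z a b c /\ euler3 z a b c = RtoC (INR n) * f n z).
  { apply (functional_choice (fun n (g : C3) => let '(a, b, c) := g in
      D3 (f n) z a b c /\ euler3 z a b c = RtoC (INR n) * f n z)); intros n; destruct (Hf n) as [_ H].
    destruct (H z Hz) as [_ [_ [a [b [c Habc]]]]]; now exists (a, b, c). }
  destruct HG as [g Hg].
  set (a := fun n => fst (fst (g n))); set (b := fun n => snd (fst (g n))); set (c := fun n => snd (g n)).
  assert (HD : forall n, D3 (f n) z (a n) (b n) (c n)).
  { intros n; specialize (Hg n); unfold a, b, c; destruct (g n) as [[? ?] ?]; apply Hg. }
  assert (HE : forall n, euler3 z (a n) (b n) (c n) = RtoC (INR n) * f n z).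
  { intros n; specialize (Hg n); unfold a, b, c; destruct (g n) as [[? ?] ?]; apply Hg. }
  assert (HB : dom (K / dl) a /\ dom (K / dl) b /\ dom (K / dl) c).
  { assert (HB : forall n, (dl * Cmod (a n) <= K * wt n /\ dl * Cmod (b n) <= K * wt n
                             /\ dl * Cmod (c n) <= K * wt n)%R).
    { intros n; destruct (Hf n) as [H0 H]; apply (D3_gradient_bound (f n) z); auto.
      intros z' Hz'; now apply H. }
    assert (HB' : forall (x : C) (n : nat), (dl * Cmod x <= K * wt n)%R -> (Cmod x <= K / dl * (/ 2) ^ n)%R).
    { intros x n Hx; apply Rmult_le_reg_l with dl; auto. eapply Rle_trans; [exact Hx|].
      replace (dl * (K / dl * (/ 2) ^ n))%R with (K * (/ 2) ^ n)%R by (field; lra).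
      apply Rmult_le_compat_l; [auto|apply wt_le]. }
    repeat split; intros n; apply HB'; apply HB. }
  destruct HB as [Ba [Bb Bc]].
  assert (B3 : forall x : C, (Cmod x <= 3 * (K / dl))%R -> (dl * Cmod x <= 3 * K)%R).
  { intros x Hx; replace (3 * K)%R with (dl * (3 * (K / dl)))%R by (field; lra).
    apply Rmult_le_compat_l; lra. }
  exists (CS a), (CS b), (CS c); split; [|split].
  - split.
    + exists (Cmod (CS a) + Cmod (CS b) + Cmod (CS c))%R; split.
      * pose proof (Cmod_ge_0 (CS a)); pose proof (Cmod_ge_0 (CS b)); pose proof (Cmod_ge_0 (CS c)); lra.
      * intros z'; apply lin3_bound.
    + intros eps He.
      (* The 8 collects 2 from the tail of the differences and 2 from the tail of each of the three
         partial derivatives. *)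
      destruct (half_pow_small (8 * (K / dl))%R (eps / 2)%R ltac:(lra)) as [N HN].
      destruct (D3_Csum f z a b c N HD) as [_ HS].
      destruct (HS (eps / 2)%R ltac:(lra)) as [del [Hdel H]].
      exists (Rmin del (dl - norm3 z)); split; [apply Rmin_pos; lra|].
      intros z' Hz'0.
      pose proof (Rlt_le_trans _ _ _ Hz'0 (Rmin_l _ _)) as Hz'1.
      pose proof (Rlt_le_trans _ _ _ Hz'0 (Rmin_r _ _)) as Hz'2.
      assert (Hz' : (norm3 z' < dl)%R).
      { revert Hz'2; unfold dist3; destruct z as [[x y] w], z' as [[x' y'] w']; simpl.
        pose proof (Cmod_triangle_inv x' x); pose proof (Cmod_triangle_inv y' y);
        pose proof (Cmod_triangle_inv w' w); lra. }
      specialize (H z' Hz'1).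
      pose proof (CS_tail _ _ N (graded_dom_diff K f z z' HK Hf Hz Hz')) as HT.
      rewrite (CS_diff K), Csum_plus, Csum_scal in HT by auto.
      pose proof (CS_tail _ _ N Ba) as Ta; pose proof (CS_tail _ _ N Bb) as Tb;
      pose proof (CS_tail _ _ N Bc) as Tc.
      assert (HL : (Cmod (lin3 (CS a - Csum a N) (CS b - Csum b N) (CS c - Csum c N) (sub3 z' z))
        <= 6 * (K / dl) * (/ 2) ^ N * dist3 z z')%R).
      { eapply Rle_trans; [apply lin3_bound|]. apply Rmult_le_compat_r; [apply norm3_pos|lra]. }
      set (F := CS (fun n => f n z')) in *; set (F0 := CS (fun n => f n z)) in *.
      set (S := Csum (fun n => f n z') N) in *; set (S0 := Csum (fun n => f n z) N) in *.
      replace (F - F0 - lin3 (CS a) (CS b) (CS c) (sub3 z' z)) with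
        ((F - F0 - (S + RtoC (-1) * S0)) + (S - S0 - lin3 (Csum a N) (Csum b N) (Csum c N) (sub3 z' z)) +
         (- lin3 (CS a - Csum a N) (CS b - Csum b N) (CS c - Csum c N) (sub3 z' z)))
        by (destruct (sub3 z' z) as [[? ?] ?]; simpl; ring).
      eapply Rle_trans; [apply Cmod_triangle3|]. rewrite Cmod_opp.
      replace (2 * (K * dist3 z z' / dl) * (/ 2) ^ N)%R
        with (2 * (K / dl) * (/ 2) ^ N * dist3 z z')%R in HT by (field; lra).
      pose proof (dist3_pos z z').
      assert (8 * (K / dl) * (/ 2) ^ N * dist3 z z' <= eps / 2 * dist3 z z')%R
        by (apply Rmult_le_compat_r; lra).
      lra.
  - rewrite (CS_ext (fun n => RtoC (INR n) * f n z) (fun n => euler3 z (a n) (b n) (c n)))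
      by (intros; now rewrite HE).
    destruct z as [[x y] w]; unfold euler3.
    rewrite (CS_plus (Cmod (4 * x) * (K / dl) + Cmod (5 * y) * (K / dl)) (Cmod (6 * w) * (K / dl)));
      [|apply dom_plus; now apply dom_scal|now apply dom_scal].
    rewrite (CS_plus (Cmod (4 * x) * (K / dl)) (Cmod (5 * y) * (K / dl))) by now apply dom_scal.
    now rewrite !(CS_scal (K / dl)) by auto.
  - split; [|split]; apply B3; now apply CS_bound.
Qed.

(* On the Painleve solution [(p, h)], at the point [y = q^(-2)]: [x = p + q (1 + lam)],
   [y' = - 2 q^(-3) (1 + mu)], [dx/dq = 1 + ell] and [z q^6 = A + B (2 + om)]. *)
Definition mu (z : C3) : C := CS (mu_n z).
Definition ell (z : C3) : C := CS (ell_n z).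
Definition lam (z : C3) : C := CS (lam_n z).
Definition om (z : C3) : C := CS (om_n z).

(** * Identities and bounds for the four sums *)

Lemma MM_pos : (0 <= MM)%R.
Proof. unfold MM; lra. Qed.

Lemma dom_mu_n (z : C3) : (norm3 z < dl)%R -> dom MM (mu_n z).
Proof. apply (graded_dom MM (fun n z => mu_n z n)); [apply MM_pos|apply graded_mu_n]. Qed.

Lemma dom_ell_n (z : C3) : (norm3 z < dl)%R -> dom (2 * MM) (ell_n z).
Proof. apply (graded_dom (2 * MM) (fun n z => ell_n z n)); [pose proof MM_pos; lra|apply graded_ell_n]. Qed.

Lemma dom_lam_n (z : C3) : (norm3 z < dl)%R -> dom (2 * MM) (lam_n z).
Proof. apply (graded_dom (2 * MM) (fun n z => lam_n z n)); [pose proof MM_pos; lra|apply graded_lam_n]. Qed.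

Lemma dom_om_n (z : C3) : (norm3 z < dl)%R -> dom (2 * MM) (om_n z).
Proof. apply (graded_dom (2 * MM) (fun n z => om_n z n)); [pose proof MM_pos; lra|apply graded_om_n]. Qed.

Lemma dom_conv_mu (z : C3) (K : R) (f : nat -> C3 -> C) :
  (norm3 z < dl)%R -> (0 <= K)%R -> (forall n, graded n (f n) (K * wt n)) ->
  dom (16 * MM * K) (conv (mu_n z) (fun n => f n z)).
Proof.
  intros Hz HK Hf. pose proof MM_pos.
  apply (graded_dom (16 * MM * K) (fun n z => conv (mu_n z) (fun n => f n z) n)); auto; [nra|].
  intros n; apply (graded_conv n (fun n z => mu_n z n)); auto using graded_mu_n.
Qed.

(** This is [dy/dx = y'] in the parameter [q]: [dy/dq = -2 q^(-3)], [dx/dq = 1 + ell] and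
    [y' = -2 q^(-3) (1 + mu)]. *)
Lemma mu_ell (z : C3) : (norm3 z < dl)%R -> (1 + mu z) * (1 + ell z) = 1.
Proof.
  intros Hz. pose proof MM_pos as HM.
  assert (E : ell z = RtoC (-1) * mu z + RtoC (-1) * (mu z * ell z)).
  { unfold ell at 1; rewrite (CS_ext _ (fun n => RtoC (-1) * mu_n z n + RtoC (-1) * conv (mu_n z) (ell_n z) n)).
    2:{ intros n; rewrite ell_n_rec; ring. }
    pose proof (dom_mu_n z Hz) as D1. pose proof (dom_ell_n z Hz) as D2.
    assert (D3 : dom (16 * MM * (2 * MM)) (conv (mu_n z) (ell_n z)))
      by (apply (dom_conv_mu z (2 * MM) (fun n z => ell_n z n) Hz); [lra|apply graded_ell_n]).
    rewrite (CS_plus _ _ _ _ (dom_scal _ _ _ D1) (dom_scal _ _ _ D3)).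
    rewrite (CS_scal _ _ _ D1), (CS_scal _ _ _ D3), (CS_conv _ _ _ _ D1 D2). reflexivity. }
  replace ((1 + mu z) * (1 + ell z)) with (1 + mu z + mu z * ell z + ell z) by ring.
  rewrite E at 2; ring.
Qed.

Lemma CS_src (A B D : C) :
  (norm3 (A, B, D) < dl)%R ->
  CS (src (A, B, D) (ell_n (A, B, D))) =
  RtoC (/ 4) * A + RtoC (/ 2) * B + RtoC (/ 8) * D + RtoC (/ 4) * (B * om (A, B, D)).
Proof.
  intros Hz; set (z := (A, B, D)) in *. pose proof MM_pos as HM.
  assert (D1 : dom (MM / 2) (src z (ell_n z))).
  { apply (graded_dom (MM / 2) (fun n z => src z (ell_n z) n)); auto; [lra|].
    intros n; apply (graded_src (fun n z => ell_n z n)), graded_ell_n. }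
  (* From degree 7 on, the source is a shift of [om_n] by 5. The partial sum up to [N] thus contains
     [om_n] up to [N - 5], and the shift multiplies the tail bound by [2^5 = 32]. *)
  apply CS_unique with (MM / 2)%R (Cmod (RtoC (/ 4) * B) * (2 * (2 * MM)) * 32)%R 7%nat; auto.
  intros N HN.
  assert (ES : Csum (src z (ell_n z)) N =
    RtoC (/ 4) * A + RtoC (/ 2) * B + RtoC (/ 8) * D + RtoC (/ 4) * (B * Csum (om_n z) (N - 5))).
  { replace N with ((N - 7) + 7)%nat by lia. generalize (N - 7)%nat; intros m; clear HN.
    replace (m + 7 - 5)%nat with (m + 2)%nat by lia.
    induction m as [|m IH].
    - unfold z at 1; simpl; unfold om_n; simpl; ring.
    - replace (S m + 7)%nat with (S (m + 7)) by lia. replace (S m + 2)%nat with (S (m + 2)) by lia.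
      cbn [Csum]; rewrite IH.
      assert (E : src z (ell_n z) (S (m + 7)) = RtoC (/ 4) * (B * om_n z (S (m + 2)))).
      { replace (S (m + 7)) with (5 + S (S (S m)))%nat by lia. replace (S (m + 2)) with (S (S (S m))) by lia.
        reflexivity. }
      rewrite E; ring. }
  rewrite ES.
  match goal with |- (Cmod ?x <= _)%R =>
    replace x with (RtoC (/ 4) * B * (om z - Csum (om_n z) (N - 5))) by ring end.
  rewrite Cmod_mult.
  pose proof (CS_tail _ _ (N - 5) (dom_om_n z Hz)) as HT.
  assert (E : ((/ 2) ^ N = / 32 * (/ 2) ^ (N - 5))%R).
  { replace N with (5 + (N - 5))%nat at 1 by lia. rewrite pow_add; simpl; field. }
  rewrite E.
  eapply Rle_trans; [apply Rmult_le_compat_l; [apply Cmod_ge_0|exact HT]|].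
  apply Req_le; field.
Qed.

(** The energy relation [y'^2 = 4 y^3 + h + 2 z] multiplied by [q^6]. *)
Lemma mu_square (A B D : C) :
  (norm3 (A, B, D) < dl)%R ->
  4 * (1 + mu (A, B, D)) ^ 2 = 4 + D + 2 * (A + B * (2 + om (A, B, D))).
Proof.
  intros Hz; set (z := (A, B, D)) in *. pose proof MM_pos as HM.
  pose proof (dom_mu_n z Hz) as D1.
  assert (D2 : dom (MM / 2) (src z (ell_n z))).
  { apply (graded_dom (MM / 2) (fun n z => src z (ell_n z) n)); auto; [lra|].
    intros n; apply (graded_src (fun n z => ell_n z n)), graded_ell_n. }
  assert (D3 : dom (16 * MM * MM) (conv (mu_n z) (mu_n z)))
    by apply (dom_conv_mu z MM (fun n z => mu_n z n) Hz HM graded_mu_n).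
  assert (E : mu z = RtoC (/ 4) * A + RtoC (/ 2) * B + RtoC (/ 8) * D + RtoC (/ 4) * (B * om z)
                     + RtoC (- / 2) * (mu z * mu z)).
  { unfold mu at 1; rewrite (CS_ext _ (fun n => src z (ell_n z) n + RtoC (- / 2) * conv (mu_n z) (mu_n z) n)).
    2:{ intros n; rewrite mu_n_rec, RtoC_opp; ring. }
    rewrite (CS_plus _ _ _ _ D2 (dom_scal _ _ _ D3)), (CS_scal _ _ _ D3), (CS_conv _ _ _ _ D1 D1).
    unfold z; rewrite CS_src by auto; reflexivity. }
  assert (H4 : RtoC (/ 4) = / 4) by (rewrite RtoC_inv; [reflexivity|lra]).
  assert (H2 : RtoC (/ 2) = / 2) by (rewrite RtoC_inv; [reflexivity|lra]).
  assert (H8 : RtoC (/ 8) = / 8) by (rewrite RtoC_inv; [reflexivity|lra]).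
  rewrite RtoC_opp, H2, H4, H8 in E.
  replace (4 * (1 + mu z) ^ 2) with (4 + 8 * mu z + 4 * (mu z * mu z)) by ring.
  rewrite E at 1. field. 
Qed.

Lemma mu_bound (z : C3) : (norm3 z < dl)%R -> (Cmod (mu z) <= 3 * / 100)%R.
Proof. intros Hz; apply (graded_series_bound MM (fun n z => mu_n z n)); auto using MM_pos, graded_mu_n. Qed.

Lemma lam_bound (z : C3) : (norm3 z < dl)%R -> (Cmod (lam z) <= 6 * / 100)%R.
Proof.
  intros Hz; pose proof MM_pos.
  eapply Rle_trans; [apply (graded_series_bound (2 * MM) (fun n z => lam_n z n)); auto using graded_lam_n; lra|].
  unfold MM; lra.
Qed.

(** The number 7200 is [6 MM / dl]: the sum is at most 3 times the constant [2 MM]. *)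
Lemma lam_lipschitz (z z' : C3) :
  (norm3 z < dl)%R -> (norm3 z' < dl)%R -> (Cmod (lam z' - lam z) <= 7200 * dist3 z z')%R.
Proof.
  intros Hz Hz'; pose proof MM_pos.
  assert (H1 : (dl * Cmod (lam z' - lam z) <= 3 * (2 * MM) * dist3 z z')%R)
    by (apply (graded_series_lipschitz (2 * MM) (fun n z => lam_n z n)); auto using graded_lam_n; lra).
  unfold MM, dl in *; lra.
Qed.

Lemma om_lipschitz (z z' : C3) :
  (norm3 z < dl)%R -> (norm3 z' < dl)%R -> (Cmod (om z' - om z) <= 7200 * dist3 z z')%R.
Proof.
  intros Hz Hz'; pose proof MM_pos.
  assert (H1 : (dl * Cmod (om z' - om z) <= 3 * (2 * MM) * dist3 z z')%R)
    by (apply (graded_series_lipschitz (2 * MM) (fun n z => om_n z n)); auto using graded_om_n; lra).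
  unfold MM, dl in *; lra.
Qed.

Lemma mu_D3 (z : C3) : (norm3 z < dl)%R -> exists a b c, D3 mu z a b c.
Proof.
  intros Hz; destruct (graded_series_D3 MM (fun n z => mu_n z n) z MM_pos graded_mu_n Hz)
    as [a [b [c [H _]]]]; now exists a, b, c.
Qed.

(** The Euler clause is [(n + 1) lam_n = ell_n] summed over [n]. It says that [q (1 + lam)] has
    derivative [1 + ell] in [q] when [p] and [h] are fixed. *)
Lemma lam_D3 (z : C3) : (norm3 z < dl)%R -> exists a b c, D3 lam z a b c /\
  euler3 z a b c = ell z - lam z /\
  (Cmod a <= 7200 /\ Cmod b <= 7200 /\ Cmod c <= 7200)%R.
Proof.
  intros Hz; pose proof MM_pos.
  destruct (graded_series_D3 (2 * MM) (fun n z => lam_n z n) z ltac:(lra) graded_lam_n Hz)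
    as [a [b [c [H1 [H2 H3]]]]]; exists a, b, c; split; [exact H1|split].
  - rewrite H2.
    rewrite (CS_ext _ (fun n => ell_n z n + RtoC (-1) * lam_n z n)).
    + rewrite (CS_plus _ _ _ _ (dom_ell_n z Hz) (dom_scal _ _ _ (dom_lam_n z Hz))),
        (CS_scal _ _ _ (dom_lam_n z Hz)). unfold lam, ell; ring.
    + intros n; unfold lam_n. pose proof (pos_INR n).
      rewrite RtoC_inv, RtoC_plus by lra. field.
      cbv beta; rewrite <- RtoC_plus; intros E; apply RtoC_inj in E; lra.
  - unfold MM, dl in *; lra.
Qed.

(** The Euler clause expresses [dz/dy = x] for fixed [p] and [h], where
    [z = p q^(-2) + q^(-1) (2 + om)] and [y = q^(-2)]. *)
Lemma om_D3 (z : C3) : (norm3 z < dl)%R -> exists a b c, D3 om z a b c /\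
  euler3 z a b c = om z - 2 * lam z /\
  (Cmod a <= 7200 /\ Cmod b <= 7200 /\ Cmod c <= 7200)%R.
Proof.
  intros Hz; pose proof MM_pos.
  destruct (graded_series_D3 (2 * MM) (fun n z => om_n z n) z ltac:(lra) graded_om_n Hz)
    as [a [b [c [H1 [H2 H3]]]]]; exists a, b, c; split; [exact H1|split].
  - rewrite H2.
    rewrite (CS_ext _ (fun n => om_n z n + RtoC (-2) * lam_n z n)).
    + rewrite (CS_plus _ _ _ _ (dom_om_n z Hz) (dom_scal _ _ _ (dom_lam_n z Hz))),
        (CS_scal _ _ _ (dom_lam_n z Hz)). unfold lam, om; ring.
    + intros n; unfold lam_n, om_n, om_c. destruct n as [|[|n]].
      * rewrite ell_n_0; ring.
      (* Degree 1 is the resonant one: [(n - 1) om_n = -2 lam_n] is solvable there only because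
         [lam_1 = 0]. The choice [om_1 = 0] fixes the additive constant of [z]. *)
      * assert (E : ell_n z 1 = 0).
        { rewrite ell_n_rec, mu_n_rec; unfold conv; simpl.
          rewrite !mu_n_0, !ell_n_0; destruct z as [[? ?] ?]; simpl; ring. }
        rewrite E; ring.
      * pose proof (pos_INR n) as Hn. rewrite !S_INR.
        assert (E : ((INR n + 1 + 1) * (-2 / ((INR n + 3) * (INR n + 1))) =
                     -2 / ((INR n + 3) * (INR n + 1)) - 2 * / (INR n + 1 + 1 + 1))%R) by (field; lra).
        rewrite Cmult_assoc, <- RtoC_mult, E, RtoC_minus, RtoC_mult. ring.
  - unfold MM, dl in *; lra.
Qed.

(** * Normal-form coordinates *)

Definition kap (w : C) : C := / w - 4.
(** At [A = B = 0] the energy relation reads [4 m0^2 = 4 + kap = 1/w]. So [m0] is the branch of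
    [1/(2 sqrt w)] near 1, and the series supplies the square root that defines [q = v sqrt w]. *)
Definition m0 (w : C) : C := 1 + mu (RtoC 0, RtoC 0, kap w).
Definition qf (z : C3) : C := let '(t, v, w) := z in v / (2 * m0 w).
Definition pf (z : C3) : C :=
  let '(t, v, w) := z in t - qf z * (1 + lam (RtoC 0, RtoC 0, kap w)).
Definition zf (z : C3) : C3 :=
  let '(t, v, w) := z in (pf z * qf z ^ 4, qf z ^ 5, kap w).

Definition gamma (z : C3) : C := pf z + qf z * (1 + lam (zf z)).
Definition eta (z : C3) : C := 2 * qf z * (1 + mu (zf z)).
(** With [m = 1 + mu (zf z)], one needs [v^4 eta1 = (m - m0)/m0]. Writing
    [m - m0 = (m^2 - m0^2)/(m + m0)] and subtracting the two energy relations brings out a factor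
    [q^4 = v^4/(16 m0^4)], which cancels; what remains is regular at [v = 0]. *)
Definition eta1 (z : C3) : C :=
  let '(t, v, w) := z in
  (pf z + qf z * (2 + om (zf z))) / (32 * m0 w ^ 5 * (1 + mu (zf z) + m0 w)).
Definition Gam (z : C3) : C3 :=
  (gamma (tvw z), snd (fst z), - snd (fst z) ^ 2 * eta (tvw z)).

(** On the polydisk [|p| <= |x0| + 3] and [|q| <= |v|], so this choice gives [|p q| <= 10^(-9)].
    Together with [|kap| <= 10^(-6)], which follows from the value of [ep], it places [zf] in the
    ball of radius [dl]. *)
Definition rho_of (x0 : C) : R := (1000000000 * (Cmod x0 + 3))%R.
Definition ep : R := (/ 100000000)%R.

Lemma Cmod_pow_le (q : C) (n : nat) : (Cmod q <= 1)%R -> (Cmod (q ^ S n) <= Cmod q)%R.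
Proof.
  intros H; rewrite Cmod_pow. pose proof (Cmod_ge_0 q).
  simpl. rewrite <- (Rmult_1_r (Cmod q)) at 3. apply Rmult_le_compat_l; auto.
  rewrite <- (pow1 n). now apply pow_incr.
Qed.

Lemma near_one_neq_0 (a : C) (r : R) : (r < 1)%R -> (Cmod a <= r)%R -> 1 + a <> 0.
Proof.
  intros Hr Ha E. assert (E' : a = - (1)) by (replace a with (1 + a - 1) by ring; rewrite E; ring).
  rewrite E', Cmod_m1 in Ha; lra.
Qed.

Lemma norm3_kap (k : C) : norm3 (RtoC 0, RtoC 0, k) = Cmod k.
Proof. simpl; rewrite Cmod_0; ring. Qed.

Lemma kap_small (w : C) : (Cmod (w - / 4) < ep)%R ->
  w <> 0 /\ (Cmod (kap w) <= / 1000000)%R.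
Proof.
  intros H. unfold ep in H.
  assert (Hw : (/ 5 <= Cmod w)%R).
  { pose proof (Cmod_triangle_inv (/ 4) (/ 4 - w)) as H1.
    replace (/ 4 - (/ 4 - w)) with w in H1 by ring.
    rewrite (Cmod_minus_sym (/ 4) w) in H1.
    rewrite <- RtoC_inv in * by lra. rewrite Cmod_R, Rabs_pos_eq in H1 by lra. lra. }
  assert (Hw0 : w <> 0) by (apply Cmod_gt_0; lra).
  split; auto. unfold kap.
  replace (/ w - 4) with (- (4 * (w - / 4) * / w)).
  2:{ field; auto. }
  rewrite Cmod_opp, !Cmod_mult, Cmod_inv, Cmod_R, Rabs_pos_eq by (auto; lra).
  assert (Hi : (0 < / Cmod w <= 5)%R).
  { split; [apply Rinv_0_lt_compat; lra|].
    replace 5%R with (/ / 5)%R by field. apply Rinv_le_contravar; lra. }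
  pose proof (Cmod_ge_0 (w - / 4)). nra.
Qed.

(** The consequences of membership in the polydisk on which the estimates rest. They no longer
    mention [x0]. *)
Record region (z : C3) : Prop := {
  rg_w : snd z <> 0;
  rg_k : (norm3 (RtoC 0, RtoC 0, kap (snd z)) < dl)%R;
  rg_m0 : (Cmod (m0 (snd z) - 1) <= 3 * / 100)%R;
  rg_q : (Cmod (qf z) <= / 1000000000)%R;
  rg_pq : (Cmod (pf z) * Cmod (qf z) <= / 1000000000)%R;
  rg_z : (norm3 (zf z) < dl)%R }.

Lemma rg_m0_neq (z : C3) : region z -> m0 (snd z) <> 0.
Proof.
  intros H; pose proof (rg_m0 z H). replace (m0 (snd z)) with (1 + (m0 (snd z) - 1)) by ring.
  apply near_one_neq_0 with (3 * / 100)%R; [lra|auto].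
Qed.

Lemma polydisk_region (x0 : C) (z : C3) : polydisk x0 (rho_of x0) ep z -> region z.
Proof.
  destruct z as [[t v] w]; intros [Ht [Hv Hw]].
  destruct (kap_small w Hw) as [Hw0 Hk].
  assert (Hk3 : (norm3 (RtoC 0, RtoC 0, kap w) < dl)%R) by (rewrite norm3_kap; unfold dl; lra).
  assert (Hm : (Cmod (m0 w - 1) <= 3 * / 100)%R).
  { unfold m0. replace (1 + mu (RtoC 0, RtoC 0, kap w) - 1) with (mu (RtoC 0, RtoC 0, kap w)) by ring.
    now apply mu_bound. }
  assert (Hm1 : (/ 2 <= Cmod (m0 w))%R).
  { pose proof (Cmod_triangle_inv 1 (1 - m0 w)) as H.
    replace (1 - (1 - m0 w)) with (m0 w) in H by ring.
    rewrite (Cmod_minus_sym 1 (m0 w)), Cmod_1 in H. lra. }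
  set (X := Cmod x0) in *. assert (HX : (0 <= X)%R) by apply Cmod_ge_0.
  assert (Hq : (Cmod (qf (t, v, w)) <= Cmod v)%R).
  { unfold qf. rewrite Cmod_div, Cmod_mult, Cmod_R, Rabs_pos_eq by
      (try apply Cmult_neq_0; try apply Cmod_gt_0; try (rewrite Cmod_R, Rabs_pos_eq); lra).
    pose proof (Cmod_ge_0 v). unfold Rdiv. rewrite <- (Rmult_1_r (Cmod v)) at 2.
    apply Rmult_le_compat_l; auto. rewrite <- Rinv_1. apply Rinv_le_contravar; lra. }
  assert (Hr : (/ rho_of x0 * (X + 3) = / 1000000000)%R).
  { unfold rho_of; fold X. field; lra. }
  assert (HqX : (Cmod (qf (t, v, w)) * (X + 3) <= / 1000000000)%R).
  { rewrite <- Hr. apply Rmult_le_compat_r; lra. }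
  set (q := qf (t, v, w)) in *. pose proof (Cmod_ge_0 q) as Hq0.
  assert (Hq1 : (Cmod q <= / 1000000000)%R) by nra.
  assert (Hp : (Cmod (pf (t, v, w)) <= X + 3)%R).
  { unfold pf; fold q.
    eapply Rle_trans; [apply Cmod_minus_le|]. rewrite Cmod_mult.
    pose proof (lam_bound _ Hk3) as Hl. set (l := lam (RtoC 0, RtoC 0, kap w)) in *.
    pose proof (Cmod_triangle 1 l) as H2; rewrite Cmod_1 in H2.
    pose proof (Cmod_triangle (t - x0) x0) as H3. replace (t - x0 + x0) with t in H3 by ring.
    fold X in H3. pose proof (Cmod_ge_0 (1 + l)). nra. }
  assert (Hpq : (Cmod (pf (t, v, w)) * Cmod q <= / 1000000000)%R).
  { eapply Rle_trans; [|exact HqX]. rewrite Rmult_comm. apply Rmult_le_compat_l; auto. }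
  split; auto.
  change (norm3 ((pf (t, v, w) * q ^ 4)%C, (q ^ 5)%C, kap w) < dl)%R; unfold norm3.
  rewrite Cmod_mult.
  pose proof (Cmod_pow_le q 3 ltac:(lra)); pose proof (Cmod_pow_le q 4 ltac:(lra)).
  pose proof (Cmod_ge_0 (pf (t, v, w))).
  assert (Cmod (pf (t, v, w)) * Cmod (q ^ 4)%C <= / 1000000000)%R.
  { eapply Rle_trans; [|exact Hpq]. apply Rmult_le_compat_l; auto. }
  unfold dl; lra.
Qed.

(** If [u] or [u1] were 0, then [w] would be 0 by the convention for division, at distance 1/4 from
    the centre. *)
Lemma tpolydisk_polydisk (x0 : C) (rho eps : R) (t u u1 : C) :
  (eps < / 4)%R -> tpolydisk x0 rho eps (t, u, u1) ->
  polydisk x0 rho eps (tvw (t, u, u1)) /\ u <> 0 /\ u1 <> 0.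
Proof.
  intros He [Ht [Hv Hw]].
  assert (HH : u ^ 3 / u1 ^ 2 <> 0).
  { intros E; rewrite E in Hw. replace (0 - / 4) with (- / 4) in Hw by ring.
    rewrite Cmod_opp, <- RtoC_inv, Cmod_R, Rabs_pos_eq in Hw by lra. lra. }
  split; [|split].
  - unfold tvw; split; auto; split; auto. rewrite Cmod_opp; auto.
  - intros ->; apply HH. unfold Cdiv; simpl; ring.
  - intros ->; apply HH. unfold Cdiv.
    replace (0 ^ 2) with (RtoC 0) by (simpl; ring).
    assert (/ RtoC 0 = 0) as ->; [|ring].
    apply injective_projections; simpl; unfold Rdiv; ring.
Qed.

Lemma m0_square (w : C) : (norm3 (RtoC 0, RtoC 0, kap w) < dl)%R -> w <> 0 ->
  4 * m0 w ^ 2 * w = 1.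
Proof.
  intros H Hw. unfold m0; rewrite mu_square by auto. unfold kap. field; auto.
Qed.

Lemma q_square_u (t u u1 : C) :
  u <> 0 -> u1 <> 0 -> (norm3 (RtoC 0, RtoC 0, kap (u ^ 3 / u1 ^ 2)) < dl)%R ->
  let z := tvw (t, u, u1) in
  qf z ^ 2 * u = 1 /\ u1 = - (2 * m0 (snd z) * qf z) * u ^ 2.
Proof.
  intros Hu Hu1 Hk; unfold tvw, qf, snd; cbv zeta iota beta.
  set (w := u ^ 3 / u1 ^ 2) in *.
  assert (Hw : w <> 0).
  { unfold w; intros E. apply (Cmult_neq_0 _ _ (Cmult_neq_0 _ _ Hu Hu) Hu).
    replace (u * u * u) with (u ^ 3 / u1 ^ 2 * (u1 * u1)) by (field; auto). rewrite E; ring. }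
  pose proof (m0_square w Hk Hw) as H.
  assert (Hm : m0 w <> 0).
  { intros E; rewrite E in H. apply C1_nz. rewrite <- H; ring. }
  assert (Hw' : w = u ^ 3 / u1 ^ 2) by reflexivity.
  clearbody w.
  split.
  - replace ((- (u1 / u ^ 2) / (2 * m0 w)) ^ 2 * u) with (u1 ^ 2 / u ^ 3 / (4 * m0 w ^ 2)) by (field; auto).
    replace (4 * m0 w ^ 2) with (/ w).
    2:{ apply (f_equal (fun x => x * / w)) in H. rewrite <- Cmult_assoc, Cinv_r in H by auto.
        rewrite Cmult_1_r in H. rewrite H; ring. }
    rewrite Hw'; field; auto.
  - field; auto.
Qed.

(** * Derivatives along a curve *)

Local Opaque mu lam om ell dl.

Definition near (t : C) (P : C -> Prop) : Prop :=
  exists del : R, (0 < del)%R /\ forall s, (dist1 t s < del)%R -> P s.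

Lemma near_and (t : C) (P Q : C -> Prop) : near t P -> near t Q -> near t (fun s => P s /\ Q s).
Proof.
  intros [d1 [H1 HP]] [d2 [H2 HQ]]; exists (Rmin d1 d2); split; [now apply Rmin_pos|].
  intros s Hs; split; [apply HP|apply HQ]; eapply Rlt_le_trans; eauto using Rmin_l, Rmin_r.
Qed.

Lemma near_imp (t : C) (P Q : C -> Prop) : (forall s, P s -> Q s) -> near t P -> near t Q.
Proof. intros H [d [Hd HP]]; exists d; split; auto. Qed.

Lemma near_self (t : C) (P : C -> Prop) : near t P -> P t.
Proof.
  intros [d [Hd HP]]; apply HP; unfold dist1; replace (t - t) with (RtoC 0) by ring.
  now rewrite Cmod_0.
Qed.

Lemma D1_near (f : C -> C) (t a : C) (eps : R) :
  (0 < eps)%R -> D1 f t a -> near t (fun s => Cmod (f s - f t) < eps)%R.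
Proof. intros He H; exact (approx_continuous _ (dist1_pos t) _ _ _ H eps He). Qed.

Lemma D1_near_neq_0 (f : C -> C) (t a : C) : D1 f t a -> f t <> 0 -> near t (fun s => f s <> 0).
Proof.
  intros H Hn; apply Cmod_gt_0 in Hn.
  eapply near_imp; [|apply (D1_near f t a (Cmod (f t))); auto].
  intros s Hs E; simpl in Hs; rewrite E in Hs.
  replace (0 - f t) with (- f t) in Hs by ring; rewrite Cmod_opp in Hs; lra.
Qed.

Lemma D1_near_norm3 (f g h : C -> C) (t a b c : C) (r : R) :
  D1 f t a -> D1 g t b -> D1 h t c -> (norm3 (f t, g t, h t) < r)%R ->
  near t (fun s => norm3 (f s, g s, h s) < r)%R.
Proof.
  intros Hf Hg Hh Hr; set (e := ((r - norm3 (f t, g t, h t)) / 3)%R).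
  assert (He : (0 < e)%R) by (unfold e; lra).
  eapply near_imp; [|exact (near_and _ _ _ (near_and _ _ _ (D1_near _ _ _ _ He Hf) (D1_near _ _ _ _ He Hg))
    (D1_near _ _ _ _ He Hh))].
  intros s [[H1 H2] H3]; simpl in *.
  pose proof (Cmod_triangle_inv (f s) (f t)); pose proof (Cmod_triangle_inv (g s) (g t));
  pose proof (Cmod_triangle_inv (h s) (h t)).
  unfold e in *. lra.
Qed.

Lemma D1_eq (f : C -> C) (t a b : C) : a = b -> D1 f t a -> D1 f t b.
Proof. now intros ->. Qed.

Lemma D1_ext_near (f g : C -> C) (t a : C) :
  near t (fun s => f s = g s) -> D1 f t a -> D1 g t a.
Proof. intros H; apply approx_ext_loc; auto. now apply near_self in H. Qed.

Lemma D1_const (c t : C) : D1 (fun _ => c) t 0.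
Proof. eapply approx_eq_lin; [|apply approx_const, dist1_pos]; intros; simpl; ring. Qed.

Lemma D1_plus (f g : C -> C) (t a b : C) : D1 f t a -> D1 g t b -> D1 (fun s => f s + g s) t (a + b).
Proof. intros H H'; eapply approx_eq_lin; [|apply (approx_plus _ _ _ _ _ _ H H')]; intros; simpl; ring. Qed.

Lemma D1_minus (f g : C -> C) (t a b : C) : D1 f t a -> D1 g t b -> D1 (fun s => f s - g s) t (a - b).
Proof.
  intros H H'; eapply approx_eq_lin; [|apply (approx_minus _ (dist1_pos t) _ _ _ _ _ H H')]; intros; simpl; ring.
Qed.

Lemma D1_opp (f : C -> C) (t a : C) : D1 f t a -> D1 (fun s => - f s) t (- a).
Proof.
  intros H; eapply approx_eq_lin; [|apply (approx_opp _ (dist1_pos t) _ _ _ H)]; intros; simpl; ring.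
Qed.

Lemma D1_mult (f g : C -> C) (t a b : C) :
  D1 f t a -> D1 g t b -> D1 (fun s => f s * g s) t (f t * b + g t * a).
Proof.
  intros H H'; eapply approx_eq_lin; [|apply (approx_mult _ (dist1_pos t) _ _ _ _ _ H H')]; intros; simpl; ring.
Qed.

Lemma D1_pow (n : nat) (f : C -> C) (t a : C) :
  D1 f t a -> D1 (fun s => f s ^ n) t (RtoC (INR n) * f t ^ (n - 1) * a).
Proof.
  intros H; eapply approx_eq_lin; [|apply (approx_pow _ (dist1_pos t) _ n _ _ H)]; intros; simpl; ring.
Qed.

Lemma D1_div (f g : C -> C) (t a b : C) :
  g t <> 0 -> D1 f t a -> D1 g t b ->
  D1 (fun s => f s / g s) t ((a * g t - f t * b) / (g t * g t)).
Proof.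
  intros Hn H H'; eapply approx_eq_lin; [|apply (approx_div _ (dist1_pos t) _ _ _ _ _ Hn H H')];
  intros; simpl; field; auto.
Qed.

Lemma D1_comp3 (F : C3 -> C) (f g h : C -> C) (t a b c x y w : C) :
  D3 F (f t, g t, h t) a b c -> D1 f t x -> D1 g t y -> D1 h t w ->
  D1 (fun s => F (f s, g s, h s)) t (a * x + b * y + c * w).
Proof.
  intros HF Hf Hg Hh; eapply approx_eq_lin; [|apply (approx_comp3 _ (dist1_pos t) _ _ _ _ _ _ _ _ _ _ _ HF Hf Hg Hh)].
  intros; simpl; ring.
Qed.

Lemma RtoC_neq_0 (x : R) : x <> 0%R -> RtoC x <> 0.
Proof. intros H E; apply H; now apply RtoC_inj. Qed.

Ltac cpow_neq := repeat first [apply Cpow_nz | apply Cmult_neq_0 | assumption].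

(* [p] and [h = kap / q^6] are constant on the solutions of either equation, so both
   systems are expressed through their derivatives [dp], [dh] along the curve. *)
Lemma curve_derivatives (t0 : C) (u u1 : C -> C) (du du1 : C) :
  let z := fun t => tvw (t, u t, u1 t) in
  let q := qf (z t0) in
  u t0 <> 0 -> u1 t0 <> 0 -> region (z t0) -> D1 u t0 du -> D1 u1 t0 du1 ->
  exists dx dy1 dp dh a c a' c' c0 : C,
    D1 (fun t => gamma (z t)) t0 dx /\
    D1 (fun t => - u t ^ 2 * eta (z t)) t0 dy1 /\
    dh = 2 * u1 t0 * du1 - 12 * u t0 ^ 2 * du /\
    dp = 1 - du / u1 t0 - q ^ 7 * c0 * dh /\
    dx = dp * (1 + q ^ 5 * a) + q ^ 7 * c * dh + - (q ^ 3 * du / 2) * / (1 + mu (zf (z t0))) /\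
    2 * (- u t0 ^ 2 * eta (z t0)) * dy1 =
      (12 * u t0 ^ 2 + 2 * gamma (z t0)) * du
      + dh * (1 + 2 * q ^ 5 * c') + 2 * dp * / q ^ 2 * (1 + q ^ 5 * a') /\
    (Cmod a <= 7200 /\ Cmod c <= 7200 /\ Cmod a' <= 7200 /\ Cmod c' <= 7200 /\ Cmod c0 <= 7200)%R.
Proof.
  intros z q Hu Hu1 Hreg HDu HDu1.
  set (v := fun t => - (u1 t / u t ^ 2)). set (w := fun t => u t ^ 3 / u1 t ^ 2).
  set (k := fun t => kap (w t)).
  assert (Hu2 : u t0 ^ 2 <> 0) by cpow_neq.
  assert (Hu3 : u t0 ^ 3 <> 0) by cpow_neq.
  assert (Hu12 : u1 t0 ^ 2 <> 0) by cpow_neq.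
  pose proof (D1_near_neq_0 u t0 du HDu Hu) as Nu.
  pose proof (D1_near_neq_0 u1 t0 du1 HDu1 Hu1) as Nu1.
  assert (HDv : exists dv, D1 v t0 dv).
  { eexists; apply D1_opp, D1_div; [auto|exact HDu1|apply (D1_pow 2); exact HDu]. }
  destruct HDv as [dv HDv].
  assert (Hk0 : k t0 = u1 t0 ^ 2 / u t0 ^ 3 - 4) by (unfold k, w, kap; field; auto).
  assert (HDk : D1 k t0 ((2 * u1 t0 * du1 - 12 * u t0 ^ 2 * du) / u t0 ^ 3 - 3 * k t0 * du / u t0)).
  { apply D1_ext_near with (fun t => u1 t ^ 2 / u t ^ 3 - 4).
    { eapply near_imp; [|apply (near_and _ _ _ Nu Nu1)]; intros s [H1 H2].
      unfold k, w, kap; field; auto. }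
    eapply D1_eq; [|apply D1_minus; [apply D1_div; [exact Hu3|apply (D1_pow 2); exact HDu1|apply (D1_pow 3); exact HDu]|apply D1_const]].
    rewrite Hk0; simpl INR; simpl Nat.sub.
    replace (1 + 1)%R with 2%R by ring; replace (2 + 1)%R with 3%R by ring. field; auto. }
  set (dk := (2 * u1 t0 * du1 - 12 * u t0 ^ 2 * du) / u t0 ^ 3 - 3 * k t0 * du / u t0) in *.
  pose proof (rg_k _ Hreg) as Hk. change (snd (z t0)) with (w t0) in Hk.
  change (kap (w t0)) with (k t0) in Hk.
  pose proof (D1_near_norm3 _ _ _ _ _ _ _ dl (D1_const 0 t0) (D1_const 0 t0) HDk Hk) as Nk.
  set (M0 := fun t => m0 (w t)).
  assert (HM0 : M0 t0 <> 0) by exact (rg_m0_neq (z t0) Hreg).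
  assert (HDM0 : exists dm0, D1 M0 t0 dm0).
  { destruct (mu_D3 _ Hk) as [a [b [c HD]]].
    eexists; apply D1_plus; [apply D1_const|].
    apply (D1_comp3 mu (fun _ => RtoC 0) (fun _ => RtoC 0) k t0 a b c); [exact HD|apply D1_const|apply D1_const|exact HDk]. }
  destruct HDM0 as [dm0 HDM0].
  set (Q := fun t => qf (z t)).
  assert (HQu : near t0 (fun t => Q t ^ 2 * u t = 1)).
  { eapply near_imp; [|apply (near_and _ _ _ (near_and _ _ _ Nu Nu1) Nk)].
    intros s [[H1 H2] H3]. now apply q_square_u. }
  pose proof (near_self _ _ HQu) as HQu0; cbv beta in HQu0.
  assert (HQ0 : Q t0 <> 0).
  { intros E; rewrite E in HQu0. apply C1_nz. rewrite <- HQu0; ring. }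
  assert (Eu : u t0 = / Q t0 ^ 2).
  { replace (u t0) with (Q t0 ^ 2 * u t0 * / Q t0 ^ 2) by (field; auto). rewrite HQu0; ring. }
  destruct (q_square_u t0 (u t0) (u1 t0) Hu Hu1 Hk) as [_ Eu1].
  change (snd (tvw (t0, u t0, u1 t0))) with (w t0) in Eu1. change (m0 (w t0)) with (M0 t0) in Eu1.
  change (qf (tvw (t0, u t0, u1 t0))) with (Q t0) in Eu1.
  (* Differentiability comes from the quotient that defines [q]; the value of the derivative from
     differentiating [q^2 u = 1]. This avoids the derivative of [m0]. *)
  assert (HDQ : D1 Q t0 (- (Q t0 ^ 3 * du / 2))).
  { assert (HDQ : exists dq, D1 Q t0 dq).
    { eexists; apply (D1_div v (fun t => 2 * M0 t)); [apply Cmult_neq_0; [apply RtoC_neq_0; lra|exact HM0]|exact HDv|].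
      apply D1_mult; [apply D1_const|exact HDM0]. }
    destruct HDQ as [dq HDQ].
    assert (E : 2 * Q t0 ^ 1 * dq * u t0 + Q t0 ^ 2 * du = 0).
    { apply (D1_unique (fun t => Q t ^ 2 * u t) t0).
      - eapply D1_eq; [|apply D1_mult; [apply (D1_pow 2); exact HDQ|exact HDu]].
        simpl INR; simpl Nat.sub; replace (1 + 1)%R with 2%R by ring; ring.
      - apply D1_ext_near with (fun _ => RtoC 1); [|apply D1_const].
        eapply near_imp; [|exact HQu]; intros s Hs; symmetry; exact Hs. }
    eapply D1_eq; [|exact HDQ].
    rewrite Eu in E.
    assert (E' : dq = - (Q t0 ^ 3 * du / 2) + Q t0 / 2 * (2 * Q t0 ^ 1 * dq * / Q t0 ^ 2 + Q t0 ^ 2 * du))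
      by (field; auto).
    rewrite E', E; ring. }
  set (dq := - (Q t0 ^ 3 * du / 2)) in *.
  set (dh := 2 * u1 t0 * du1 - 12 * u t0 ^ 2 * du).
  assert (Edu : du = - (2 * dq / Q t0 ^ 3)) by (unfold dq; field; auto).
  assert (Edk : dk = dh * Q t0 ^ 6 + 6 * k t0 * dq / Q t0).
  { unfold dk; fold dh; rewrite Eu; unfold dq; field; auto. }
  destruct (lam_D3 _ Hk) as [a0 [b0 [c0 [HD0 [HE0 [_ [_ Bc0]]]]]]].
  set (l0 := lam (RtoC 0, RtoC 0, k t0)) in *.
  assert (HDP : D1 (fun t => pf (z t)) t0
    (1 - dq * (1 + ell (RtoC 0, RtoC 0, k t0)) - Q t0 ^ 7 * c0 * dh)).
  { eapply D1_eq; [|apply (D1_minus (fun t => t) (fun t => Q t * (1 + lam (RtoC 0, RtoC 0, k t))));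
      [apply D1_id|apply D1_mult; [exact HDQ|apply D1_plus; [apply D1_const|]]]].
    2:{ apply (D1_comp3 lam (fun _ => RtoC 0) (fun _ => RtoC 0) k t0 a0 b0 c0);
        [exact HD0|apply D1_const|apply D1_const|exact HDk]. }
    cbv beta; fold l0. rewrite Edk.
    replace (ell (RtoC 0, RtoC 0, k t0)) with (euler3 (RtoC 0, RtoC 0, k t0) a0 b0 c0 + l0) by (rewrite HE0; ring).
    unfold euler3; field; auto. }
  set (dp := 1 - dq * (1 + ell (RtoC 0, RtoC 0, k t0)) - Q t0 ^ 7 * c0 * dh) in *.
  assert (Edp : dp = 1 - du / u1 t0 - Q t0 ^ 7 * c0 * dh).
  { assert (E : dq * (1 + ell (RtoC 0, RtoC 0, k t0)) = du / u1 t0); [|unfold dp; rewrite E; reflexivity].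
    pose proof (mu_ell _ Hk) as Hme. change (1 + mu (RtoC 0, RtoC 0, k t0)) with (M0 t0) in Hme.
    replace (1 + ell (RtoC 0, RtoC 0, k t0)) with (/ M0 t0).
    2:{ replace (1 + ell (RtoC 0, RtoC 0, k t0)) with (M0 t0 * (1 + ell (RtoC 0, RtoC 0, k t0)) * / M0 t0) by (field; auto).
        rewrite Hme; ring. }
    rewrite Eu1, Eu, Edu; field; auto. }
  (* Since the three arguments are [p q^4], [q^5] and [h q^6], the [dq] part of their differentials
     is [dq/q] times the weighted Euler field. The Euler identities for [lam] and [om] evaluate it,
     so that only [dp] and [dh] keep unknown partial derivatives as coefficients. *)
  set (A := fun t => pf (z t) * Q t ^ 4). set (B := fun t => Q t ^ 5).
  set (p := pf (z t0)) in *.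
  assert (HDA : D1 A t0 (dp * Q t0 ^ 4 + 4 * A t0 * dq / Q t0)).
  { eapply D1_eq; [|apply D1_mult; [exact HDP|apply (D1_pow 4); exact HDQ]].
    unfold A; fold p; simpl INR; simpl Nat.sub.
    replace (1 + 1 + 1 + 1)%R with 4%R by ring; field; auto. }
  assert (HDB : D1 B t0 (5 * B t0 * dq / Q t0)).
  { eapply D1_eq; [|apply (D1_pow 5); exact HDQ].
    unfold B; simpl INR; simpl Nat.sub.
    replace (1 + 1 + 1 + 1 + 1)%R with 5%R by ring; field; auto. }
  pose proof (rg_z _ Hreg) as Hz. change (zf (z t0)) with ((A t0, B t0, k t0) : C3) in Hz.
  pose proof (D1_near_norm3 _ _ _ _ _ _ _ dl HDA HDB HDk Hz) as Nz.
  destruct (lam_D3 _ Hz) as [a [b [c [HD [HE [Ba [_ Bc]]]]]]].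
  destruct (om_D3 _ Hz) as [a' [b' [c' [HD' [HE' [Ba' [_ Bc']]]]]]].
  destruct (mu_D3 _ Hz) as [a2 [b2 [c2 HD2]]].
  set (Z := (A t0, B t0, k t0) : C3) in *.
  change (zf (z t0)) with Z.
  assert (HDx : D1 (fun t => gamma (z t)) t0
    (dp * (1 + Q t0 ^ 5 * a) + Q t0 ^ 7 * c * dh + dq * (1 + ell Z))).
  { eapply D1_eq; [|apply (D1_plus (fun t => pf (z t)) (fun t => Q t * (1 + lam (A t, B t, k t))));
      [exact HDP|apply D1_mult; [exact HDQ|apply D1_plus; [apply D1_const|]]]].
    2:{ apply (D1_comp3 lam A B k t0 a b c); [exact HD|exact HDA|exact HDB|exact HDk]. }
    cbv beta; change (lam (A t0, B t0, k t0)) with (lam Z). rewrite Edk.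
    replace (ell Z) with (euler3 Z a b c + lam Z) by (rewrite HE; ring).
    unfold euler3, Z at 2; field; auto. }
  assert (Hm1 : 1 + mu Z <> 0) by (apply near_one_neq_0 with (3 * / 100)%R; [lra|now apply mu_bound]).
  assert (Eell : 1 + ell Z = / (1 + mu Z)).
  { pose proof (mu_ell _ Hz) as Hme.
    replace (1 + ell Z) with ((1 + mu Z) * (1 + ell Z) * / (1 + mu Z)) by (field; auto).
    rewrite Hme; ring. }
  assert (HDy : exists dy1, D1 (fun t => - u t ^ 2 * eta (z t)) t0 dy1).
  { eexists; apply D1_mult; [apply D1_opp, (D1_pow 2); exact HDu|].
    apply (D1_mult (fun t => 2 * Q t) (fun t => 1 + mu (A t, B t, k t)));
      [apply D1_mult; [apply D1_const|exact HDQ]|apply D1_plus; [apply D1_const|]].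
    apply (D1_comp3 mu A B k t0 a2 b2 c2); [exact HD2|exact HDA|exact HDB|exact HDk]. }
  destruct HDy as [dy1 HDy].
  exists (dp * (1 + Q t0 ^ 5 * a) + Q t0 ^ 7 * c * dh + dq * (1 + ell Z)), dy1, dp, dh, a, c, a', c', c0.
  split; [exact HDx|]. split; [exact HDy|]. split; [reflexivity|]. split; [exact Edp|].
  split; [rewrite Eell; reflexivity|]. split; [|auto].
  (* [Y] is [y'^2 = 4 u^3 + h + 2 z]. Differentiating the square in two ways yields [2 y' dy']
     without the partial derivatives of [mu]. *)
  set (Y := fun t => u t ^ 3 * (4 + k t + 2 * (A t + B t * (2 + om (A t, B t, k t))))).
  assert (HDom : D1 (fun t => om (A t, B t, k t)) t0
     (a' * (dp * Q t0 ^ 4 + 4 * A t0 * dq / Q t0) + b' * (5 * B t0 * dq / Q t0) + c' * dk))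
    by (apply (D1_comp3 om A B k t0 a' b' c'); [exact HD'|exact HDA|exact HDB|exact HDk]).
  apply (D1_unique (fun t => (- u t ^ 2 * eta (z t)) * (- u t ^ 2 * eta (z t))) t0).
  { eapply D1_eq; [|apply D1_mult; exact HDy]. cbv beta; ring. }
  apply D1_ext_near with Y.
  { eapply near_imp; [|apply (near_and _ _ _ HQu Nz)]; intros s [H1 H2]; cbv beta in H1, H2.
    unfold Y. rewrite <- mu_square by exact H2.
    unfold eta. change (qf (z s)) with (Q s). change (zf (z s)) with ((A s, B s, k s) : C3).
    set (M := 1 + mu (A s, B s, k s)).
    replace (- u s ^ 2 * (2 * Q s * M) * (- u s ^ 2 * (2 * Q s * M)))
      with (u s ^ 3 * (Q s ^ 2 * u s) * (4 * M ^ 2)) by ring. rewrite H1; ring. }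
  eapply D1_eq; [|apply D1_mult; [apply (D1_pow 3); exact HDu|apply D1_plus; [apply D1_plus; [apply D1_const|exact HDk]|
     apply D1_mult; [apply D1_const|apply D1_plus; [exact HDA|apply D1_mult; [exact HDB|apply D1_plus; [apply D1_const|exact HDom]]]]]]].
  cbv beta. change (om (A t0, B t0, k t0)) with (om Z).
  unfold gamma. change (zf (z t0)) with Z. change (qf (z t0)) with (Q t0). fold p.
  replace (om Z) with (euler3 Z a' b' c' + 2 * lam Z) by (rewrite HE'; ring).
  change q with (Q t0).
  simpl INR; simpl Nat.sub; replace (1 + 1 + 1)%R with 3%R by ring.
  rewrite Edk, Eu, Edu. unfold euler3, Z.
  set (L := lam (A t0, B t0, k t0)). clearbody L.
  unfold A, B; fold p. clearbody dq dh dp p.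
  set (x := Q t0) in *. set (kk := k t0) in *. clearbody x kk. field; auto.
Qed.

Lemma Cmod_zero_intro (a : C) : (Cmod a <= 0)%R -> a = 0.
Proof. intros H; apply Cmod_eq_0, Rle_antisym; [auto|apply Cmod_ge_0]. Qed.

(* [dp] and [dh] solve a homogeneous linear system whose determinant is close to [1]. *)
Lemma small_system (P h al be ga de : C) :
  (Cmod al <= / 100)%R -> (Cmod be <= / 100)%R -> (Cmod ga <= / 100)%R -> (Cmod de <= / 100)%R ->
  P * (1 + al) + be * h = 0 -> h * (1 + 2 * ga) + 2 * P * (1 + de) = 0 -> P = 0 /\ h = 0.
Proof.
  intros Hal Hbe Hga Hde E1 E2.
  assert (F1 : (Cmod P <= / 100 * Cmod P + / 100 * Cmod h)%R).
  { replace P with (- (al * P) - be * h) at 1.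
    2:{ replace (be * h) with (P * (1 + al) + be * h - P * (1 + al)) by ring. rewrite E1; ring. }
    eapply Rle_trans; [apply Cmod_minus_le|]. rewrite Cmod_opp, !Cmod_mult.
    pose proof (Cmod_ge_0 P); pose proof (Cmod_ge_0 h); nra. }
  assert (F2 : (Cmod h <= / 50 * Cmod h + 3 * Cmod P)%R).
  { replace h with (- (2 * ga * h) - 2 * P * (1 + de)) at 1.
    2:{ replace (2 * P * (1 + de)) with (h * (1 + 2 * ga) + 2 * P * (1 + de) - h * (1 + 2 * ga)) by ring.
        rewrite E2; ring. }
    eapply Rle_trans; [apply Cmod_minus_le|]. rewrite Cmod_opp, !Cmod_mult, !Cmod_R, !Rabs_pos_eq by lra.
    pose proof (Cmod_triangle 1 de) as H; rewrite Cmod_1 in H.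
    pose proof (Cmod_ge_0 P); pose proof (Cmod_ge_0 h); pose proof (Cmod_ge_0 (1 + de)); nra. }
  split; apply Cmod_zero_intro; lra.
Qed.

Lemma q5_small (q a : C) : (Cmod q <= / 1000000000)%R -> (Cmod a <= 7200)%R -> (Cmod (q ^ 5 * a) <= / 100)%R.
Proof.
  intros Hq Ha; rewrite Cmod_mult. pose proof (Cmod_pow_le q 4 ltac:(lra)).
  pose proof (Cmod_ge_0 (q ^ 5)); pose proof (Cmod_ge_0 a). nra.
Qed.

Lemma eq_div_iff (a b c : C) : c <> 0 -> (a / c = b <-> a = b * c).
Proof.
  intros Hc; split; intros H.
  - rewrite <- H; field; auto.
  - rewrite H; field; auto.
Qed.

Lemma m_neq_0 (z : C3) : (norm3 z < dl)%R -> 1 + mu z <> 0.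
Proof. intros H; apply near_one_neq_0 with (3 * / 100)%R; [lra|now apply mu_bound]. Qed.

(** Either system is equivalent to [dp = dh = 0]. For the elliptic one this is read off the formulas
    for [dp] and [dh]; for the Painleve one the two equations are a linear system in [dp] and
    [dh]. *)
Lemma takes_into_Gam (D : C3 -> Prop) :
  (forall t u u1, D (t, u, u1) -> region (tvw (t, u, u1)) /\ u <> 0 /\ u1 <> 0) ->
  takes_into Gam D F_painleve F_elliptic.
Proof.
  intros HDom t0 u u1 du du1 HD Hdu Hdu1 x y y1.
  apply is_derive_D1 in Hdu, Hdu1.
  destruct (HDom _ _ _ HD) as [Hreg [Hu Hu1]].
  destruct (curve_derivatives t0 u u1 du du1 Hu Hu1 Hreg Hdu Hdu1)
    as [dx [dy1 [dp [dh [a [c [a' [c' [c0 [HDx [HDy1 [Edh [Edp [Edx [Edy1 [Ba [Bc [Ba' [Bc' Bc0]]]]]]]]]]]]]]]]]]].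
  change (D1 x t0 dx) in HDx. change (D1 y1 t0 dy1) in HDy1.
  assert (HDy : D1 y t0 du) by exact Hdu.
  change (gamma (tvw (t0, u t0, u1 t0))) with (x t0) in Edy1.
  change (- u t0 ^ 2 * eta (tvw (t0, u t0, u1 t0))) with (y1 t0) in Edy1.
  assert (Ey1 : y1 t0 = - (2 * u t0 ^ 2 * qf (tvw (t0, u t0, u1 t0)) * (1 + mu (zf (tvw (t0, u t0, u1 t0)))))).
  { change (y1 t0) with (- u t0 ^ 2 * eta (tvw (t0, u t0, u1 t0))). unfold eta; ring. }
  pose proof (rg_q _ Hreg) as Hq.
  destruct (q_square_u t0 (u t0) (u1 t0) Hu Hu1 (rg_k _ Hreg)) as [Hqu Eu1].
  pose proof (rg_m0_neq _ Hreg) as Hm0. pose proof (m_neq_0 _ (rg_z _ Hreg)) as Hm.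
  set (q := qf (tvw (t0, u t0, u1 t0))) in *.
  set (m := 1 + mu (zf (tvw (t0, u t0, u1 t0)))) in *.
  set (M0 := m0 (snd (tvw (t0, u t0, u1 t0)))) in *.
  assert (Hq0 : q <> 0) by (intros E; rewrite E in Hqu; apply C1_nz; rewrite <- Hqu; ring).
  assert (Eu : u t0 = / q ^ 2).
  { replace (u t0) with (q ^ 2 * u t0 * / q ^ 2) by (field; auto). rewrite Hqu; ring. }
  assert (Hy10 : y1 t0 <> 0).
  { rewrite Ey1; intros E. apply (Cmult_neq_0 (2 * u t0 ^ 2 * q) m).
    - apply Cmult_neq_0; [apply Cmult_neq_0; [apply RtoC_neq_0; lra|now apply Cpow_nz]|exact Hq0].
    - exact Hm.
    - transitivity (- - (2 * u t0 ^ 2 * q * m)); [ring|]. etransitivity; [exact (f_equal Copp E)|ring]. }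
  assert (Hdx : y1 t0 * dx = du - 2 / q ^ 3 * m * (dp * (1 + q ^ 5 * a) + q ^ 7 * c * dh)).
  { rewrite Edx, Ey1, Eu; field; auto. }
  split.
  - intros [dx' [dy' [dy1' [Hx [Hy [Hy1 [Hdx0 [E1 E2]]]]]]]].
    apply is_derive_D1 in Hx, Hy, Hy1.
    rewrite (D1_unique _ _ _ _ Hx HDx) in *. rewrite (D1_unique _ _ _ _ Hy HDy) in *.
    rewrite (D1_unique _ _ _ _ Hy1 HDy1) in *.
    assert (F1 : du = y1 t0 * dx) by now apply eq_div_iff.
    assert (F2 : dy1 = (6 * u t0 ^ 2 + x t0) * dx) by now apply eq_div_iff.
    clear E1 E2; rename F1 into E1, F2 into E2.
    assert (S1 : dp * (1 + q ^ 5 * a) + q ^ 7 * c * dh = 0).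
    { rewrite <- E1 in Hdx.
      replace (dp * (1 + q ^ 5 * a) + q ^ 7 * c * dh) with
        (- (q ^ 3 / (2 * m)) * (du - 2 / q ^ 3 * m * (dp * (1 + q ^ 5 * a) + q ^ 7 * c * dh) - du)) by (field; auto).
      rewrite <- Hdx; ring. }
    assert (S2 : dh * (1 + 2 * (q ^ 5 * c')) + 2 * (dp / q ^ 2) * (1 + q ^ 5 * a') = 0).
    { replace (dh * (1 + 2 * (q ^ 5 * c')) + 2 * (dp / q ^ 2) * (1 + q ^ 5 * a')) with
        ((12 * u t0 ^ 2 + 2 * x t0) * du + dh * (1 + 2 * q ^ 5 * c') + 2 * dp * / q ^ 2 * (1 + q ^ 5 * a')
          - (12 * u t0 ^ 2 + 2 * x t0) * du) by (field; auto).
      rewrite <- Edy1, E2, E1; ring. }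
    (* The unknown is [dp / q^2]: after this scaling every perturbing coefficient is [q^5] times a
       bounded partial derivative, hence small. *)
    destruct (small_system (dp / q ^ 2) dh (q ^ 5 * a) (q ^ 5 * c) (q ^ 5 * c') (q ^ 5 * a')) as [P0 H0];
      auto using q5_small.
    { replace (dp / q ^ 2 * (1 + q ^ 5 * a) + q ^ 5 * c * dh) with
        ((dp * (1 + q ^ 5 * a) + q ^ 7 * c * dh) / q ^ 2) by (field; auto).
      rewrite S1; field; auto. }
    assert (P1 : dp = 0) by (replace dp with (dp / q ^ 2 * q ^ 2) by (field; auto); rewrite P0; ring).
    assert (G1 : du = u1 t0).
    { rewrite H0, P1 in Edp. replace du with (u1 t0 - u1 t0 * (1 - du / u1 t0 - q ^ 7 * c0 * 0)) by (field; auto).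
      rewrite <- Edp; ring. }
    split; auto. unfold F_elliptic. rewrite H0, G1 in Edh.
    replace du1 with ((2 * u1 t0 * du1 - 12 * u t0 ^ 2 * u1 t0) / (2 * u1 t0) + 6 * u t0 ^ 2) by (field; auto).
    rewrite <- Edh; field; auto.
  - intros [G1 G2]; unfold F_elliptic in G2.
    assert (H0 : dh = 0) by (rewrite Edh, G1, G2; ring).
    assert (P0 : dp = 0) by (rewrite Edp, H0, G1; field; auto).
    rewrite H0, P0 in Hdx, Edy1.
    replace (du - 2 / q ^ 3 * m * (0 * (1 + q ^ 5 * a) + q ^ 7 * c * 0)) with du in Hdx by (field; auto).
    assert (Hdx0 : dx <> 0).
    { intros E; rewrite E in Hdx. apply Hu1. rewrite <- G1, <- Hdx; ring. }
    exists dx, du, dy1; split; [now apply is_derive_D1|]. split; [now apply is_derive_D1|].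
    split; [now apply is_derive_D1|]. split; auto.
    split; apply eq_div_iff; auto.
    unfold F_painleve. change (y t0) with (u t0).
    replace dy1 with (2 * y1 t0 * dy1 / (2 * y1 t0)) by (field; auto).
    rewrite Edy1, <- Hdx; field; auto.
Qed.

(** * Holomorphy and injectivity of the map *)

Lemma m_plus_m0_neq_0 (z : C3) : region z -> 1 + mu (zf z) + m0 (snd z) <> 0.
Proof.
  intros H. pose proof (mu_bound _ (rg_z _ H)) as H1. pose proof (rg_m0 _ H) as H2.
  replace (1 + mu (zf z) + m0 (snd z)) with (1 + 1 + (mu (zf z) + (m0 (snd z) - 1))) by ring.
  pose proof (Cmod_triangle (mu (zf z)) (m0 (snd z) - 1)) as H3.
  set (e := mu (zf z) + (m0 (snd z) - 1)) in *. intros E.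
  assert (E' : e = RtoC (-2)) by (replace e with (1 + 1 + e - 2) by ring; rewrite E; ring).
  rewrite E', Cmod_R, Rabs_left in H3; lra.
Qed.

Lemma v_of_q (t v w : C) : m0 w <> 0 -> v = 2 * m0 w * qf (t, v, w).
Proof. intros H; unfold qf; field; auto. Qed.

(** Both energy relations have the same [kap], so their difference is
    [2 (m^2 - m0^2) = q^4 (p + q (2 + om))]. *)
Lemma eta1_ratio (t v w : C) :
  region (t, v, w) -> 1 + v ^ 4 * eta1 (t, v, w) = (1 + mu (zf (t, v, w))) / m0 w.
Proof.
  intros H. pose proof (rg_m0_neq _ H) as Hm0. pose proof (m_plus_m0_neq_0 _ H) as Hs.
  pose proof (mu_square _ _ _ (rg_z _ H)) as E1. pose proof (m0_square w (rg_k _ H) (rg_w _ H)) as E2.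
  pose proof (v_of_q t v w Hm0) as Ev.
  unfold eta1. simpl snd in *.
  change (pf (t, v, w) * qf (t, v, w) ^ 4, qf (t, v, w) ^ 5, kap w) with (zf (t, v, w)) in E1.
  unfold kap in E1. set (q := qf (t, v, w)) in *. set (p := pf (t, v, w)) in *.
  set (m := 1 + mu (zf (t, v, w))) in *. set (o := om (zf (t, v, w))) in *. set (n := m0 w) in *.
  assert (Hw : w <> 0) by exact (rg_w _ H).
  assert (Ew : / w = 4 * n ^ 2).
  { replace (4 * n ^ 2) with (4 * n ^ 2 * w * / w) by (field; auto). rewrite E2; ring. }
  rewrite Ew in E1.
  assert (E3 : q ^ 4 * (p + q * (2 + o)) = 2 * (m ^ 2 - n ^ 2)).
  { replace (q ^ 4 * (p + q * (2 + o))) with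
      ((4 + (4 * n ^ 2 - 4) + 2 * (p * q ^ 4 + q ^ 5 * (2 + o))) / 2 - 2 * n ^ 2) by field.
    rewrite <- E1; field. }
  clearbody q p m o n.
  rewrite Ev.
  replace (1 + (2 * n * q) ^ 4 * ((p + q * (2 + o)) / (32 * n ^ 5 * (m + n))))
    with (1 + q ^ 4 * (p + q * (2 + o)) / (2 * n * (m + n))) by (field; auto).
  rewrite E3; field; auto.
Qed.

Lemma eta_eta1 (t v w : C) : region (t, v, w) -> eta (t, v, w) = v * (1 + v ^ 4 * eta1 (t, v, w)).
Proof.
  intros H; rewrite eta1_ratio by auto. unfold eta.
  pose proof (rg_m0_neq _ H) as Hm0. simpl snd in Hm0.
  rewrite (v_of_q t v w Hm0) at 3. field; auto.
Qed.

Lemma m0_lower (z : C3) : region z -> (97 * / 100 <= Cmod (m0 (snd z)))%R.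
Proof.
  intros H; pose proof (rg_m0 _ H) as H1.
  pose proof (Cmod_triangle_inv 1 (1 - m0 (snd z))) as H2.
  replace (1 - (1 - m0 (snd z))) with (m0 (snd z)) in H2 by ring.
  rewrite (Cmod_minus_sym 1 (m0 (snd z))), Cmod_1 in H2. lra.
Qed.

Lemma eta1_small (t v w : C) : region (t, v, w) -> (Cmod (v ^ 4 * eta1 (t, v, w)) <= / 3)%R.
Proof.
  intros H. pose proof (eta1_ratio t v w H) as E. pose proof (rg_m0_neq _ H) as Hm0.
  pose proof (m0_lower _ H) as H1. pose proof (rg_m0 _ H) as H2. pose proof (mu_bound _ (rg_z _ H)) as H3.
  simpl snd in *.
  replace (v ^ 4 * eta1 (t, v, w)) with ((mu (zf (t, v, w)) - (m0 w - 1)) / m0 w).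
  2:{ replace (v ^ 4 * eta1 (t, v, w)) with (1 + v ^ 4 * eta1 (t, v, w) - 1) by ring. rewrite E; field; auto. }
  rewrite Cmod_div by auto.
  pose proof (Cmod_minus_le (mu (zf (t, v, w))) (m0 w - 1)).
  apply Rmult_le_reg_r with (Cmod (m0 w)); [lra|]. unfold Rdiv; rewrite Rmult_assoc, Rinv_l; lra.
Qed.

Lemma qf_le (t v w : C) : region (t, v, w) -> (Cmod (qf (t, v, w)) <= Cmod v)%R.
Proof.
  intros H. pose proof (rg_m0_neq _ H) as Hm0. pose proof (m0_lower _ H) as H1. simpl snd in *.
  rewrite (v_of_q t v w Hm0) at 2. rewrite !Cmod_mult, Cmod_R, Rabs_pos_eq by lra.
  pose proof (Cmod_ge_0 (qf (t, v, w))). nra.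
Qed.

(** [gamma - t] is [q] times the difference of [lam] at [(p q^4, q^5, kap)] and at [(0, 0, kap)].
    The Lipschitz bound gives [7200 (|p q| + |q|^2) |q|^4]. *)
Lemma gamma_close (t v w : C) : region (t, v, w) -> (Cmod (gamma (t, v, w) - t) <= Cmod v ^ 4)%R.
Proof.
  intros H. pose proof (qf_le t v w H) as Hqv. pose proof (rg_q _ H) as Hq. pose proof (rg_pq _ H) as Hpq.
  pose proof (lam_lipschitz _ _ (rg_k _ H) (rg_z _ H)) as HL. simpl snd in *.
  replace (gamma (t, v, w) - t) with
    (qf (t, v, w) * (lam (zf (t, v, w)) - lam (RtoC 0, RtoC 0, kap w))) by (unfold gamma, pf; ring).
  rewrite Cmod_mult. unfold dist3, zf in HL. unfold sub3, norm3 in HL.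
  change (lam (pf (t, v, w) * qf (t, v, w) ^ 4, qf (t, v, w) ^ 5, kap w)) with (lam (zf (t, v, w))) in HL.
  replace (kap w - kap w) with (RtoC 0) in HL by ring. rewrite Cmod_0 in HL.
  replace (pf (t, v, w) * qf (t, v, w) ^ 4 - 0) with (pf (t, v, w) * qf (t, v, w) ^ 4) in HL by ring.
  replace (qf (t, v, w) ^ 5 - 0) with (qf (t, v, w) ^ 5) in HL by ring.
  rewrite Cmod_mult, !Cmod_pow in HL.
  set (q := Cmod (qf (t, v, w))) in *. set (p := Cmod (pf (t, v, w))) in *.
  set (X := Cmod (lam (zf (t, v, w)) - lam (RtoC 0, RtoC 0, kap w))) in *.
  assert (Hq0 : (0 <= q)%R) by apply Cmod_ge_0. assert (HX : (0 <= X)%R) by apply Cmod_ge_0.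
  assert (Hp0 : (0 <= p)%R) by apply Cmod_ge_0.
  assert (Hq4 : (q ^ 4 <= Cmod v ^ 4)%R) by (apply pow_incr; lra).
  assert (H4 : (0 <= q ^ 4)%R) by now apply pow_le.
  assert (HX' : (q * X <= q * (7200 * (p * q ^ 4 + q ^ 5 + 0)))%R) by (apply Rmult_le_compat_l; auto).
  replace (q * (7200 * (p * q ^ 4 + q ^ 5 + 0)))%R with (7200 * (p * q + q * q) * q ^ 4)%R in HX' by ring.
  assert (H5 : (7200 * (p * q + q * q) <= 1)%R) by nra. nra.
Qed.

Lemma time_of_leaf (z : C3) :
  fst (fst z) = pf z + qf z * (1 + lam (RtoC 0, RtoC 0, kap (snd z))).
Proof. destruct z as [[t v] w]; unfold pf; simpl fst; simpl snd; ring. Qed.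

(** It suffices to recover [q], [p] and [kap], for these determine [t] and [u1]. The value of
    [y = u] gives [q] up to sign, [y'] gives the sign, and the equalities of [x] and of [y'] leave a
    contracting system for the differences of [p] and [kap]. *)
Lemma Gam_injective (t u u1 t' u' u1' : C) :
  u <> 0 -> u1 <> 0 -> u' <> 0 -> u1' <> 0 ->
  region (tvw (t, u, u1)) -> region (tvw (t', u', u1')) ->
  Gam (t, u, u1) = Gam (t', u', u1') -> (t, u, u1) = (t', u', u1').
Proof.
  intros Hu Hu1 Hu' Hu1' H H' E.
  assert (Ex : gamma (tvw (t, u, u1)) = gamma (tvw (t', u', u1')))
    by exact (f_equal (fun z : C3 => fst (fst z)) E).
  assert (Eu : u = u') by exact (f_equal (fun z : C3 => snd (fst z)) E).
  assert (Ey : - u ^ 2 * eta (tvw (t, u, u1)) = - u' ^ 2 * eta (tvw (t', u', u1')))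
    by exact (f_equal (fun z : C3 => snd z) E).
  subst u'.
  destruct (q_square_u t u u1 Hu Hu1 (rg_k _ H)) as [Q1 F1].
  destruct (q_square_u t' u u1' Hu Hu1' (rg_k _ H')) as [Q2 F2].
  assert (Et : t = pf (tvw (t, u, u1)) + qf (tvw (t, u, u1)) *
     (1 + lam (RtoC 0, RtoC 0, kap (snd (tvw (t, u, u1)))))) by exact (time_of_leaf (tvw (t, u, u1))).
  assert (Et' : t' = pf (tvw (t', u, u1')) + qf (tvw (t', u, u1')) *
     (1 + lam (RtoC 0, RtoC 0, kap (snd (tvw (t', u, u1')))))) by exact (time_of_leaf (tvw (t', u, u1'))).
  assert (Ez : zf (tvw (t, u, u1)) = (pf (tvw (t, u, u1)) * qf (tvw (t, u, u1)) ^ 4,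
     qf (tvw (t, u, u1)) ^ 5, kap (snd (tvw (t, u, u1))))) by reflexivity.
  assert (Ez' : zf (tvw (t', u, u1')) = (pf (tvw (t', u, u1')) * qf (tvw (t', u, u1')) ^ 4,
     qf (tvw (t', u, u1')) ^ 5, kap (snd (tvw (t', u, u1'))))) by reflexivity.
  unfold gamma, eta in Ex, Ey.
  destruct H as [Hw Hk Hm Hq Hpq Hz], H' as [Hw' Hk' Hm' Hq' Hpq' Hz'].
  pose proof (m0_square _ Hk Hw) as Em0. pose proof (m0_square _ Hk' Hw') as Em0'.
  assert (Em : m0 (snd (tvw (t, u, u1))) = 1 + mu (RtoC 0, RtoC 0, kap (snd (tvw (t, u, u1))))) by reflexivity.
  assert (Em' : m0 (snd (tvw (t', u, u1'))) = 1 + mu (RtoC 0, RtoC 0, kap (snd (tvw (t', u, u1'))))) by reflexivity.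
  rewrite Ez in *; rewrite Ez' in *; clear Ez Ez'.
  rewrite Em in F1. rewrite Em' in F2. clear Em Em' Em0 Em0' Hm Hm' Hw Hw' Hpq Hpq' E.
  set (q := qf (tvw (t, u, u1))) in *. set (p := pf (tvw (t, u, u1))) in *.
  set (k := kap (snd (tvw (t, u, u1)))) in *.
  set (q' := qf (tvw (t', u, u1'))) in *. set (p' := pf (tvw (t', u, u1'))) in *.
  set (k' := kap (snd (tvw (t', u, u1')))) in *.
  clearbody q p k q' p' k'.
  assert (Hq0 : q <> 0) by (intros E; rewrite E in Q1; apply C1_nz; rewrite <- Q1; ring).
  assert (Hmm : q * (1 + mu (p * q ^ 4, q ^ 5, k)) = q' * (1 + mu (p' * q' ^ 4, q' ^ 5, k'))).
  { replace (q * (1 + mu (p * q ^ 4, q ^ 5, k))) with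
      (- u ^ 2 * (2 * q * (1 + mu (p * q ^ 4, q ^ 5, k))) / (- u ^ 2 * 2)).
    2:{ field; repeat split; auto using Cpow_nz. }
    rewrite Ey. field; repeat split; auto using Cpow_nz. }
  (* If [q' = -q], the equality of [y'] would force the two values of [mu] to add up to -2, although
     both are at most 3/100 in modulus. *)
  assert (Eq : q' = q).
  { assert (Hqq : (q' - q) * (q' + q) = 0).
    { replace ((q' - q) * (q' + q)) with ((q' ^ 2 * u - q ^ 2 * u) / u) by (field; auto).
      rewrite Q1, Q2; field; auto. }
    destruct (Ceq_dec (q' - q) 0) as [E0|E0].
    { replace q' with (q' - q + q) by ring; rewrite E0; ring. }
    assert (E1 : q' + q = 0).
    { replace (q' + q) with ((q' - q) * (q' + q) / (q' - q)) by (field; auto). rewrite Hqq; field; auto. }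
    assert (E2 : q' = - q) by (replace q' with (q' + q - q) by ring; rewrite E1; ring).
    exfalso.
    pose proof (mu_bound _ Hz) as B1. pose proof (mu_bound _ Hz') as B2.
    set (a := mu (p * q ^ 4, q ^ 5, k)) in *. set (b := mu (p' * q' ^ 4, q' ^ 5, k')) in *.
    clearbody a b. rewrite E2 in Hmm.
    assert (E3 : a + b = RtoC (-2)).
    { replace (a + b) with ((q * (1 + a) - - q * (1 + b)) / q - 2) by (field; auto).
      rewrite Hmm; field; auto. }
    pose proof (Cmod_triangle a b) as B3. rewrite E3, Cmod_R, Rabs_left in B3; lra. }
  subst q'.
  assert (Hm : mu (p * q ^ 4, q ^ 5, k) = mu (p' * q ^ 4, q ^ 5, k')).
  { replace (mu (p * q ^ 4, q ^ 5, k)) with (q * (1 + mu (p * q ^ 4, q ^ 5, k)) / q - 1) by (field; auto).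
    rewrite Hmm; field; auto. }
  pose proof (mu_square _ _ _ Hz) as S1. pose proof (mu_square _ _ _ Hz') as S2.
  rewrite Hm, S2 in S1.
  pose proof (lam_lipschitz _ _ Hz Hz') as L1. pose proof (om_lipschitz _ _ Hz Hz') as L2.
  set (z := (p * q ^ 4, q ^ 5, k) : C3) in *. set (z' := (p' * q ^ 4, q ^ 5, k') : C3) in *.
  assert (Ed : dist3 z z' = (Cmod (p' - p) * Cmod (q ^ 4) + Cmod (k' - k))%R).
  { change (dist3 z z') with
      (Cmod (p' * q ^ 4 - p * q ^ 4)%C + Cmod (q ^ 5 - q ^ 5)%C + Cmod (k' - k)%C)%R.
    replace (p' * q ^ 4 - p * q ^ 4) with ((p' - p) * q ^ 4) by ring.
    replace (q ^ 5 - q ^ 5) with (RtoC 0) by ring. rewrite Cmod_0, Cmod_mult; ring. }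
  (* [X1] is the equality of [x], [X2] that of [y'^2]. With the Lipschitz bounds each difference is
     at most a small fraction of the sum of both, so both vanish. *)
  assert (X1 : p' - p = - (q * (lam z' - lam z))).
  { replace (p' - p) with (p' + q * (1 + lam z') - (p + q * (1 + lam z)) - q * (lam z' - lam z)) by ring.
    rewrite <- Ex; ring. }
  assert (X2 : k' - k = - (2 * (q ^ 4 * (p' - p)) + 2 * (q ^ 5 * (om z' - om z)))).
  { replace (k' - k) with (4 + k' + 2 * (p' * q ^ 4 + q ^ 5 * (2 + om z')) -
      (4 + k + 2 * (p * q ^ 4 + q ^ 5 * (2 + om z))) - (2 * (q ^ 4 * (p' - p)) + 2 * (q ^ 5 * (om z' - om z)))) by ring.
    rewrite S1; ring. }
  apply (f_equal Cmod) in X1, X2. rewrite Cmod_opp, Cmod_mult in X1. rewrite Cmod_opp in X2.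
  pose proof (Cmod_triangle (2 * (q ^ 4 * (p' - p))) (2 * (q ^ 5 * (om z' - om z)))) as X3.
  rewrite !Cmod_mult, !Cmod_R, !Rabs_pos_eq in X3 by lra.
  pose proof (Cmod_pow_le q 3 ltac:(lra)) as Q4. pose proof (Cmod_pow_le q 4 ltac:(lra)) as Q5.
  rewrite Ed in L1, L2.
  pose proof (Cmod_ge_0 q); pose proof (Cmod_ge_0 (q ^ 4)); pose proof (Cmod_ge_0 (q ^ 5)).
  pose proof (Cmod_ge_0 (p' - p)) as P0; pose proof (Cmod_ge_0 (k' - k)) as K0.
  pose proof (Cmod_ge_0 (lam z' - lam z)); pose proof (Cmod_ge_0 (om z' - om z)).
  assert (P1 : (Cmod (p' - p) <= / 1000 * (Cmod (p' - p) + Cmod (k' - k)))%R).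
  { rewrite X1 at 1. eapply Rle_trans; [apply Rmult_le_compat; [auto|auto|exact Hq|exact L1]|]. nra. }
  assert (K1 : (Cmod (k' - k) <= / 100 * (Cmod (p' - p) + Cmod (k' - k)))%R).
  { rewrite X2 at 1. eapply Rle_trans; [exact X3|].
    assert (Cmod (q ^ 5) * Cmod (om z' - om z) <= / 1000000000 * (7200 * (Cmod (p' - p) * Cmod (q ^ 4) + Cmod (k' - k))))%R
      by (apply Rmult_le_compat; auto; lra).
    nra. }
  assert (Ep : p' - p = 0) by (apply Cmod_zero_intro; lra).
  assert (Ek : k' - k = 0) by (apply Cmod_zero_intro; lra).
  assert (Ep' : p' = p) by (replace p' with (p' - p + p) by ring; rewrite Ep; ring).
  assert (Ek' : k' = k) by (replace k' with (k' - k + k) by ring; rewrite Ek; ring).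
  rewrite Ep', Ek' in Et'. rewrite Ek' in F2.
  rewrite Et, Et', F1, F2. reflexivity.
Qed.

(** * Holomorphy of the components *)

Definition diff3 (f : C3 -> C) (z : C3) : Prop := exists a b c, D3 f z a b c.

Lemma diff3_const (c : C) (z : C3) : diff3 (fun _ => c) z.
Proof.
  exists 0, 0, 0. eapply approx_eq_lin; [|apply approx_const, dist3_pos].
  intros [[? ?] ?]; destruct z as [[? ?] ?]; simpl; ring.
Qed.

Lemma diff3_coord1 (z : C3) : diff3 (fun z => fst (fst z)) z.
Proof.
  exists 1, 0, 0. apply D3_ext with (lin3 1 0 0); [intros [[? ?] ?]; simpl; ring|apply D3_lin].
Qed.

Lemma diff3_coord2 (z : C3) : diff3 (fun z => snd (fst z)) z.
Proof.
  exists 0, 1, 0. apply D3_ext with (lin3 0 1 0); [intros [[? ?] ?]; simpl; ring|apply D3_lin].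
Qed.

Lemma diff3_coord3 (z : C3) : diff3 (fun z => snd z) z.
Proof.
  exists 0, 0, 1. apply D3_ext with (lin3 0 0 1); [intros [[? ?] ?]; simpl; ring|apply D3_lin].
Qed.

Lemma diff3_plus (f g : C3 -> C) (z : C3) : diff3 f z -> diff3 g z -> diff3 (fun z => f z + g z) z.
Proof. intros [a [b [c H]]] [a' [b' [c' H']]]; do 3 eexists; exact (D3_plus _ _ _ _ _ _ _ _ _ H H'). Qed.

Lemma diff3_mult (f g : C3 -> C) (z : C3) : diff3 f z -> diff3 g z -> diff3 (fun z => f z * g z) z.
Proof.
  intros [a [b [c H]]] [a' [b' [c' H']]].
  exists (f z * a' + g z * a), (f z * b' + g z * b), (f z * c' + g z * c).
  eapply approx_eq_lin; [|apply (approx_mult _ (dist3_pos z) _ _ _ _ _ H H')].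
  intros [[? ?] ?]; destruct z as [[? ?] ?]; simpl; ring.
Qed.

Lemma diff3_minus (f g : C3 -> C) (z : C3) : diff3 f z -> diff3 g z -> diff3 (fun z => f z - g z) z.
Proof.
  intros H H'. destruct (diff3_plus f (fun z => RtoC (-1) * g z) z H
    (diff3_mult _ _ _ (diff3_const (RtoC (-1)) z) H')) as [a [b [c HH]]].
  exists a, b, c; revert HH; apply D3_ext; intros; ring.
Qed.

Lemma diff3_inv (f : C3 -> C) (z : C3) : f z <> 0 -> diff3 f z -> diff3 (fun z => / f z) z.
Proof.
  intros Hn [a [b [c H]]]. exists (- (a / (f z * f z))), (- (b / (f z * f z))), (- (c / (f z * f z))).
  eapply approx_eq_lin; [|apply (approx_inv _ (dist3_pos z) _ _ _ Hn H)].
  intros [[? ?] ?]; destruct z as [[? ?] ?]; simpl; field; auto.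
Qed.

Lemma diff3_pow (n : nat) (f : C3 -> C) (z : C3) : diff3 f z -> diff3 (fun z => f z ^ n) z.
Proof.
  intros H; induction n as [|n IH]; [exact (diff3_const 1 z)|exact (diff3_mult _ _ _ H IH)].
Qed.

Lemma diff3_comp (F f g h : C3 -> C) (z : C3) :
  diff3 F (f z, g z, h z) -> diff3 f z -> diff3 g z -> diff3 h z ->
  diff3 (fun z => F (f z, g z, h z)) z.
Proof.
  intros [a [b [c HF]]] [a1 [b1 [c1 Hf]]] [a2 [b2 [c2 Hg]]] [a3 [b3 [c3 Hh]]].
  exists (a * a1 + b * a2 + c * a3), (a * b1 + b * b2 + c * b3), (a * c1 + b * c2 + c * c3).
  eapply approx_eq_lin; [|apply (approx_comp3 _ (dist3_pos z) _ _ _ _ _ _ _ _ _ _ _ HF Hf Hg Hh)].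
  intros [[? ?] ?]; destruct z as [[? ?] ?]; simpl; ring.
Qed.

Lemma diff3_ext (f g : C3 -> C) (z : C3) : (forall z, f z = g z) -> diff3 f z -> diff3 g z.
Proof. intros E [a [b [c H]]]; exists a, b, c; revert H; now apply D3_ext. Qed.

Lemma diff3_mu (z : C3) : (norm3 z < dl)%R -> diff3 mu z.
Proof. exact (mu_D3 z). Qed.

Lemma diff3_lam (z : C3) : (norm3 z < dl)%R -> diff3 lam z.
Proof. intros H; destruct (lam_D3 z H) as [a [b [c [HH _]]]]; now exists a, b, c. Qed.

Lemma diff3_om (z : C3) : (norm3 z < dl)%R -> diff3 om z.
Proof. intros H; destruct (om_D3 z H) as [a [b [c [HH _]]]]; now exists a, b, c. Qed.

Lemma region_diff3 (z : C3) : region z -> diff3 gamma z /\ diff3 eta z /\ diff3 eta1 z.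
Proof.
  intros H.
  assert (Hk : diff3 (fun z => kap (snd z)) z).
  { apply diff3_minus; [apply diff3_inv; [exact (rg_w _ H)|apply diff3_coord3]|apply diff3_const]. }
  assert (Hm0 : diff3 (fun z => m0 (snd z)) z).
  { apply diff3_plus; [apply diff3_const|].
    apply (diff3_comp mu (fun _ => RtoC 0) (fun _ => RtoC 0) (fun z => kap (snd z)));
      auto using diff3_const. apply diff3_mu, (rg_k _ H). }
  assert (Hq : diff3 qf z).
  { apply diff3_ext with (fun z => snd (fst z) * / (2 * m0 (snd z))); [now intros [[? ?] ?]|].
    apply diff3_mult; [apply diff3_coord2|apply diff3_inv].
    - apply Cmult_neq_0; [apply RtoC_neq_0; lra|exact (rg_m0_neq _ H)].
    - apply diff3_mult; auto using diff3_const. }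
  assert (Hp : diff3 pf z).
  { apply diff3_ext with (fun z => fst (fst z) - qf z * (1 + lam (RtoC 0, RtoC 0, kap (snd z))));
      [now intros [[? ?] ?]|].
    apply diff3_minus; [apply diff3_coord1|apply diff3_mult; auto; apply diff3_plus; [apply diff3_const|]].
    apply (diff3_comp lam (fun _ => RtoC 0) (fun _ => RtoC 0) (fun z => kap (snd z)));
      auto using diff3_const. apply diff3_lam, (rg_k _ H). }
  assert (HA : diff3 (fun z => pf z * qf z ^ 4) z) by (apply diff3_mult; auto using diff3_pow).
  assert (HB : diff3 (fun z => qf z ^ 5) z) by auto using diff3_pow.
  assert (Ez : forall z, zf z = (pf z * qf z ^ 4, qf z ^ 5, kap (snd z))) by now intros [[? ?] ?].
  assert (HF : forall F, (diff3 F (zf z)) -> diff3 (fun z => F (zf z)) z).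
  { intros F HF; apply diff3_ext with (fun z => F (pf z * qf z ^ 4, qf z ^ 5, kap (snd z)));
      [intros; now rewrite Ez|]. apply (diff3_comp F); auto. now rewrite <- Ez. }
  pose proof (HF _ (diff3_mu _ (rg_z _ H))) as Hmu.
  pose proof (HF _ (diff3_lam _ (rg_z _ H))) as Hlam.
  pose proof (HF _ (diff3_om _ (rg_z _ H))) as Hom.
  split; [|split].
  - repeat first [assumption | apply diff3_plus | apply diff3_mult | apply diff3_const].
  - repeat first [assumption | apply diff3_plus | apply diff3_mult | apply diff3_const].
  - apply diff3_ext with (fun z => (pf z + qf z * (2 + om (zf z))) *
       / (32 * m0 (snd z) ^ 5 * (1 + mu (zf z) + m0 (snd z)))); [now intros [[? ?] ?]|].
    apply diff3_mult; [|apply diff3_inv].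
    + repeat first [assumption | apply diff3_plus | apply diff3_mult | apply diff3_const].
    + apply Cmult_neq_0; [apply Cmult_neq_0; [apply RtoC_neq_0; lra|apply Cpow_nz, (rg_m0_neq _ H)]|].
      now apply m_plus_m0_neq_0.
    + apply diff3_mult; [apply diff3_mult; auto using diff3_const, diff3_pow|].
      repeat first [assumption | apply diff3_plus | apply diff3_const].
Qed.

(** * Inverting a perturbation of the identity *)

(** The chain rule in three variables, applied to a function of the first coordinate and a curve
    whose other two coordinates are constant. *)
Lemma D1_comp (f g : C -> C) (t a b : C) :
  D1 f (g t) a -> D1 g t b -> D1 (fun s => f (g s)) t (a * b).
Proof.
  intros [_ Hf] Hg.
  assert (HF : D3 (fun z : C3 => f (fst (fst z))) (g t, RtoC 0, RtoC 0) a 0 0).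
  { split.
    - exists (Cmod a + Cmod 0 + Cmod 0)%R; split.
      + rewrite Cmod_0; pose proof (Cmod_ge_0 a); lra.
      + intros z; apply lin3_bound.
    - intros eps He; destruct (Hf eps He) as [del [Hdel H]]; exists del; split; auto.
      intros [[x y] w] Hz; simpl.
      assert (Hx : (dist1 (g t) x <= dist3 (g t, RtoC 0, RtoC 0) (x, y, w))%R).
      { unfold dist1, dist3; simpl. pose proof (Cmod_ge_0 (y - 0)); pose proof (Cmod_ge_0 (w - 0)); lra. }
      specialize (H x ltac:(lra)).
      replace (f x - f (g t) - (a * (x - g t) + 0 * (y - 0) + 0 * (w - 0)))
        with (f x - f (g t) - a * (x - g t)) by ring.
      eapply Rle_trans; [exact H|apply Rmult_le_compat_l; lra]. }
  eapply D1_eq; [|apply (D1_comp3 _ g (fun _ => RtoC 0) (fun _ => RtoC 0) t a 0 0 b 0 0 HF Hg); apply D1_const].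
  ring.
Qed.

(** With [c = f b - f a], the real mean value theorem is applied on the segment to the real part of
    [conj c * f], whose total increment is [|c|^2]. *)
Lemma mean_value_bound (f df : C -> C) (a b : C) (K : R) :
  (forall s : R, (0 <= s <= 1)%R -> D1 f (a + RtoC s * (b - a))%C (df (a + RtoC s * (b - a))%C) /\
     (Cmod (df (a + RtoC s * (b - a))%C) <= K)%R) ->
  (Cmod (f b - f a) <= K * Cmod (b - a))%R.
Proof.
  intros H; set (c := f b - f a).
  set (l := fun s : R => (a + RtoC s * (b - a))%C).
  set (g := fun s : R => Re (Cconj c * f (l s))%C).
  set (dg := fun s : R => Re (Cconj c * (df (l s) * (b - a)))%C).
  assert (Hg : forall s, (0 <= s <= 1)%R -> derivable_pt_lim g s (dg s)).
  { intros s Hs eps He; destruct (H s Hs) as [[_ HD] _].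
    set (N := (Cmod c * Cmod (b - a) + 1)%R).
    assert (HN : (0 < N)%R) by (unfold N; pose proof (Cmod_ge_0 c); pose proof (Cmod_ge_0 (b - a)); nra).
    destruct (HD (eps / 2 / N)%R) as [del [Hdel HD']]; [apply Rdiv_lt_0_compat; lra|].
    assert (Hd : (0 < del / (Cmod (b - a) + 1))%R)
      by (apply Rdiv_lt_0_compat; [auto|pose proof (Cmod_ge_0 (b - a)); lra]).
    exists (mkposreal _ Hd); intros h Hh Hhd; simpl in Hhd.
    assert (E1 : l (s + h)%R - l s = RtoC h * (b - a)) by (unfold l; rewrite RtoC_plus; ring).
    assert (E2 : dist1 (l s) (l (s + h)%R) = (Rabs h * Cmod (b - a))%R).
    { unfold dist1; rewrite E1, Cmod_mult, Cmod_R; auto. }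
    assert (E3 : (dist1 (l s) (l (s + h)%R) < del)%R).
    { rewrite E2. apply (Rmult_lt_compat_r (Cmod (b - a) + 1)) in Hhd; [|pose proof (Cmod_ge_0 (b - a)); lra].
      replace (del / (Cmod (b - a) + 1) * (Cmod (b - a) + 1))%R with del in Hhd
        by (field; pose proof (Cmod_ge_0 (b - a)); lra).
      pose proof (Rabs_pos h); lra. }
    specialize (HD' _ E3). fold (l s) in HD'. rewrite E2, E1 in HD'.
    set (X := f (l (s + h)%R) - f (l s) - df (l s) * (RtoC h * (b - a))) in *.
    replace ((g (s + h) - g s) / h - dg s)%R with (Re (Cconj c * X) / h)%R.
    2:{ unfold X, g, dg.
        replace (Cconj c * (f (l (s + h)%R) - f (l s) - df (l s) * (RtoC h * (b - a)))) with
          (Cconj c * f (l (s + h)%R) - Cconj c * f (l s) - RtoC h * (Cconj c * (df (l s) * (b - a)))) by ring.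
        unfold Cminus. rewrite !re_plus, !re_opp, re_scal_l. field; auto. }
    unfold Rdiv. rewrite Rabs_mult, Rabs_inv.
    assert (Hhp : (0 < Rabs h)%R) by now apply Rabs_pos_lt.
    apply Rmult_lt_reg_r with (Rabs h); auto. rewrite Rmult_assoc, Rinv_l, Rmult_1_r by lra.
    eapply Rle_lt_trans; [apply re_le_Cmod|]. rewrite Cmod_mult, Cmod_conj.
    pose proof (Cmod_ge_0 c) as Hc; pose proof (Cmod_ge_0 (b - a)) as Hba.
    apply Rle_lt_trans with (Cmod c * (eps / 2 / N * (Rabs h * Cmod (b - a))))%R.
    { apply Rmult_le_compat_l; auto. }
    replace (Cmod c * (eps / 2 / N * (Rabs h * Cmod (b - a))))%R
      with ((Cmod c * Cmod (b - a) / N) * (eps / 2) * Rabs h)%R by (field; lra).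
    assert (H1 : (Cmod c * Cmod (b - a) / N <= 1)%R).
    { apply Rmult_le_reg_r with N; auto. unfold Rdiv; rewrite Rmult_assoc, Rinv_l by lra. unfold N; lra. }
    apply Rle_lt_trans with (1 * (eps / 2) * Rabs h)%R; [|nra].
    apply Rmult_le_compat_r; [lra|]. apply Rmult_le_compat_r; lra. }
  destruct (MVT_cor2 g dg 0 1 Rlt_0_1 Hg) as [s [E Hs]].
  assert (E0 : (g 1 - g 0 = Cmod c ^ 2)%R).
  { unfold g, l. replace (a + RtoC 1 * (b - a)) with b by ring. replace (a + RtoC 0 * (b - a)) with a by ring.
    apply RtoC_inj. rewrite Cmod2_conj.
    replace (RtoC (Re (Cconj c * f b) - Re (Cconj c * f a))) with (RtoC (Re (Cconj c * c))).
    - destruct c as [c1 c2]; apply injective_projections; simpl; ring.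
    - f_equal. unfold c at 2. replace (Cconj c * (f b - f a)) with (Cconj c * f b + - (Cconj c * f a)) by ring.
      rewrite re_plus, re_opp; ring. }
  rewrite E0 in E. destruct (H s ltac:(lra)) as [_ HK]. fold (l s) in HK.
  assert (H1 : (Cmod c ^ 2 <= Cmod c * (K * Cmod (b - a)))%R).
  { rewrite E. replace (1 - 0)%R with 1%R by ring. rewrite Rmult_1_r. unfold dg.
    eapply Rle_trans; [apply Rle_abs|]. eapply Rle_trans; [apply re_le_Cmod|].
    rewrite !Cmod_mult, Cmod_conj.
    apply Rmult_le_compat_l; [apply Cmod_ge_0|]. apply Rmult_le_compat_r; [apply Cmod_ge_0|auto]. }
  pose proof (Cmod_ge_0 c) as [Hc|Hc].
  - apply Rmult_le_reg_l with (Cmod c); auto. nra.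
  - rewrite <- Hc. apply Rmult_le_pos; [|apply Cmod_ge_0].
    eapply Rle_trans; [apply Cmod_ge_0|exact HK].
Qed.

Section Inverse.
Context (t1 : C) (r : R) (x : C -> C).
Let disk (t : C) : Prop := (Cmod (t - t1) < r)%R.
Context (x_lip : forall a b, disk a -> disk b ->
  (Cmod ((x a - a) - (x b - b)) <= / 2 * Cmod (a - b))%R).

(** As [x] minus the identity is 1/2-Lipschitz, [x] shrinks no distance by more than a factor 2. *)
Lemma inverse_lipschitz (a b : C) : disk a -> disk b -> (Cmod (a - b) <= 2 * Cmod (x a - x b))%R.
Proof.
  intros Ha Hb; pose proof (x_lip a b Ha Hb) as H.
  pose proof (Cmod_minus_le (x a - x b) (x a - a - (x b - b))) as H1.
  replace (x a - x b - (x a - a - (x b - b))) with (a - b) in H1 by ring. lra.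
Qed.

Lemma x_injective (a b : C) : disk a -> disk b -> x a = x b -> a = b.
Proof.
  intros Ha Hb E; pose proof (inverse_lipschitz a b Ha Hb) as H.
  replace (x a - x b) with (RtoC 0) in H by (rewrite E; ring). rewrite Cmod_0 in H.
  assert (E0 : a - b = 0) by (apply Cmod_zero_intro; lra).
  replace a with (a - b + b) by ring; rewrite E0; ring.
Qed.

(* Contraction mapping argument for [t = X - (x t - t)]. *)
Lemma x_surjective_near (t0 : C) : disk t0 ->
  exists del : R, (0 < del)%R /\ forall X, (Cmod (X - x t0) < del)%R -> exists t, disk t /\ x t = X.
Proof.
  intros Ht0; unfold disk in *.
  (* The limit of the iteration lies within [3 d] of [t0], by the bound for dominated series; hence
     the division by 3. *)
  exists ((r - Cmod (t0 - t1)) / 3)%R; split; [lra|]; intros X HX.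
  set (d := Cmod (X - x t0)) in *. assert (Hd : (0 <= d)%R) by apply Cmod_ge_0.
  assert (Hball : forall t, (Cmod (t - t0) <= 3 * d)%R -> (Cmod (t - t1) < r)%R).
  { intros t Ht. pose proof (Cmod_triangle (t - t0) (t0 - t1)) as H.
    replace (t - t0 + (t0 - t1)) with (t - t1) in H by ring. lra. }
  set (s := fix s (n : nat) : C := match n with O => t0 | S k => X - (x (s k) - s k) end).
  (* The increments are dominated by [d 2^(-n)], so the limit of the iterates is the sum of a series
     already under control. *)
  set (a := fun n => s (S n) - s n).
  assert (Hs : forall n, (Cmod (s n - t0) <= 2 * d * (1 - (/ 2) ^ n))%R /\ (Cmod (a n) <= d * (/ 2) ^ n)%R).
  { induction n as [|n [IH1 IH2]].
    - unfold a; simpl. replace (t0 - t0) with (RtoC 0) by ring. rewrite Cmod_0; split; [lra|].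
      replace (X - (x t0 - t0) - t0) with (X - x t0) by ring. fold d; lra.
    - assert (Hn1 : (Cmod (s (S n) - t0) <= 2 * d * (1 - (/ 2) ^ S n))%R).
      { replace (s (S n) - t0) with (s n - t0 + a n) by (unfold a; ring).
        pose proof (Cmod_triangle (s n - t0) (a n)) as H0. simpl pow. lra. }
      split; auto.
      assert (Hdn : forall m, (Cmod (s m - t0) <= 2 * d * (1 - (/ 2) ^ m))%R -> (Cmod (s m - t1) < r)%R).
      { intros m Hm; apply Hball. pose proof (half_pow_pos m). nra. }
      pose proof (x_lip _ _ (Hdn _ Hn1) (Hdn _ IH1)) as HL.
      replace (a (S n)) with (- ((x (s (S n)) - s (S n)) - (x (s n) - s n))).
      2:{ unfold a at 1. change (s (S (S n))) with (X - (x (s (S n)) - s (S n))).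
          replace (X - (x (s (S n)) - s (S n)) - s (S n)) with
            (X - (x (s (S n)) - s (S n)) - (X - (x (s n) - s n))) by reflexivity. ring. }
      rewrite Cmod_opp. fold (a n) in HL. simpl pow. lra. }
  assert (Hdom : dom d a) by (intros n; apply Hs).
  set (t := t0 + CS a).
  assert (Hsum : forall n, Csum a n = s (S n) - t0).
  { induction n as [|n IH]; [reflexivity|]. cbn [Csum]; rewrite IH; unfold a; ring. }
  assert (Ht : (Cmod (t - t1) < r)%R).
  { apply Hball. unfold t; replace (t0 + CS a - t0) with (CS a) by ring. now apply CS_bound. }
  assert (Hlim : forall n, (Cmod (t - s (S n)) <= 2 * d * (/ 2) ^ n)%R).
  { intros n; pose proof (CS_tail d a n Hdom) as H; rewrite Hsum in H.
    replace (CS a - (s (S n) - t0)) with (t - s (S n)) in H by (unfold t; ring). auto. }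
  exists t; split; auto.
  assert (H0 : (Cmod (x t - X) <= 0)%R).
  { apply le_epsilon; intros eps He.
    destruct (half_pow_small (3 * d) eps He) as [n Hn].
    assert (Hdn : (Cmod (s (S n) - t1) < r)%R).
    { apply Hball. destruct (Hs (S n)) as [H1 _]. pose proof (half_pow_pos (S n)). nra. }
    pose proof (x_lip _ _ Ht Hdn) as HL.
    pose proof (Hlim n) as L1. pose proof (Hlim (S n)) as L2.
    pose proof (Cmod_triangle (t - s (S (S n))) (x t - t - (x (s (S n)) - s (S n)))) as H.
    replace (t - s (S (S n)) + (x t - t - (x (s (S n)) - s (S n)))) with (x t - X) in H.
    2:{ change (s (S (S n))) with (X - (x (s (S n)) - s (S n))). ring. }
    simpl pow in L2. pose proof (half_pow_pos n). nra. }
  apply Cmod_zero_intro in H0. replace (x t) with (x t - X + X) by ring; rewrite H0; ring.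
Qed.

(** Injectivity of [x] on the disk makes the chosen value the only possible one on the image;
    elsewhere the value is arbitrary. *)
Definition inv_x (X : C) : C := epsilon (inhabits (RtoC 0)) (fun t => disk t /\ x t = X).

Lemma inv_x_spec (t : C) : disk t -> inv_x (x t) = t.
Proof.
  intros Ht. destruct (epsilon_spec (inhabits (RtoC 0)) (fun s => disk s /\ x s = x t)) as [H1 H2].
  { now exists t. }
  now apply x_injective.
Qed.

Lemma inv_x_near (t0 : C) : disk t0 ->
  near (x t0) (fun X => disk (inv_x X) /\ x (inv_x X) = X /\
     (Cmod (inv_x X - t0) <= 2 * Cmod (X - x t0))%R).
Proof.
  intros Ht0; destruct (x_surjective_near t0 Ht0) as [del [Hdel H]]; exists del; split; auto.
  intros X HX; destruct (H X HX) as [t [Ht E]]. subst X; rewrite inv_x_spec by auto.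
  split; auto; split; auto. now apply inverse_lipschitz.
Qed.

Lemma near_inv_x (t0 : C) (P : C -> Prop) : disk t0 -> near t0 P -> near (x t0) (fun X => P (inv_x X)).
Proof.
  intros Ht0 [del [Hdel H]].
  assert (N : near (x t0) (fun X => (dist1 (x t0) X < del / 2)%R)) by (exists (del / 2)%R; split; [lra|auto]).
  eapply near_imp; [|exact (near_and _ _ _ (inv_x_near t0 Ht0) N)].
  intros X [[_ [_ H1]] H2]; apply H; unfold dist1 in *; lra.
Qed.

Lemma inv_x_D1 (t0 dx : C) : disk t0 -> dx <> 0 -> D1 x t0 dx -> D1 inv_x (x t0) (/ dx).
Proof.
  intros Ht0 Hdx [_ HD]; split.
  - exists (Cmod (/ dx)); split; [apply Cmod_ge_0|]; intros s; rewrite Cmod_mult; apply Rle_refl.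
  - intros eps He. pose proof (proj1 (Cmod_gt_0 _) Hdx) as Hp.
    destruct (HD (eps * Cmod dx / 2)%R) as [del [Hdel H]].
    { apply Rdiv_lt_0_compat; [apply Rmult_lt_0_compat|]; lra. }
    assert (N : near t0 (fun t => (Cmod (x t - x t0 - dx * (t - t0)) <= eps * Cmod dx / 2 * dist1 t0 t)%R))
      by (exists del; auto).
    apply (near_inv_x t0) in N; auto.
    destruct (near_and _ _ _ (inv_x_near t0 Ht0) N) as [del' [Hdel' H']].
    exists del'; split; auto; intros X HX; destruct (H' X HX) as [[_ [E HL]] HB].
    cbv beta in HB. rewrite E in HB. rewrite inv_x_spec by auto.
    replace (inv_x X - t0 - / dx * (X - x t0)) with (- (/ dx * (X - x t0 - dx * (inv_x X - t0)))) by (field; auto).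
    rewrite Cmod_opp, Cmod_mult, Cmod_inv by auto.
    apply Rmult_le_reg_l with (Cmod dx); auto. rewrite <- Rmult_assoc, Rinv_r, Rmult_1_l by lra.
    eapply Rle_trans; [exact HB|]. unfold dist1.
    replace (Cmod dx * (eps * Cmod (X - x t0)))%R with (eps * Cmod dx / 2 * (2 * Cmod (X - x t0)))%R by field.
    apply Rmult_le_compat_l; auto.
    apply Rlt_le, Rdiv_lt_0_compat; [apply Rmult_lt_0_compat|]; lra.
Qed.

End Inverse.

(** * Transformed solutions *)

Lemma rho_of_ge_1 (x0 : C) : (1 <= rho_of x0)%R.
Proof. unfold rho_of; pose proof (Cmod_ge_0 x0); lra. Qed.

Lemma ep_bound : (0 < ep < / 4)%R.
Proof. unfold ep; lra. Qed.

Lemma tpolydisk_region (x0 t u u1 : C) :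
  tpolydisk x0 (rho_of x0) ep (t, u, u1) -> region (tvw (t, u, u1)) /\ u <> 0 /\ u1 <> 0.
Proof.
  intros H; destruct (tpolydisk_polydisk _ _ _ _ _ _ (proj2 ep_bound) H) as [H1 H2].
  split; auto. now apply polydisk_region with x0.
Qed.

Lemma Gam_formula (t u u1 : C) :
  region (tvw (t, u, u1)) -> u <> 0 ->
  - u ^ 2 * eta (tvw (t, u, u1)) = u1 * (1 + (u1 / u ^ 2) ^ 4 * eta1 (tvw (t, u, u1))).
Proof.
  intros H Hu. unfold tvw in *. rewrite eta_eta1 by auto.
  set (e := eta1 _); clearbody e. field; auto.
Qed.

(* At a pole of [u] the last two coordinates are junk values. *)
Definition phase (u : C -> option C) (u1 : C -> C) (t : C) : C3 :=
  (t, finite_value (u t), u1 t).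
Definition vw_curve (u : C -> option C) (u1 : C -> C) (t : C) : C3 :=
  (t, v_of u u1 t, w_of u u1 t).

Section Solution.
Context (x0 t1 : C) (r : R) (u : C -> option C) (u1 : C -> C).
Let disk (t : C) : Prop := (Cmod (t - t1) < r)%R.
Context (Hsol : is_solution F_elliptic disk u u1).
Context (HT : forall z : C3, T_set u u1 t1 r z -> polydisk x0 (rho_of x0) ep z).
Let x (t : C) : C := gamma (vw_curve u u1 t).
Let U (t : C) : C := finite_value (u t).

Lemma curve_polydisk (t : C) : disk t -> polydisk x0 (rho_of x0) ep (vw_curve u u1 t).
Proof. intros Ht; apply HT; now exists t. Qed.

Lemma vw_curve_finite (t : C) : u t <> None -> vw_curve u u1 t = tvw (phase u u1 t).
Proof. unfold vw_curve, phase, v_of, w_of; destruct (u t); [reflexivity|congruence]. Qed.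

Lemma phase_domain (t : C) : disk t -> u t <> None -> tpolydisk x0 (rho_of x0) ep (phase u u1 t).
Proof.
  intros Ht Hu; pose proof (curve_polydisk t Ht) as H; rewrite vw_curve_finite in H by auto.
  destruct H as [H1 [H2 H3]]; split; auto; split; auto. now rewrite Cmod_opp in H2.
Qed.

Lemma finite_near (t : C) : disk t -> u t <> None -> near t (fun s => u s <> None).
Proof.
  intros Ht Hu; destruct Hsol as [_ H]; specialize (H t Ht).
  destruct (u t); [|congruence]. destruct H as [H _]. now apply locally_C_elim in H.
Qed.

Lemma regular_point (t c : C) : disk t -> u t = Some c ->
  exists dx dy1, D1 x t dx /\ dx <> 0 /\ (Cmod (dx - 1) <= / 2)%R /\
    D1 U t (u1 t) /\ D1 (fun s => snd (Gam (phase u u1 s))) t dy1 /\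
    u1 t / dx = snd (Gam (phase u u1 t)) /\ dy1 / dx = F_painleve (x t) c.
Proof.
  intros Ht Hc. assert (Hu : u t <> None) by congruence.
  pose proof (phase_domain t Ht Hu) as Hd.
  destruct (tpolydisk_region _ _ _ _ Hd) as [Hreg [Hu0 Hu10]].
  destruct Hsol as [_ H]; specialize (H t Ht); rewrite Hc in H; destruct H as [_ [HU HU1]].
  assert (EU : U t = c) by (unfold U; now rewrite Hc).
  destruct (proj2 (takes_into_Gam (tpolydisk x0 (rho_of x0) ep) (tpolydisk_region x0) t U u1 (u1 t) (F_elliptic t c)
    Hd HU HU1)) as [dx [dy [dy1 [Hx [Hy [Hy1 [Hdx [E1 E2]]]]]]]].
  { rewrite EU; auto. }
  apply is_derive_D1 in Hx, Hy, Hy1, HU.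
  assert (Edy : dy = u1 t) by (eapply D1_unique; [exact Hy|exact HU]).
  subst dy.
  assert (Hx' : D1 x t dx).
  { apply D1_ext_near with (2 := Hx). eapply near_imp; [|exact (finite_near t Ht Hu)].
    intros s Hs. unfold x. rewrite vw_curve_finite by auto. reflexivity. }
  assert (Ext : x t = fst (fst (Gam (phase u u1 t)))) by (unfold x; rewrite vw_curve_finite; auto).
  exists dx, dy1; split; auto. split; auto. split.
  - cbv beta in E1. change (snd (Gam (t, U t, u1 t))) with (- U t ^ 2 * eta (tvw (t, U t, u1 t))) in E1.
    rewrite Gam_formula in E1 by auto.
    pose proof (eta1_small _ _ _ Hreg) as HS.
    assert (HS' : (Cmod ((u1 t / U t ^ 2) ^ 4 * eta1 (tvw (t, U t, u1 t))) <= / 3)%R).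
    { replace ((u1 t / U t ^ 2) ^ 4) with ((- (u1 t / U t ^ 2)) ^ 4) by ring. exact HS. }
    clear HS; rename HS' into HS.
    set (e := (u1 t / U t ^ 2) ^ 4 * eta1 (tvw (t, U t, u1 t))) in *.
    (* Since [u1 / dx = u1 (1 + e)] with [|e| <= 1/3], one gets [|dx - 1| <= |dx|/3], and therefore
       [|dx - 1| <= 1/2]. *)
    assert (E3 : dx - 1 = - (e * dx)).
    { replace (dx - 1) with (dx - (u1 t / dx) * dx / u1 t) by (field; auto). rewrite E1. field; auto. }
    assert (B1 : (Cmod (dx - 1) <= / 3 * Cmod dx)%R).
    { rewrite E3, Cmod_opp, Cmod_mult. apply Rmult_le_compat_r; [apply Cmod_ge_0|exact HS]. }
    pose proof (Cmod_triangle (dx - 1) 1) as B2. replace (dx - 1 + 1) with dx in B2 by ring.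
    rewrite Cmod_1 in B2. lra.
  - split; [exact HU|split; [exact Hy1|split; [exact E1|]]].
    rewrite Ext, <- EU. exact E2.
Qed.

Lemma reciprocal_pole (t : C) : disk t -> u t = None ->
  exists d, D1 (fun s => reciprocal (u s)) t d.
Proof.
  intros Ht Hc; destruct Hsol as [_ H]; specialize (H t Ht); rewrite Hc in H.
  destruct H as [_ [d Hd]]; exists d; now apply is_derive_D1.
Qed.

Lemma punctured_finite (t : C) : disk t -> u t = None -> near t (fun s => s <> t -> u s <> None).
Proof.
  intros Ht Hc; destruct Hsol as [_ H]; specialize (H t Ht); rewrite Hc in H.
  destruct H as [H _]. apply (locally_C_elim t (fun s => s <> t -> u s <> None)). exact H.
Qed.

Lemma disk_near (t : C) : disk t -> near t disk.
Proof.
  intros Ht; unfold disk in *; exists (r - Cmod (t - t1))%R; split; [lra|].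
  intros s Hs; unfold dist1 in Hs. pose proof (Cmod_triangle (s - t) (t - t1)) as H.
  replace (s - t + (t - t1)) with (s - t1) in H by ring. lra.
Qed.

(** [v^2 = (1/u)/w], and [w] is close to 1/4, so [|w| >= 1/5]. *)
Lemma v_square (t : C) : disk t -> u t <> None ->
  (Cmod (v_of u u1 t) ^ 2 <= 5 * Cmod (reciprocal (u t)))%R.
Proof.
  intros Ht Hu. pose proof (curve_polydisk t Ht) as [_ [_ Hw]].
  destruct (tpolydisk_region _ _ _ _ (phase_domain t Ht Hu)) as [_ [Hu0 Hu10]].
  revert Hw Hu0; unfold v_of, w_of, reciprocal. destruct (u t) as [c|]; [|congruence].
  simpl finite_value; intros Hw Hc.
  assert (HW : (/ 5 <= Cmod (c ^ 3 / u1 t ^ 2))%R).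
  { pose proof (Cmod_triangle_inv (/ 4) (/ 4 - c ^ 3 / u1 t ^ 2)) as H1.
    replace (/ 4 - (/ 4 - c ^ 3 / u1 t ^ 2)) with (c ^ 3 / u1 t ^ 2) in H1 by ring.
    rewrite (Cmod_minus_sym (/ 4) _), <- RtoC_inv, Cmod_R, Rabs_pos_eq in H1 by lra.
    rewrite <- RtoC_inv in Hw by lra. unfold ep in Hw. lra. }
  replace (/ c) with ((- (u1 t / c ^ 2)) ^ 2 * (c ^ 3 / u1 t ^ 2)) by (field; auto).
  rewrite Cmod_mult, Cmod_pow.
  pose proof (pow_le _ 2 (Cmod_ge_0 (- (u1 t / c ^ 2)))). nra.
Qed.

(** Near a pole [|x(s) - s| <= |v|^4 <= 25 |1/u|^2], and [1/u] is differentiable with value 0 at the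
    pole. So [x] agrees with the identity to second order, and no differentiability of [v] or [w] at
    the pole has to be established. *)
Lemma pole_point (t : C) : disk t -> u t = None -> x t = t /\ D1 x t 1.
Proof.
  intros Ht Hc.
  assert (HG : forall s, disk s -> (Cmod (x s - s) <= Cmod (v_of u u1 s) ^ 4)%R).
  { intros s Hs. apply gamma_close. apply polydisk_region with x0. now apply curve_polydisk. }
  assert (Ex : x t = t).
  { pose proof (HG t Ht) as H. unfold v_of in H; rewrite Hc, Cmod_0 in H.
    assert (E : x t - t = 0) by (apply Cmod_zero_intro; simpl in H; lra).
    replace (x t) with (x t - t + t) by ring; rewrite E; ring. }
  split; auto.
  apply (approx_perturb (dist1 t) (dist1_pos t) t x (fun s => s)); [apply D1_id|auto|].
  destruct (reciprocal_pole t Ht Hc) as [d Hd].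
  destruct (approx_lipschitz _ _ _ _ Hd) as [K [del [HK [Hdel HL]]]].
  assert (N : near t (fun s => (Cmod (reciprocal (u s) - reciprocal (u t)) <= K * dist1 t s)%R))
    by (exists del; auto).
  destruct (near_and _ _ _ (near_and _ _ _ N (disk_near t Ht)) (punctured_finite t Ht Hc)) as [del' [Hdel' H]].
  exists (25 * (K * K))%R, del'; split; [nra|split; auto]; intros s Hs.
  destruct (H s Hs) as [[H1 H2] H3]. pose proof (dist1_pos t s) as Hd0.
  destruct (Ceq_dec s t) as [->|E].
  { rewrite Ex; replace (t - t) with (RtoC 0) by ring; rewrite Cmod_0. nra. }
  eapply Rle_trans; [apply HG; auto|].
  pose proof (v_square s H2 (H3 E)) as HV. rewrite Hc in H1. simpl reciprocal in H1.
  replace (reciprocal (u s) - 0) with (reciprocal (u s)) in H1 by ring.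
  replace (Cmod (v_of u u1 s) ^ 4)%R with ((Cmod (v_of u u1 s) ^ 2) * (Cmod (v_of u u1 s) ^ 2))%R by ring.
  replace (25 * (K * K) * (dist1 t s * dist1 t s))%R
    with ((5 * (K * dist1 t s)) * (5 * (K * dist1 t s)))%R by ring.
  assert (0 <= Cmod (v_of u u1 s) ^ 2)%R by apply pow_le, Cmod_ge_0.
  apply Rmult_le_compat; lra.
Qed.

Lemma x_derivative (t : C) : disk t -> exists dx, D1 x t dx /\ dx <> 0 /\ (Cmod (dx - 1) <= / 2)%R.
Proof.
  intros Ht; destruct (u t) as [c|] eqn:Hc.
  - destruct (regular_point t c Ht Hc) as [dx [_ [H1 [H2 [H3 _]]]]]; now exists dx.
  - destruct (pole_point t Ht Hc) as [_ H]; exists 1; split; auto; split; [apply C1_nz|].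
    replace (1 - 1) with (RtoC 0) by ring; rewrite Cmod_0; lra.
Qed.

(** The disk is convex, so the bound [|dx - 1| <= 1/2], valid at poles and regular points alike,
    integrates along segments. *)
Lemma x_contraction (a b : C) : disk a -> disk b ->
  (Cmod ((x a - a) - (x b - b)) <= / 2 * Cmod (a - b))%R.
Proof.
  intros Ha Hb.
  assert (HD : exists D : C -> C, forall t, disk t -> D1 x t (D t) /\ (Cmod (D t - 1) <= / 2)%R).
  { apply (functional_choice (fun t d => disk t -> D1 x t d /\ (Cmod (d - 1) <= / 2)%R)).
    intros t; destruct (Rlt_dec (Cmod (t - t1)) r) as [Ht|Ht].
    - destruct (x_derivative t Ht) as [dx [H1 [_ H2]]]; now exists dx.
    - exists 0; intros H; now elim Ht. }
  destruct HD as [D HD].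
  apply (mean_value_bound (fun t => x t - t) (fun t => D t - 1) b a (/ 2)).
  intros s Hs.
  assert (Hds : disk (b + RtoC s * (a - b))).
  { unfold disk in *.
    replace (b + RtoC s * (a - b) - t1) with (RtoC (1 - s) * (b - t1) + RtoC s * (a - t1))
      by (rewrite RtoC_minus; ring).
    eapply Rle_lt_trans; [apply Cmod_triangle|]. rewrite !Cmod_mult, !Cmod_R, !Rabs_pos_eq by lra.
    destruct (Rle_lt_or_eq_dec 0 s (proj1 Hs)) as [H0|H0]; [nra|]. rewrite <- H0; lra. }
  destruct (HD _ Hds) as [H1 H2]. split; auto. apply D1_minus; [auto|apply D1_id].
Qed.

(** With [psi] the inverse of [x], take [y = u o psi], and for its derivative the last component of
    [Gam] along the curve. At regular points the chain rule turns quotients by [dx] into derivatives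
    in [x]; at poles the reciprocal of [u] is composed with [psi]. *)
Lemma transformed_solution :
  exists (y : C -> option C) (y1 : C -> C),
    (forall t : C, disk t -> y (gamma (t, v_of u u1 t, w_of u u1 t)) = u t) /\
    is_solution F_painleve (image_set gamma (T_set u u1 t1 r)) y y1.
Proof.
  set (psi := inv_x t1 r x).
  pose proof (inv_x_spec t1 r x x_contraction) as Hpsi.
  assert (Himg : forall X, image_set gamma (T_set u u1 t1 r) X <-> exists t, disk t /\ X = x t).
  { intros X; split.
    - intros [z [[t [Ht ->]] ->]]; now exists t.
    - intros [t [Ht ->]]; exists (vw_curve u u1 t); split; auto. now exists t. }
  exists (fun X => u (psi X)), (fun X => snd (Gam (phase u u1 (psi X)))).
  split; [intros t Ht; unfold psi; change (u (inv_x t1 r x (x t)) = u t); now rewrite Hpsi|].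
  split.
  - intros X HX; apply Himg in HX; destruct HX as [t [Ht ->]]; apply locally_C_intro.
    destruct (inv_x_near t1 r x x_contraction t Ht) as [del [Hdel H]]; exists del; split; auto.
    intros X HX; destruct (H X HX) as [H1 [H2 _]]. apply Himg; now exists (inv_x t1 r x X).
  - intros X HX; apply Himg in HX; destruct HX as [t [Ht ->]].
    destruct (x_derivative t Ht) as [dx0 [HDx0 [Hdx0 _]]].
    pose proof (inv_x_D1 t1 r x x_contraction t dx0 Ht Hdx0 HDx0) as HDpsi. fold psi in HDpsi.
    assert (Epsi : psi (x t) = t) by now apply Hpsi.
    assert (Hloc : forall P, near t P -> @locally C_UniformSpace (x t) (fun X => P (psi X))).
    { intros P HP; apply locally_C_intro. exact (near_inv_x t1 r x x_contraction t P Ht HP). }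
    rewrite Epsi. destruct (u t) as [c|] eqn:Hc.
    + destruct (regular_point t c Ht Hc) as [dx [dy1 [HDx [Hdx [_ [HU [HY [E1 E2]]]]]]]].
      rewrite (D1_unique _ _ _ _ HDx0 HDx) in HDpsi.
      split; [|split].
      * apply (Hloc (fun s => u s <> None)), finite_near; auto; congruence.
      * apply is_derive_D1. rewrite <- E1. apply (D1_comp U psi); [rewrite Epsi; exact HU|exact HDpsi].
      * apply is_derive_D1. rewrite <- E2.
        apply (D1_comp (fun s => snd (Gam (phase u u1 s))) psi); [rewrite Epsi; exact HY|exact HDpsi].
    + split.
      * unfold locally', within.
        (* The identity [x (psi X) = X] near the pole shows that [psi] maps the punctured
           neighbourhood into a punctured one. *)
        apply (filter_imp (fun X => (psi X <> t -> u (psi X) <> None) /\ x (psi X) = X)).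
        { intros X [H1 H2] HX; apply H1; intros E; apply HX; rewrite <- H2, E; auto. }
        apply filter_and.
        { apply (Hloc (fun s => s <> t -> u s <> None)), punctured_finite; auto. }
        apply locally_C_intro.
        destruct (inv_x_near t1 r x x_contraction t Ht) as [del [Hdel H]]; exists del; split; auto.
        intros X HX; apply (H X HX).
      * destruct (reciprocal_pole t Ht Hc) as [d Hd]. exists (d * / dx0). apply is_derive_D1.
        apply (D1_comp (fun s => reciprocal (u s)) psi); [rewrite Epsi; exact Hd|exact HDpsi].
Qed.

End Solution.

Theorem corollary2 :
  exists (Gamma : C3 -> C3) (gamma eta eta1 : C3 -> C),
  forall x0 : C,
  exists rho eps : R,
    (1 <= rho)%R /\ (0 < eps < / 4)%R /\
    holomorphic_on (polydisk x0 rho eps) gamma /\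
    holomorphic_on (polydisk x0 rho eps) eta /\
    holomorphic_on (polydisk x0 rho eps) eta1 /\
    (forall t u u1 : C, tpolydisk x0 rho eps (t, u, u1) ->
       let z := tvw (t, u, u1) in
       Gamma (t, u, u1) = (gamma z, u, - u ^ 2 * eta z) /\
       - u ^ 2 * eta z = u1 * (1 + (u1 / u ^ 2) ^ 4 * eta1 z)) /\
    takes_into Gamma (tpolydisk x0 rho eps) F_painleve F_elliptic /\
    (forall p q : C3, tpolydisk x0 rho eps p -> tpolydisk x0 rho eps q ->
       Gamma p = Gamma q -> p = q) /\
    (forall (u : C -> option C) (u1 : C -> C) (t1 : C) (r : R),
       (0 < r)%R ->
       is_solution F_elliptic (fun t => (Cmod (t - t1) < r)%R) u u1 ->
       (forall z : C3, T_set u u1 t1 r z -> polydisk x0 rho eps z) ->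
       exists (y : C -> option C) (y1 : C -> C),
         (forall t : C, (Cmod (t - t1) < r)%R ->
            y (gamma (t, v_of u u1 t, w_of u u1 t)) = u t) /\
         is_solution F_painleve (image_set gamma (T_set u u1 t1 r)) y y1).
Proof.
  exists Gam, gamma, eta, eta1; intros x0; exists (rho_of x0), ep.
  split; [apply rho_of_ge_1|split; [apply ep_bound|]].
  assert (HH : forall z, polydisk x0 (rho_of x0) ep z -> diff3 gamma z /\ diff3 eta z /\ diff3 eta1 z)
    by (intros z Hz; now apply region_diff3, polydisk_region with x0).
  split; [|split; [|split; [|split; [|split; [|split]]]]].
  - intros z Hz; destruct (HH z Hz) as [[a [b [c H]]] _]. exact (D3_ex_filterdiff _ _ _ _ _ H).
  - intros z Hz; destruct (HH z Hz) as [_ [[a [b [c H]]] _]]. exact (D3_ex_filterdiff _ _ _ _ _ H).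
  - intros z Hz; destruct (HH z Hz) as [_ [_ [a [b [c H]]]]]. exact (D3_ex_filterdiff _ _ _ _ _ H).
  - intros t u u1 H; split; [reflexivity|].
    destruct (tpolydisk_region _ _ _ _ H) as [H1 [H2 _]]. now apply Gam_formula.
  - exact (takes_into_Gam _ (tpolydisk_region x0)).
  - intros [[t u] u1] [[t' u'] u1'] H H'.
    destruct (tpolydisk_region _ _ _ _ H) as [H1 [H2 H3]].
    destruct (tpolydisk_region _ _ _ _ H') as [H1' [H2' H3']].
    now apply Gam_injective.
  - intros u u1 t1 r _ Hsol HT. exact (transformed_solution x0 t1 r u u1 Hsol HT).
Qed.
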